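(* Let $\lambda_1,\mu_1,\lambda_2,\mu_2\in\mathbb{R}$ and set $K_i:=\lambda_i+\mu_i$ for $i=1,2$. Assume that $$0<\mu_1=-K_2<\mu_2,\qquad K_1>0.$$ Let $\mathbb{L}^1,\mathbb{L}^2$ be the isotropic stiffness tensors with Lamé coefficients $(\lambda_1,\mu_1)$ and $(\lambda_2,\mu_2)$ respectively. Let $\chi$ be the characteristic function of an open subset with Lipschitz boundary (phase 1, the inclusion) of the unit $2$-torus $\mathfrak{T}$, and assume that the set $\{\chi=0\}:=\{x\in\mathfrak{T}:\chi(x)=0\}$ is connected in $\mathfrak{T}$. Let $$\mathbb{L}(x)=\chi(x)\,\mathbb{L}^1+(1-\chi(x))\,\mathbb{L}^2,\qquad x\in\mathfrak{T},$$ and let $\mathbb{L}_*$ be the associated homogenized tensor. Assume further that $\mathbb{L}_*$ is isotropic, with bulk modulus $K_*$ and shear modulus $\mu_*$. Then $K_*+\mu_*>0$, that is, $\mathbb{L}_*$ is strictly strongly elliptic: there exists $c>0$ such that $M\cdot\mathbb{L}_*M\ge c|M|^2$ for all rank-one matrices $M=a\otimes b$, $a,b\in\mathbb{R}^2$.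
   Context: The space dimension is two; $\mathfrak{T}$ denotes the unit $2$-torus, and $A\cdot B=\sum_{p,q}A_{pq}B_{pq}$ is the Euclidean inner product of $2\times 2$ matrices, with associated norm $|\cdot|$. The isotropic stiffness tensor with Lamé coefficients $(\lambda,\mu)$ is the fourth-order tensor $$\mathbb{L}_{pqrs}=\lambda\,\delta_{pq}\delta_{rs}+\mu(\delta_{pr}\delta_{qs}+\delta_{ps}\delta_{qr}),\qquad p,q,r,s\in\{1,2\},$$ acting on $2\times2$ matrices by $(\mathbb{L}M)_{pq}=\sum_{r,s}\mathbb{L}_{pqrs}M_{rs}$, i.e. $\mathbb{L}M=\lambda\,\mathrm{tr}(M)\,I+\mu(M+M^T)$. Its shear modulus is $\mu$ and its (two-dimensional) bulk modulus is $K=\lambda+\mu$. A constant elasticity tensor is called isotropic if it is of this form for some $(\lambda,\mu)\in\mathbb{R}^2$. The homogenized tensor $\mathbb{L}_*$ is the constant symmetric fourth-order tensor given by the quadratic form $$M\cdot\mathbb{L}_*M=\min\left\{\int_{\mathfrak{T}}(M+\nabla v)\cdot\mathbb{L}(x)(M+\nabla v)\,dx\;:\;v\in H^1(\mathfrak{T};\mathbb{R}^2)\right\}$$ for all $2\times2$ matrices $M$. *)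

(* Defs.v *)
From HB Require Import structures.
From mathcomp Require Import all_boot all_order all_algebra.
From mathcomp Require Import generic_quotient.
From mathcomp Require Import all_classical all_reals all_analysis.

Set Implicit Arguments.
Unset Strict Implicit.
Unset Printing Implicit Defensive.

Import Order.TTheory GRing.Theory Num.Theory.
Import numFieldNormedType.Exports.

Local Open Scope classical_set_scope.
Local Open Scope ring_scope.
Local Open Scope quotient_scope.

Section Torus.
Variable R : realType.

Definition Z2_congr : rel (R * R) :=
  fun x y => (x.1 - y.1 \is a Num.int) && (x.2 - y.2 \is a Num.int).

Lemma Z2_congr_refl : reflexive Z2_congr.
Proof. by move=> x; rewrite /Z2_congr !subrr rpred0. Qed.

Lemma Z2_congr_sym : symmetric Z2_congr.
Proof.
by move=> x y; rewrite /Z2_congr -(opprB y.1) -(opprB y.2) !rpredN.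
Qed.

Lemma Z2_congr_trans : transitive Z2_congr.
Proof.
move=> y x z /andP[xy1 xy2] /andP[yz1 yz2]; rewrite /Z2_congr.
apply/andP; split; [rewrite -(subrKA y.1 x.1)|rewrite -(subrKA y.2 x.2)];
  exact: rpredD.
Qed.

Canonical Z2_congr_equiv :=
  EquivRel Z2_congr Z2_congr_refl Z2_congr_sym Z2_congr_trans.

Definition torus := {eq_quot Z2_congr_equiv}.
HB.instance Definition _ := Topological.copy torus (quotient_topology torus).
HB.instance Definition _ := Quotient.on torus.

Definition torus_pi (x : R * R) : torus := \pi_torus x.

Definition torus_lift (U : Type) (f : torus -> U) : R * R -> U := f \o torus_pi.

Local Notation plane := (measurableTypeR R * measurableTypeR R)%type.

Definition leb2 : {measure set plane -> \bar R} :=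
  (@lebesgue_measure R \x @lebesgue_measure R)%E.

(* Each point of the torus has exactly one representative in [cell]; integrals
   over the torus are integrals of lifts over [cell]. *)
Definition cell : set plane := `[0, 1[ `*` `[0, 1[.

Definition torus_int (f : torus -> R) : R :=
  \int[leb2]_(x in cell) torus_lift f x.

Definition torus_L2 (f : torus -> R) : Prop :=
  measurable_fun cell (torus_lift f : plane -> R) /\
  leb2.-integrable cell (fun x => ((torus_lift f x) ^+ 2)%:E).

Definition basis_vec (q : 'I_2) : R * R := ((q == 0)%:R, (q == 1)%:R).

Definition partial (q : 'I_2) (f : R * R -> R) : R * R -> R :=
  fun x => 'D_(basis_vec q) f x.

Fixpoint Cn (n : nat) (f : R * R -> R) : Prop :=
  continuous f /\
  if n is m.+1 then
    forall q : 'I_2, (forall x, derivable f x (basis_vec q)) /\ Cn m (partial q f)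
  else True.

Definition torus_smooth (phi : torus -> R) : Prop := forall n, Cn n (torus_lift phi).

(* The partial derivatives of a lift are periodic, so the choice of the
   representative [repr x] is immaterial. *)
Definition torus_partial (q : 'I_2) (phi : torus -> R) : torus -> R :=
  fun x => partial q (torus_lift phi) (repr x).

(* [G] is a weak gradient, with [G x p q] standing for d v_p / d x_q. *)
Definition H1_gradient (v : torus -> 'cV[R]_2) (G : torus -> 'M[R]_2) : Prop :=
  [/\ forall p, torus_L2 (fun x => v x p 0),
      forall p q, torus_L2 (fun x => G x p q)
    & forall (phi : torus -> R), torus_smooth phi -> forall p q,
        torus_int (fun x => v x p 0 * torus_partial q phi x) =
        - torus_int (fun x => G x p q * phi x)].

(* Near each boundary point, in some rotated orthonormal frame centred at that
   point, the set is the strict epigraph of a Lipschitz function. *)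
Definition Lipschitz_boundary (A : set torus) : Prop :=
  forall x : R * R,
    (closure A `\` A^°) (torus_pi x) ->
    exists (theta r : R) (g : R -> R),
      [/\ 0 < r, lipschitz g &
        forall s t : R, s ^+ 2 + t ^+ 2 < r ^+ 2 ->
          A (torus_pi (x.1 + s * cos theta - t * sin theta,
                       x.2 + s * sin theta + t * cos theta)) <-> g s < t].

End Torus.

Section Elasticity.
Variable R : realType.

Definition tensor4 : Type := 'I_2 -> 'I_2 -> 'I_2 -> 'I_2 -> R.

Definition mxdot (A B : 'M[R]_2) : R := \sum_p \sum_q A p q * B p q.

Definition tensor_act (L : tensor4) (M : 'M[R]_2) : 'M[R]_2 :=
  \matrix_(p, q) \sum_r \sum_s L p q r s * M r s.

Definition tensor_symmetric (L : tensor4) : Prop :=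
  forall p q r s, L p q r s = L r s p q.

Definition iso_tensor (lambda mu : R) : tensor4 := fun p q r s =>
  lambda * ((p == q)%:R * (r == s)%:R) +
  mu * ((p == r)%:R * (q == s)%:R + (p == s)%:R * (q == r)%:R).

Definition bulk_modulus (lambda mu : R) : R := lambda + mu.

Definition two_phase (chi : torus R -> R) (L1 L2 : tensor4) :
    torus R -> tensor4 :=
  fun x p q r s => chi x * L1 p q r s + (1 - chi x) * L2 p q r s.

Definition energy (L : torus R -> tensor4) (M : 'M[R]_2)
    (G : torus R -> 'M[R]_2) : R :=
  torus_int (fun x => mxdot (M + G x) (tensor_act (L x) (M + G x))).

Definition admissible_energies (L : torus R -> tensor4) (M : 'M[R]_2) : set R :=
  [set e | exists v G, H1_gradient v G /\ e = energy L M G].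

Definition is_homogenized (L : torus R -> tensor4) (Lstar : tensor4) : Prop :=
  tensor_symmetric Lstar /\
  forall M : 'M[R]_2,
    let m := mxdot M (tensor_act Lstar M) in
    admissible_energies L M m /\ lbound (admissible_energies L M) m.

Definition strictly_strongly_elliptic (L : tensor4) : Prop :=
  exists2 c : R, 0 < c &
    forall a b : 'cV[R]_2, let M := a *m b^T in
      c * mxdot M M <= mxdot M (tensor_act L M).

End Elasticity.

(* Main.v *)
From HB Require Import structures.
Require Import Defs.
From mathcomp Require Import all_boot all_order all_algebra.
From mathcomp Require Import generic_quotient.
From mathcomp Require Import all_classical all_reals all_analysis.
From mathcomp Require Import measurable_realfun.
From mathcomp Require Import ring lra.
Import Order.TTheory GRing.Theory Num.Theory.
Import numFieldNormedType.Exports.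
Local Open Scope classical_set_scope.
Local Open Scope ring_scope.

(** Let P be the local energy density plus 4 mu1 det. The relation
    mu1 = - K2 makes P a sum of squares with nonnegative coefficients: in
    phase 1 the traceless symmetric part of the strain drops out, in phase 2
    the trace does, and in both phases the skew part keeps the coefficient mu1
    ([energy_sos], [sos_density_ge0]). The determinant is a null Lagrangian:
    the mean of det (M + grad v) is det M ([total_field_det]). Hence the
    homogenized form plus 4 mu1 det M is the integral of P along a minimizer,
    which is nonnegative. The matrices e1 (x) e1 and e1 (x) e2, of determinant
    zero, give Kstar + mustar >= 0 and mustar >= 0.

    Equality forces P = 0 almost everywhere along a minimizer. If mustar = 0,
    the minimizing field for e1 (x) e2 is symmetric, which contradicts its mean
    ([shear_rigid]). If Kstar + mustar = 0, consider the minimizing fields F1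
    and F2 for e1 (x) e1 and e2 (x) e2. They are symmetric, traceless in phase 1
    and scalar in phase 2. A field f I whose rows are curl-free has constant f
    locally ([curlfree_scalar_cst]); as phase 2 is connected with Lipschitz
    boundary, F_i = k_i I throughout phase 2 ([scalar_field_cst]). The mean
    trace is 1, so 1 = 2 k_i theta with theta the area of phase 2; therefore
    theta > 0 and k_1 = k_2. The difference D of the two gradients is then
    symmetric and traceless everywhere, so that det D is minus a sum of squares
    of its entries; as det D has mean zero, D = 0. But in phase 2 the first entry
    of D is k_1 - k_2 - 1 = -1, a contradiction ([dilation_rigid]).

    The null Lagrangian property ([null_lagrangian]) comes from Parseval's
    identity for real Fourier series on the unit cell ([parseval]), itself a
    consequence of the density of trigonometric polynomials: they approximate
    indicators of quadrants, these generate the Borel sets, and indicators span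
    a dense subspace. The same property, in the polarised form that E1 H2 and
    E2 H1 have equal means for gradients E and H, is tested with tensor products
    of piecewise affine functions to obtain local constancy. Passing from local
    to global constancy needs one value at each point of phase 2, including its
    boundary points; there the region below a Lipschitz graph is connected and
    the graph is null ([boundary_value]). *)

Set Implicit Arguments.
Unset Strict Implicit.
Unset Printing Implicit Defensive.

(** * Square integrable functions *)

Import HBSimple HBNNSimple.

Section SquareIntegrable.
Context d (T : measurableType d) (R : realType).
Variables (mu : {measure set T -> \bar R}) (D : set T).
Hypothesis mD : measurable D.
Hypothesis muD : (mu D < +oo)%E.
Implicit Types f g h : T -> R.

Definition sqint f : Prop :=
  measurable_fun D f /\ mu.-integrable D (fun x => ((f x) ^+ 2)%:E).

Definition inner_product f g : R := \int[mu]_(x in D) (f x * g x).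
Local Notation ip := inner_product.

Lemma sqintM f g : sqint f -> sqint g -> mu.-integrable D (fun x => (f x * g x)%:E).
Proof.
move=> [mf f2] [mg g2].
apply: (@le_integrable _ _ _ mu D mD _ (fun x => ((f x) ^+ 2)%:E + ((g x) ^+ 2)%:E)%E).
- by apply/measurable_EFinP; exact: measurable_funM.
- move=> x Dx; rewrite lee_fin normrM.
  rewrite (ger0_norm (_ : 0 <= f x ^+ 2 + g x ^+ 2)); last by rewrite addr_ge0// sqr_ge0.
  rewrite -(real_normK (num_real (f x))) -(real_normK (num_real (g x))).
  have := sqr_ge0 (`|f x| - `|g x|); have := normr_ge0 (f x).
  have := normr_ge0 (g x); nra.
- exact: integrableD.
Qed.

Lemma sqint_bounded f (M : R) : measurable_fun D f ->
  (forall x, D x -> `|f x| <= M) -> sqint f.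
Proof.
move=> mf fM; split=> //.
apply: (@le_integrable _ _ _ mu D mD _ (fun x => (M ^+ 2)%:E)).
- by apply/measurable_EFinP; exact: measurable_funX.
- move=> x Dx; rewrite !abse_EFin lee_fin.
  rewrite !ger0_norm ?sqr_ge0// -(real_normK (num_real (f x))).
  have := fM x Dx; have := normr_ge0 (f x); nra.
- apply: measurable_bounded_integrable => //.
  exact: bounded_cst.
Qed.

Lemma sqintD f g : sqint f -> sqint g -> sqint (f \+ g).
Proof.
move=> sf sg; split; first by apply: measurable_funD; [apply: sf.1|apply: sg.1].
apply: (@eq_integrable _ _ _ mu D mD
  (fun x => (f x ^+ 2)%:E + ((2 * (f x * g x))%:E + (g x ^+ 2)%:E))%E).
  by move=> x _; rewrite -!EFinD; congr EFin; rewrite /=; ring.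
apply: integrableD => //; first by apply: sf.2.
apply: integrableD => //; last by apply: sg.2.
rewrite (_ : (fun x => _) = (fun x => (2%:E * (f x * g x)%:E)%E)); last first.
  by apply/funext => x; rewrite EFinM.
by apply: integrableZl => //; exact: sqintM.
Qed.

Lemma sqintZ k f : sqint f -> sqint (k \*o f).
Proof.
move=> [mf f2]; split; first by apply: measurable_funM.
rewrite (_ : (fun x => _) = (fun x => ((k ^+ 2)%:E * (f x ^+ 2)%:E)%E)); last first.
  by apply/funext => x; rewrite -EFinM /= exprMn.
exact: integrableZl.
Qed.

Lemma sqintB f g : sqint f -> sqint g -> sqint (f \- g).
Proof.
move=> sf sg; rewrite (_ : f \- g = f \+ (-1 \*o g)).
  by apply: sqintD => //; exact: sqintZ.
by apply/funext => x /=; rewrite mulN1r.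
Qed.

Lemma sqint_cst k : sqint (cst k).
Proof. exact: (@sqint_bounded _ `|k|). Qed.

Lemma sqint_le f g : measurable_fun D f -> sqint g ->
  (forall x, D x -> `|f x| <= `|g x|) -> sqint f.
Proof.
move=> mf [mg g2] fg; split=> //.
apply: (@le_integrable _ _ _ mu D mD _ (fun x => ((g x) ^+ 2)%:E)) => //.
  by apply/measurable_EFinP; exact: measurable_funX.
move=> x Dx; rewrite !abse_EFin lee_fin !ger0_norm ?sqr_ge0//.
rewrite -(real_normK (num_real (f x))) -(real_normK (num_real (g x))).
have := fg x Dx; have := normr_ge0 (f x); nra.
Qed.

Lemma sqintMb (b f : T -> R) (M : R) : measurable_fun D b -> (forall x, D x -> `|b x| <= M) ->
  sqint f -> sqint (b \* f).
Proof.
move=> mb bM sf; apply: (@sqint_le _ (M \*o f)); last 1 first.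
- move=> x Dx /=; rewrite !normrM ler_wpM2r// (le_trans (bM _ Dx))//.
  exact: ler_norm.
- by apply: measurable_funM => //; apply: sf.1.
- exact: sqintZ.
Qed.

Lemma sqint_int f : sqint f -> mu.-integrable D (EFin \o f).
Proof.
move=> sf; have := sqintM sf (sqint_cst 1).
by apply: eq_integrable => // x _; rewrite /= mulr1.
Qed.

Lemma ipC f g : ip f g = ip g f.
Proof. by apply: eq_Rintegral => x _; rewrite mulrC. Qed.

Lemma eq_ip f1 f2 g1 g2 : (forall x, D x -> f1 x = f2 x) ->
  (forall x, D x -> g1 x = g2 x) -> ip f1 g1 = ip f2 g2.
Proof.
by move=> f12 g12; apply: eq_Rintegral => x; rewrite inE => Dx; rewrite f12// g12.
Qed.

Lemma ipDl f1 f2 g : sqint f1 -> sqint f2 -> sqint g ->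
  ip (f1 \+ f2) g = ip f1 g + ip f2 g.
Proof.
move=> s1 s2 sg; rewrite /inner_product -RintegralD//; try exact: sqintM.
by apply: eq_Rintegral => x _; rewrite mulrDl.
Qed.

Lemma ipZl k f g : sqint f -> sqint g -> ip (k \*o f) g = k * ip f g.
Proof.
move=> sf sg; rewrite /inner_product -RintegralZl//; last exact: sqintM.
by apply: eq_Rintegral => x _; rewrite mulrA.
Qed.

Lemma ipBl f1 f2 g : sqint f1 -> sqint f2 -> sqint g ->
  ip (f1 \- f2) g = ip f1 g - ip f2 g.
Proof.
move=> s1 s2 sg; rewrite /inner_product -RintegralB//; try exact: sqintM.
by apply: eq_Rintegral => x _; rewrite mulrBl.
Qed.

Lemma ipDr f g1 g2 : sqint f -> sqint g1 -> sqint g2 ->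
  ip f (g1 \+ g2) = ip f g1 + ip f g2.
Proof. by move=> *; rewrite ipC ipDl// !(ipC f). Qed.

Lemma ipZr k f g : sqint f -> sqint g -> ip f (k \*o g) = k * ip f g.
Proof. by move=> *; rewrite ipC ipZl// (ipC f). Qed.

Lemma ipBr f g1 g2 : sqint f -> sqint g1 -> sqint g2 ->
  ip f (g1 \- g2) = ip f g1 - ip f g2.
Proof. by move=> *; rewrite ipC ipBl// !(ipC f). Qed.

Lemma Rintegral_ae_eq f g : measurable_fun D f -> measurable_fun D g ->
  {ae mu, forall x, D x -> f x = g x} ->
  \int[mu]_(x in D) f x = \int[mu]_(x in D) g x.
Proof.
move=> mf mg fg; congr fine; apply: ae_eq_integral => //; try exact/measurable_EFinP.
by apply: filterS fg => x h Dx; rewrite h.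
Qed.

Lemma ip_ae_eq f1 f2 g1 g2 : sqint f1 -> sqint f2 -> sqint g1 -> sqint g2 ->
  {ae mu, forall x, D x -> f1 x * g1 x = f2 x * g2 x} -> ip f1 g1 = ip f2 g2.
Proof.
move=> sf1 sf2 sg1 sg2; apply: Rintegral_ae_eq.
  by apply: measurable_funM; [exact: sf1.1|exact: sg1.1].
by apply: measurable_funM; [exact: sf2.1|exact: sg2.1].
Qed.

Lemma ip_ge0 f : 0 <= ip f f.
Proof. by apply: Rintegral_ge0 => x _; rewrite -expr2 sqr_ge0. Qed.

Lemma sqint_sum (I : Type) (r : seq I) (P : pred I) (F : I -> T -> R) :
  (forall i, sqint (F i)) -> sqint (fun x => \sum_(i <- r | P i) F i x).
Proof.
move=> sF; elim: r => [|i r IH].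
  rewrite (_ : (fun x => _) = cst 0); first exact: sqint_cst.
  by apply/funext => x; rewrite big_nil.
case: (boolP (P i)) => Pi; last first.
  rewrite (_ : (fun x => _) = (fun x => \sum_(i <- r | P i) F i x))//.
  by apply/funext => x; rewrite big_cons (negbTE Pi).
rewrite (_ : (fun x => _) = F i \+ (fun x => \sum_(i <- r | P i) F i x)).
  exact: sqintD.
by apply/funext => x; rewrite big_cons Pi.
Qed.

Lemma ip_suml (I : Type) (r : seq I) (P : pred I) (F : I -> T -> R) g :
  (forall i, sqint (F i)) -> sqint g ->
  ip (fun x => \sum_(i <- r | P i) F i x) g = \sum_(i <- r | P i) ip (F i) g.
Proof.
move=> sF sg; elim: r => [|i r IH].
  rewrite big_nil /ip (_ : (fun x => _) = cst 0) ?Rintegral_cst ?mul0r//.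
  by apply/funext => x; rewrite big_nil mul0r.
rewrite big_cons; case: ifPn => Pi.
  rewrite -IH -ipDl//; last exact: sqint_sum.
  by apply: eq_ip => // x Dx; rewrite big_cons Pi.
by rewrite -IH; apply: eq_ip => // x Dx; rewrite big_cons (negbTE Pi).
Qed.

Lemma ip_cauchy f g : sqint f -> sqint g -> ip f g ^+ 2 <= ip f f * ip g g.
Proof.
move=> sf sg.
have key t : 0 <= ip f f - 2 * t * ip f g + t ^+ 2 * ip g g.
  have := ip_ge0 (f \- (t \*o g)).
  have st := sqintZ t sg; have sft := sqintB sf st.
  rewrite ipBl// !ipBr// !ipZl// !ipZr// (ipC g f).
  by move=> h; apply: le_trans h _; rewrite le_eqVlt; apply/orP; left; apply/eqP; ring.
have [gg0|gg0] := eqVneq (ip g g) 0.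
  have [->|fg0] := eqVneq (ip f g) 0; first by rewrite gg0 mulr0 expr0n.
  have := key ((ip f f + 1) / (2 * ip f g)).
  rewrite gg0 mulr0 addr0 (_ : 2 * _ * _ = ip f f + 1); first by lra.
  by field.
have gp : 0 < ip g g by rewrite lt_neqAle eq_sym gg0 ip_ge0.
have := key (ip f g / ip g g).
rewrite (_ : _ + _ = (ip f f * ip g g - ip f g ^+ 2) / ip g g); last by field.
by rewrite pmulr_lge0 ?invr_gt0// subr_ge0.
Qed.

Lemma Rintegral_eq0_ae h : mu.-integrable D (EFin \o h) ->
  (forall x, D x -> 0 <= h x) -> \int[mu]_(x in D) h x = 0 ->
  {ae mu, forall x, D x -> h x = 0}.
Proof.
move=> ih h0 ih0; have mh := measurable_int _ ih.
have [+ _] := @ae_eq_integral_abs _ _ _ mu D mD (EFin \o h) mh.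
case.
  rewrite (eq_integral (EFin \o h)); last first.
    by move=> x; rewrite inE => Dx; rewrite gee0_abs// lee_fin h0.
  rewrite -[LHS]fineK; first by rewrite -[fine _]/(\int[mu]_(x in D) h x) ih0.
  exact: integrable_fin_num.
move=> N [mN N0 sN]; exists N; split => // x nx; apply: sN => /= H; apply: nx => Dx.
by have /= := H Dx; move=> [].
Qed.

Lemma ip_eq0_ae f : sqint f -> ip f f = 0 -> {ae mu, forall x, D x -> f x = 0}.
Proof.
move=> sf ff0; have [] := @Rintegral_eq0_ae (f \* f).
- exact: sqintM.
- by move=> x _; rewrite /= -expr2 sqr_ge0.
- exact: ff0.
move=> N [mN N0 sN]; exists N; split => // x nx; apply: sN => /= H; apply: nx => Dx.
by have /= /eqP := H Dx; rewrite mulf_eq0 => /orP[] /eqP.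
Qed.

Lemma Rintegral_dominated (F : nat -> T -> R) f g :
  (forall n, measurable_fun D (F n)) -> measurable_fun D f ->
  {ae mu, forall x, D x -> F ^~ x @ \oo --> f x} ->
  mu.-integrable D (EFin \o g) ->
  (forall n x, D x -> `|F n x| <= g x) ->
  (fun n => \int[mu]_(x in D) F n x) @ \oo --> \int[mu]_(x in D) f x.
Proof.
move=> mF mf Ff ig Fg.
have mF' n : measurable_fun D (EFin \o F n) by exact/measurable_EFinP.
have mf' : measurable_fun D (EFin \o f) by exact/measurable_EFinP.
have Ff' : {ae mu, forall x, D x -> (EFin \o F n) x @[n --> \oo] --> (EFin \o f) x}.
  apply: filterS Ff => x h Dx; apply: cvg_EFin; last exact: h.
  exact: nearW.
have Fg' : {ae mu, forall x n, D x -> (`|(EFin \o F n) x| <= (EFin \o g) x)%E}.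
  by apply: aeW => x n Dx; rewrite /= lee_fin Fg.
have [if_ _ cv] := @dominated_convergence _ _ _ mu D mD _ _ _ mF' mf' Ff' ig Fg'.
apply: fine_cvg; rewrite fineK; first exact: cv.
exact: integrable_fin_num.
Qed.

Lemma ip_dominated (F : nat -> T -> R) f G :
  (forall n, sqint (F n)) -> sqint f -> sqint G ->
  {ae mu, forall x, D x -> F ^~ x @ \oo --> f x} ->
  (forall n x, D x -> `|F n x| <= G x) -> (forall x, D x -> `|f x| <= G x) ->
  (fun n => ip (F n \- f) (F n \- f)) @ \oo --> 0.
Proof.
move=> sF sf sG Ff FG fG.
have sFf n : sqint (F n \- f) by exact: sqintB.
rewrite (_ : 0 = \int[mu]_(x in D) 0); last by rewrite Rintegral_cst// mul0r.
apply: (@Rintegral_dominated _ _ (fun x => 4 * (G x * G x))).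
- by move=> n; apply: measurable_funM; apply: (sFf n).1.
- exact: measurable_cst.
- apply: filterS Ff => x h Dx.
  rewrite [X in _ --> X](_ : 0 = (f x - f x) * (f x - f x)); last by rewrite subrr mul0r.
  by apply: cvgM; (apply: cvgB; [exact: h|exact: cvg_cst]).
- rewrite (_ : _ \o _ = (fun x => 4%:E * (G x * G x)%:E)%E); last first.
    by apply/funext => x; rewrite /= EFinM.
  by apply: integrableZl => //; exact: sqintM.
- move=> n x Dx; rewrite normrM /=.
  have h : `|F n x - f x| <= 2 * G x.
    by rewrite (le_trans (ler_normB _ _))//; have := FG n x Dx; have := fG x Dx; lra.
  by have := normr_ge0 (F n x - f x); nra.
Qed.

Lemma ip_cvg (F : nat -> T -> R) f h :
  (forall n, sqint (F n)) -> sqint f -> sqint h ->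
  (fun n => ip (F n \- f) (F n \- f)) @ \oo --> 0 ->
  (fun n => ip (F n) h) @ \oo --> ip f h.
Proof.
move=> sF sf sh cv; apply/cvgrPdist_lt => e e0.
have hh0 := ip_ge0 h.
have d0 : 0 < e ^+ 2 / (ip h h + 1) by rewrite divr_gt0 ?exprn_gt0// ltr_wpDl.
have {cv}/cvgrPdist_lt/(_ _ d0) := cv; apply: filterS => n.
rewrite sub0r normrN ger0_norm ?ip_ge0// ltr_pdivlMr ?ltr_wpDl// => ln.
rewrite distrC -ipBl// -(ltr_pXn2r (n:=2))// ?nnegrE ?normr_ge0 ?ltW//.
rewrite real_normK ?num_real//; apply: le_lt_trans ln.
have sFf : sqint (F n \- f) by exact: sqintB.
have := ip_cauchy sFf sh; have := ip_ge0 (F n \- f); nra.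
Qed.

(** Closure for the squared distance, for functions rather than for classes
    modulo null sets. *)
Definition L2closure (S : set (T -> R)) f : Prop :=
  sqint f /\ forall e, 0 < e -> exists2 p, S p & ip (f \- p) (f \- p) <= e.

Section Density.
Variable S : set (T -> R).
Hypothesis S_sqint : forall p, S p -> sqint p.
Hypothesis SD : forall p q, S p -> S q -> S (p \+ q).
Hypothesis SZ : forall k p, S p -> S (k \*o p).

Lemma ip_triangle f g h : sqint f -> sqint g -> sqint h ->
  ip (f \- h) (f \- h) <= 2 * ip (f \- g) (f \- g) + 2 * ip (g \- h) (g \- h).
Proof.
move=> sf sg sh; have sa := sqintB sf sg; have sb := sqintB sg sh.
rewrite (_ : f \- h = (f \- g) \+ (g \- h)); last first.
  by apply/funext => x /=; rewrite addrA subrK.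
have := ip_ge0 ((f \- g) \- (g \- h)).
rewrite !(ipBl sa sb, ipBr sa sa sb, ipBr sb sa sb) ?(ipDl sa sb)//; try exact: sqintB; try exact: sqintD.
rewrite !(ipDr _ sa sb)// (ipC (g \- h) (f \- g)); lra.
Qed.

Lemma L2closureS p : S p -> L2closure S p.
Proof.
move=> Sp; split; first exact: S_sqint.
move=> e e0; exists p => //; rewrite (_ : ip _ _ = 0) ?ltW//.
rewrite /inner_product (_ : (fun x => _) = cst 0) ?Rintegral_cst ?mul0r//.
by apply/funext => x /=; rewrite subrr mul0r.
Qed.

Lemma L2closureD f g : L2closure S f -> L2closure S g -> L2closure S (f \+ g).
Proof.
move=> [sf cf] [sg cg]; split; first exact: sqintD.
move=> e e0; have e4 : 0 < e / 4 by lra.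
have [p Sp fp] := cf _ e4; have [q Sq gq] := cg _ e4.
exists (p \+ q); first exact: SD.
have sp := S_sqint Sp; have sq := S_sqint Sq.
have := @ip_triangle (f \+ g) (p \+ g) (p \+ q) (sqintD sf sg) (sqintD sp sg) (sqintD sp sq).
rewrite (_ : (f \+ g) \- (p \+ g) = f \- p); last by apply/funext => x /=; ring.
rewrite (_ : (p \+ g) \- (p \+ q) = g \- q); last by apply/funext => x /=; ring.
lra.
Qed.

Lemma L2closureZ k f : L2closure S f -> L2closure S (k \*o f).
Proof.
move=> [sf cf]; split; first exact: sqintZ.
move=> e e0; have e1 : 0 < e / (k ^+ 2 + 1) by rewrite divr_gt0 ?ltr_wpDl ?sqr_ge0.
have [p Sp fp] := cf _ e1; exists (k \*o p); first exact: SZ.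
have sp := S_sqint Sp; have sfp := sqintB sf sp.
rewrite (_ : (k \*o f) \- (k \*o p) = k \*o (f \- p)); last by apply/funext => x /=; ring.
rewrite ipZl ?ipZr//; last exact: sqintZ.
move: fp; rewrite ler_pdivlMr; last by rewrite ltr_wpDl ?sqr_ge0.
have := ip_ge0 (f \- p); nra.
Qed.

Lemma L2closure_cvg (F : nat -> T -> R) f : (forall n, L2closure S (F n)) ->
  sqint f -> (fun n => ip (F n \- f) (F n \- f)) @ \oo --> 0 -> L2closure S f.
Proof.
move=> cF sf cv; split => // e e0; have e4 : 0 < e / 4 by lra.
have /cvgrPdist_lt/(_ _ e4) [n _ /(_ n (leqnn n))/=] := cv.
rewrite sub0r normrN ger0_norm ?ip_ge0// => ln.
have [sFn /(_ _ e4)[p Sp Fp]] := cF n; exists p => //.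
have := ip_triangle sf sFn (S_sqint Sp).
rewrite (_ : ip (f \- F n) (f \- F n) = ip (F n \- f) (F n \- f)); first by lra.
by apply: eq_Rintegral => x _ /=; ring.
Qed.

Hypothesis S_indic : forall E, measurable E -> L2closure S (\1_E : T -> R).

Lemma L2closure_nneg f : sqint f -> (forall x, D x -> 0 <= f x) -> L2closure S f.
Proof.
move=> sf f0.
have mf : measurable_fun D (EFin \o f) by apply/measurable_EFinP; exact: sf.1.
pose F n : T -> R := nnsfun_approx mD mf n.
have Ff x : D x -> F ^~ x @ \oo --> f x.
  move=> Dx; have := @cvg_nnsfun_approx _ _ _ _ mD _ mf _ x Dx.
  move=> /(_ _)/fine_cvgP; case; first by move=> y Dy; rewrite lee_fin f0.
  by move=> _; apply: cvg_trans.
have F0 n x : 0 <= F n x by [].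
have Fle n x : D x -> F n x <= f x.
  move=> Dx; rewrite /F nnsfun_approxE -lee_fin.
  by apply: (@le_approx _ _ _ D (EFin \o f)) => // y Dy; rewrite lee_fin f0.
have mF n : measurable_fun D (F n) by apply: measurable_funTS; exact: measurable_funP.
have sF n : sqint (F n).
  apply: (@sqint_le _ f) => // x Dx; rewrite !ger0_norm ?f0//; exact: Fle.
apply: (@L2closure_cvg F) => //; last first.
  apply: (@ip_dominated _ _ f) => //.
  - exact: aeW.
  - by move=> n x Dx; rewrite ger0_norm// Fle.
  - by move=> x Dx; rewrite ger0_norm// f0.
move=> n; rewrite (_ : F n = fun x => \sum_(y <- finmap.enum_fset (fset_set (range (F n)))) y * \1_(F n @^-1` [set y]) x).
  elim: (finmap.enum_fset _) => [|y r IH].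
    rewrite (_ : (fun x => _) = 0 \*o \1_setT); first exact/L2closureZ/S_indic.
    by apply/funext => x; rewrite big_nil /= mul0r.
  rewrite (_ : (fun x => _) = (y \*o \1_(F n @^-1` [set y])) \+
      (fun x => \sum_(z <- r) z * \1_(F n @^-1` [set z]) x)); last first.
    by apply/funext => x; rewrite big_cons.
  by apply: L2closureD => //; apply/L2closureZ/S_indic/measurable_sfunP.
apply/funext => x; rewrite /F {1}fimfunE fsbig_finite//=.
Qed.

(** Indicators give simple functions by linearity, increasing simple
    approximations give nonnegative functions by domination, and
    f = max f 0 - max (- f) 0. *)
Theorem L2_density f : sqint f -> L2closure S f.
Proof.
move=> sf; have mf := sf.1.
rewrite (_ : f = (fun x => Num.max (f x) 0) \+ (-1 \*o (fun x => Num.max (- f x) 0))); last first.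
  by apply/funext => x /=; case: (lerP (f x) 0) => h; case: (lerP (- f x) 0) => h'; lra.
apply: L2closureD; last apply: L2closureZ; apply: L2closure_nneg.
- apply: sqint_le sf _; first exact: measurable_maxr.
  by move=> x Dx; case: (lerP (f x) 0) => h; rewrite ?normr0.
- by move=> x Dx; rewrite le_max lexx orbT.
- apply: sqint_le sf _.
    by apply: measurable_maxr => //; exact: measurable_funN.
  by move=> x Dx; case: (lerP (- f x) 0) => h; rewrite ?normr0// normrN.
- by move=> x Dx; rewrite le_max lexx orbT.
Qed.

End Density.

Section OrthogonalFamily.
Variables (I : finType) (e : I -> T -> R) (w : I -> R).
Hypothesis e_sqint : forall i, sqint (e i).
Hypothesis e_orth : forall i j, i != j -> ip (e i) (e j) = 0.
(** Zero vectors are allowed, so that sines of frequency zero may stay in the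
    index set of a Fourier basis. *)
Hypothesis e_norm : forall i, e i = cst 0 \/ w i * ip (e i) (e i) = 1.

Definition orthproj f : T -> R := fun x => \sum_i (w i * ip f (e i)) * e i x.

Lemma orthproj_sqint f : sqint (orthproj f).
Proof. by apply: sqint_sum => i; exact: sqintZ. Qed.

Lemma ip_orthproj f g : sqint g ->
  ip (orthproj f) g = \sum_i w i * ip f (e i) * ip g (e i).
Proof.
move=> sg; rewrite /orthproj ip_suml//; last by move=> i; exact: sqintZ.
by apply: eq_bigr => i _; rewrite ipZl// (ipC g).
Qed.

Lemma orthproj_orth f i : sqint f -> ip (f \- orthproj f) (e i) = 0.
Proof.
move=> sf; rewrite ipBl//; last exact: orthproj_sqint.
rewrite ip_orthproj// (bigD1 i)//= big1 ?addr0; last first.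
  by move=> j ji; rewrite e_orth 1?eq_sym// mulr0.
have [ei|wi] := e_norm i; last by rewrite mulrAC wi mul1r subrr.
have -> : ip f (e i) = 0.
  by rewrite /inner_product (_ : (fun x => _) = cst 0) ?Rintegral_cst ?mul0r//; apply/funext => x; rewrite ei mulr0.
by rewrite mulr0 mul0r subrr.
Qed.

Lemma bessel f : sqint f -> ip (f \- orthproj f) (f \- orthproj f) <= ip f f.
Proof.
move=> sf; have sP := orthproj_sqint f; have sfP := sqintB sf sP.
have h0 : ip (orthproj f) (f \- orthproj f) = 0.
  by rewrite ip_orthproj// big1// => i _; rewrite orthproj_orth// mulr0.
have := ip_ge0 (orthproj f).
move: h0; rewrite !ipBr// !ipBl// (ipC f (orthproj f)); lra.
Qed.

Lemma orthproj_id j : orthproj (e j) = e j.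
Proof.
apply/funext => x; rewrite /orthproj (bigD1 j)//= big1 ?addr0; last first.
  by move=> i ij; rewrite e_orth 1?eq_sym// mulr0 mul0r.
by have [ej|wj] := e_norm j; [rewrite ej mulr0|rewrite wj mul1r].
Qed.

Lemma orthprojD f g : sqint f -> sqint g -> orthproj (f \+ g) = orthproj f \+ orthproj g.
Proof.
move=> sf sg; apply/funext => x; rewrite /orthproj /= -big_split.
by apply: eq_bigr => i _; rewrite /= ipDl// mulrDr mulrDl.
Qed.

Lemma orthprojZ k f : sqint f -> orthproj (k \*o f) = k \*o orthproj f.
Proof.
move=> sf; apply/funext => x; rewrite /orthproj /= big_distrr.
by apply: eq_bigr => i _; rewrite /= ipZl//; ring.
Qed.

(** A vector p fixed by the projection does not change the residual, so the
    residual of f is that of f - p, which Bessel's inequality bounds. *)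
Lemma orthproj_best f p : sqint f -> sqint p -> orthproj p = p ->
  ip (f \- orthproj f) (f \- orthproj f) <= ip (f \- p) (f \- p).
Proof.
move=> sf sp Pp; apply: le_trans (bessel (sqintB sf sp)).
rewrite (_ : f \- p = f \+ (-1 \*o p)); last by apply/funext => x /=; rewrite mulN1r.
have sp1 := sqintZ (-1) sp.
rewrite orthprojD// orthprojZ// Pp.
rewrite (_ : (f \+ (-1 \*o p)) \- (orthproj f \+ (-1 \*o p)) = f \- orthproj f)//.
by apply/funext => x /=; ring.
Qed.

End OrthogonalFamily.

End SquareIntegrable.

(** * Lebesgue measure on the plane *)

Section Plane.
Variable R : realType.
Local Notation plane := (measurableTypeR R * measurableTypeR R)%type.
Local Notation leb := (@lebesgue_measure R).
Local Notation leb2 := (leb2 R).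
Local Notation cell := (@cell R).

Lemma measurable_cell : measurable (cell : set plane).
Proof. by apply: measurableX; exact: measurable_itv. Qed.

Lemma leb2X (A B : set (measurableTypeR R)) : measurable A -> measurable B ->
  leb2 (A `*` B) = (leb A * leb B)%E.
Proof. by move=> mA mB; exact: product_measure1E. Qed.

Lemma leb2_cell : leb2 cell = 1%E.
Proof.
rewrite leb2X ?lebesgue_measure_itv /= ?lte_fin ?ltr01 ?oppr0 ?adde0 ?mule1//.
all: exact: measurable_itv.
Qed.

Lemma leb2_cell_fin : (leb2 cell < +oo)%E.
Proof. by rewrite leb2_cell ltry. Qed.

Let rays : set (set R) := [set A | A = setT \/ exists r, A = `]-oo, r[%classic].

Lemma measurable_quadrants :
  @measurable _ plane = <<s [set A `*` B | A in rays & B in rays] >>.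
Proof.
set G := [set A `*` B | A in rays & B in rays].
apply/seteqP; split; last first.
  apply: smallest_sub; first exact: sigma_algebra_measurable.
  have mr A : rays A -> measurable (A : set (measurableTypeR R)).
    by move=> [->|[r ->]]; [exact: measurableT|exact: measurable_itv].
  by move=> _ [A rA [B rB <-]]; apply: measurableX; exact: mr.
pose T := g_sigma_algebraType G.
have mG (A B : set R) : rays A -> rays B -> @measurable _ T (A `*` B).
  by move=> rA rB; apply: sub_sigma_algebra; exists A => //; exists B.
have m1 : measurable_fun setT (fst : T -> measurableTypeR R).
  apply: (measurability _ (RGenInftyO.measurableE R)) => //.
  move=> _ [_ [r ->] <-]; rewrite setTI (_ : _ @^-1` _ = `]-oo, r[%classic `*` setT).
    by apply: mG; [right; exists r|left].
  by apply/seteqP; split=> [x ?|x []].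
have m2 : measurable_fun setT (snd : T -> measurableTypeR R).
  apply: (measurability _ (RGenInftyO.measurableE R)) => //.
  move=> _ [_ [r ->] <-]; rewrite setTI (_ : _ @^-1` _ = setT `*` `]-oo, r[%classic).
    by apply: mG; [left|right; exists r].
  by apply/seteqP; split=> [x ?|x []].
apply: smallest_sub; first exact: (@sigma_algebra_measurable _ T).
move=> X [|] [A mA <-]; [exact: m1|exact: m2].
Qed.

(** The pi-lambda theorem. The indicator of a product of half-lines is a tensor
    product of functions of one variable, which is the only shape that has to
    be approximated or tested by hand. *)
Lemma quadrant_induction (P : set (set plane)) :
  P setT ->
  (forall A B, A = setT \/ (exists r, A = `]-oo, r[%classic) ->
     B = setT \/ (exists r, B = `]-oo, r[%classic) -> P (A `*` B)) ->
  (forall E, measurable E -> P E -> P (~` E)) ->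
  (forall F : (set plane)^nat, (forall n, measurable (F n)) ->
     trivIset setT F -> (forall n, P (F n)) -> P (\bigcup_n F n)) ->
  forall E, measurable E -> P E.
Proof.
move=> PT PG PC PU E; rewrite measurable_quadrants.
apply: (@dynkin_induction _ plane) => //.
- exact: measurable_quadrants.
- move=> _ _ [A1 rA1 [B1 rB1 <-]] [A2 rA2 [B2 rB2 <-]].
  have raysI A B : rays A -> rays B -> rays (A `&` B).
    move=> [->|[r ->]]; first by rewrite setTI.
    move=> [->|[s ->]]; first by rewrite setIT; right; exists r.
    right; exists (Num.min r s); apply/seteqP; split=> x /=.
      by rewrite !in_itv/= lt_min => -[-> ->].
    by rewrite !in_itv/= lt_min => /andP[].
  exists (A1 `&` A2); first exact: raysI.
  by exists (B1 `&` B2); [exact: raysI|rewrite setXI].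
- by move=> _ [A rA [B rB <-]]; exact: PG.
Qed.

Definition translate (a x : plane) : plane := (x.1 + a.1, x.2 + a.2).

Lemma measurable_shift1 (a : R) :
  measurable_fun setT (fun x : measurableTypeR R => x + a : measurableTypeR R).
Proof. by apply: measurable_funD => //; exact: measurable_cst. Qed.

Lemma measurable_shift a : measurable_fun setT (translate a).
Proof.
apply: measurable_fun_pair.
  exact: (measurableT_comp (measurable_shift1 a.1) measurable_fst).
exact: (measurableT_comp (measurable_shift1 a.2) measurable_snd).
Qed.

Lemma leb_shift (a : R) (A : set (measurableTypeR R)) : measurable A ->
  leb ((fun x => x + a) @^-1` A) = leb A.
Proof.
move=> mA.
pose f : {mfun measurableTypeR R >-> measurableTypeR R} :=
  HB.pack (fun x : measurableTypeR R => x + a : measurableTypeR R)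
    (isMeasurableFun.Build _ _ _ _ _ (measurable_shift1 a)).
rewrite -[LHS]/(pushforward leb f A); apply/esym/lebesgue_measure_unique => //.
move=> _ [[u v] _ <-] /=; rewrite /pushforward.
rewrite (_ : f @^-1` _ = `]u - a, v - a]%classic); last first.
  by apply/seteqP; split => x /=; rewrite !in_itv/= ltrBlDr lerBrDr.
rewrite !lebesgue_measure_itv /= !lte_fin ltrD2r; case: ifP => // _.
by rewrite -!EFinB; congr EFin; ring.
Qed.

Lemma leb2_shift a (A : set plane) : measurable A -> leb2 (translate a @^-1` A) = leb2 A.
Proof.
move=> mA.
pose f : {mfun plane >-> plane} :=
  HB.pack (translate a) (isMeasurableFun.Build _ _ _ _ _ (measurable_shift a)).
rewrite -[LHS]/(pushforward leb2 f A); apply/esym/product_measure_unique => //.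
move=> B C mB mC; have m1 (b : R) (X : set (measurableTypeR R)) : measurable X ->
    measurable ((fun x : measurableTypeR R => x + b) @^-1` X).
  by move=> mX; rewrite -[X in measurable X]setTI; exact: measurable_shift1.
change (leb2 (((fun x => x + a.1) @^-1` B) `*` ((fun x => x + a.2) @^-1` C)) = (leb B * leb C)%E).
by rewrite leb2X; [rewrite !leb_shift|exact: m1|exact: m1].
Qed.

Lemma measurable_preimage_shift a (A : set plane) : measurable A ->
  measurable (translate a @^-1` A).
Proof. by move=> mA; rewrite -[X in measurable X]setTI; exact: measurable_shift. Qed.

Lemma negligible_shift a (N : set plane) : leb2.-negligible N ->
  leb2.-negligible (translate a @^-1` N).
Proof.
move=> [A [mA A0 NA]]; exists (translate a @^-1` A); split.
- exact: measurable_preimage_shift.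
- by rewrite leb2_shift.
- by move=> x /NA.
Qed.

Definition sqbox (x : R * R) (r : R) : set (R * R) :=
  [set y | `|y.1 - x.1| < r /\ `|y.2 - x.2| < r].

Let ratbox (t : rat * rat * rat) : set (R * R) :=
  sqbox (ratr t.1.1, ratr t.1.2) (ratr t.2).

Lemma ratbox_dense x d : 0 < d -> exists t, ratbox t x /\ ratbox t `<=` sqbox x d.
Proof.
move=> d0; have d4 : d / 4 < d / 2 by lra.
have [r] := rat_in_itvoo d4; rewrite in_itv/= => /andP[r1 r2].
have xr (z : R) : z < z + ratr r by rewrite ltrDl; lra.
have [p] := rat_in_itvoo (xr x.1); rewrite in_itv/= => /andP[p1 p2].
have [q] := rat_in_itvoo (xr x.2); rewrite in_itv/= => /andP[q1 q2].
exists (p, q, r); split.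
  by split=> /=; rewrite ltr_norml; lra.
by move=> y [] /=; rewrite !ltr_norml => *; split; rewrite ltr_norml; lra.
Qed.

Lemma measurable_sqbox x r : @measurable _ plane (sqbox x r).
Proof.
rewrite (_ : sqbox x r = `]x.1 - r, x.1 + r[%classic `*` `]x.2 - r, x.2 + r[%classic).
  by apply: measurableX; exact: measurable_itv.
by apply/seteqP; split=> y [] /=; rewrite ?in_itv/= ?ltr_norml => *; split; rewrite ?in_itv/= ?ltr_norml; lra.
Qed.

Lemma nbhs_sqbox (x : R * R) (A : set (R * R)) :
  nbhs x A <-> exists2 r, 0 < r & sqbox x r `<=` A.
Proof.
split.
  move=> /nbhs_ballP[r /= r0 xA]; exists r => // y [y1 y2]; apply: xA.
  by split; rewrite /ball/= distrC.
move=> [r r0 xA]; apply/nbhs_ballP; exists r => //= y [y1 y2]; apply: xA.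
by move: y1 y2; rewrite /ball/= => y1 y2; split; rewrite distrC.
Qed.

Lemma ae_mono (P Q : plane -> Prop) : (forall x, P x -> Q x) ->
  {ae leb2, forall x, P x} -> {ae leb2, forall x, Q x}.
Proof. by move=> PQ; apply: filterS. Qed.

Lemma ae_and (P Q : plane -> Prop) : {ae leb2, forall x, P x} ->
  {ae leb2, forall x, Q x} -> {ae leb2, forall x, P x /\ Q x}.
Proof. by move=> p q; apply: filterI. Qed.

Lemma negligible_bigcup_count (K : countType) (F : K -> set plane) :
  (forall k, leb2.-negligible (F k)) -> leb2.-negligible (\bigcup_k F k).
Proof.
move=> nF; apply: (@negligibleS _ _ _ _ (\bigcup_n oapp F set0 (unpickle n))).
  by move=> x [k _ Fx]; exists (pickle k) => //; rewrite pickleK.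
by apply: negligible_bigcup => n; case: unpickle => [k|] /=; [exact: nF|exact: negligible_set0].
Qed.

Lemma measurable_bigcup_count (K : countType) (F : K -> set plane) :
  (forall k, measurable (F k)) -> measurable (\bigcup_k F k).
Proof. by move=> mF; apply: countable_bigcupT_measurable => //; exact: countableP. Qed.

Lemma open_plane_measurable (A : set (R * R)) : open A -> @measurable _ plane A.
Proof.
move=> oA; pose F t := if `[< ratbox t `<=` A >] then ratbox t else set0.
rewrite (_ : A = \bigcup_t F t).
  apply: measurable_bigcup_count => t; rewrite /F.
  by case: ifP => // _; exact: measurable_sqbox.
apply/seteqP; split=> [x Ax|x [t _]]; last first.
  by rewrite /F; case: ifP => // /asboolP; apply.
have /nbhs_sqbox[r r0 rA] : nbhs x A by exact: open_nbhs_nbhs.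
have [t [tx tr]] := ratbox_dense x r0.
exists t => //; rewrite /F ifT//; apply/asboolP.
exact: subset_trans tr rA.
Qed.

(** Lindelof: countably many squares with rational centre and radius, each
    meeting N in a null set, cover N. *)
Lemma locally_negligible (N : set plane) :
  (forall x, N x -> exists2 r, 0 < r & leb2.-negligible (N `&` sqbox x r)) ->
  leb2.-negligible N.
Proof.
move=> H; pose F t := if `[< leb2.-negligible (N `&` ratbox t) >] then N `&` ratbox t else set0.
apply: (@negligibleS _ _ _ _ (\bigcup_t F t)).
  move=> x Nx; have [r r0 h] := H _ Nx; have [t [tx tr]] := ratbox_dense x r0.
  exists t => //; rewrite /F ifT//; apply/asboolP.
  by apply: negligibleS h => y [Ny /tr].
apply: negligible_bigcup_count => t; rewrite /F.
by case: ifP => [/asboolP//|_]; exact: negligible_set0.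
Qed.

Definition periodic2 (U : Type) (f : plane -> U) :=
  forall x y, Z2_congr x y -> f x = f y.

Definition Z2vec (k : int * int) : plane := (k.1%:~R, k.2%:~R).

Lemma Z2_congr_shift k x : Z2_congr x (translate (Z2vec k) x).
Proof.
by rewrite /Z2_congr /translate /= !opprD !addrA !subrr !add0r !rpredN !intr_int.
Qed.

Lemma cell_representative (x : plane) : exists k, cell (translate (Z2vec k) x).
Proof.
exists (- Num.floor x.1, - Num.floor x.2); split; rewrite /= in_itv/= !intrN.
  by have := floor_itv x.1; rewrite intrD; lra.
by have := floor_itv x.2; rewrite intrD; lra.
Qed.

(** Measurability and negligibility of periodic sets can thus be read off from
    the unit cell, countably many integer translates being enough. *)
Lemma periodic_cover (N : set plane) : periodic2 N ->
  N = \bigcup_k translate (Z2vec k) @^-1` (N `&` cell).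
Proof.
move=> pN; apply/seteqP; split=> [x Nx|x [k _] [/=]].
  have [k ck] := cell_representative x; exists k => //; split=> //.
  by rewrite /= -(pN _ _ (Z2_congr_shift k x)).
by rewrite -(pN _ _ (Z2_congr_shift k x)).
Qed.

Lemma negligible_periodic (N : set plane) : periodic2 N ->
  leb2.-negligible (N `&` cell) -> leb2.-negligible N.
Proof.
move=> pN nN; rewrite (periodic_cover pN).
by apply: negligible_bigcup_count => k; exact: negligible_shift.
Qed.

Lemma measurable_periodic (f : plane -> R) : periodic2 f ->
  measurable_fun cell f -> measurable_fun setT f.
Proof.
move=> pf mf _ B mB; rewrite setTI (periodic_cover (N := f @^-1` B)); last first.
  by move=> x y /pf fxy; rewrite /preimage /= fxy.
apply: measurable_bigcup_count => k.
by apply: measurable_preimage_shift; rewrite setIC; apply: mf => //; exact: measurable_cell.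
Qed.

Lemma ge0_integral_shift a (D : set plane) (F : plane -> \bar R) :
  measurable D -> measurable_fun setT F -> (forall x, 0 <= F x)%E ->
  (\int[leb2]_(x in translate a @^-1` D) F (translate a x) = \int[leb2]_(x in D) F x)%E.
Proof.
move=> mD mF F0.
have H := @ge0_integral_pushforward _ _ _ _ _ _ (measurable_shift a) leb2 D F mD
  (measurable_funTS mF) (fun y _ => F0 y).
apply: etrans (esym H) _.
pose f : {mfun plane >-> plane} :=
  HB.pack (translate a) (isMeasurableFun.Build _ _ _ _ _ (measurable_shift a)).
exact: (eq_measure_integral leb2 (m1 := pushforward leb2 f)
  (fun A mA _ => leb2_shift a mA)).
Qed.

Section PeriodicIntegral.
Variable F : plane -> \bar R.
Hypothesis F_per : periodic2 F.
Hypothesis mF : measurable_fun setT F.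
Hypothesis F0 : forall x, (0 <= F x)%E.

Let J (u v : R) := (\int[leb2]_(x in (`[u, (u + 1)%R[ `*` `[v, (v + 1)%R[)) F x)%E.

Let itvX (a b c d : R) : @measurable _ plane (`[a, b[ `*` `[c, d[).
Proof. by apply: measurableX; exact: measurable_itv. Qed.

Let int_itvX (k : int * int) (a b c d : R) :
  (\int[leb2]_(x in (`[a, b[ `*` `[c, d[)) F x =
   \int[leb2]_(x in (`[(a + k.1%:~R)%R, (b + k.1%:~R)%R[ `*` `[(c + k.2%:~R)%R, (d + k.2%:~R)%R[)) F x)%E.
Proof.
rewrite -[RHS](@ge0_integral_shift (Z2vec k))//.
rewrite (_ : _ @^-1` _ = `[a, b[ `*` `[c, d[); last first.
  by apply/seteqP; split=> x [] /=; rewrite !in_itv/= !lerD2r !ltrD2r.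
by apply: eq_integral => x _; apply: F_per; exact: Z2_congr_shift.
Qed.

(** The strip lost when the square moves right is an integer translate of the
    strip gained. *)
Let J_right u u' v : u <= u' -> u' <= u + 1 -> J u v = J u' v.
Proof.
move=> uu' u'u; rewrite /J.
have E : (`[u, u + 1[ `*` `[v, v + 1[) =
   (`[u, u'[ `*` `[v, v + 1[) `|` (`[u', u + 1[ `*` `[v, v + 1[) :> set plane.
  apply/seteqP; split=> x /=; rewrite !in_itv/=.
    by move=> [/andP[? ?] ?]; case: (ltP x.1 u') => ?; [left|right]; split=> //; apply/andP.
  by move=> [|] [/andP[? ?] ?]; split=> //; lra.
have E' : (`[u', u' + 1[ `*` `[v, v + 1[) =
   (`[u + 1, u' + 1[ `*` `[v, v + 1[) `|` (`[u', u + 1[ `*` `[v, v + 1[) :> set plane.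
  apply/seteqP; split=> x /=; rewrite !in_itv/=.
    by move=> [/andP[? ?] ?]; case: (leP (u + 1) x.1) => ?; [left|right]; split=> //; apply/andP.
  by move=> [|] [/andP[? ?] ?]; split=> //; lra.
rewrite E E' !ge0_integral_setU//; try exact: measurable_funTS.
- by rewrite (int_itvX (1, 0) u) /= !addr0.
- apply/disj_set2P/seteqP; split=> // x [] [] /=; rewrite !in_itv/=; lra.
- apply/disj_set2P/seteqP; split=> // x [] [] /=; rewrite !in_itv/=; lra.
Qed.

Let J_up u v v' : v <= v' -> v' <= v + 1 -> J u v = J u v'.
Proof.
move=> vv' v'v; rewrite /J.
have E : (`[u, u + 1[ `*` `[v, v + 1[) =
   (`[u, u + 1[ `*` `[v, v'[) `|` (`[u, u + 1[ `*` `[v', v + 1[) :> set plane.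
  apply/seteqP; split=> x /=; rewrite !in_itv/=.
    by move=> [? /andP[? ?]]; case: (ltP x.2 v') => ?; [left|right]; split=> //; apply/andP.
  by move=> [|] [? /andP[? ?]]; split=> //; lra.
have E' : (`[u, u + 1[ `*` `[v', v' + 1[) =
   (`[u, u + 1[ `*` `[v + 1, v' + 1[) `|` (`[u, u + 1[ `*` `[v', v + 1[) :> set plane.
  apply/seteqP; split=> x /=; rewrite !in_itv/=.
    by move=> [? /andP[? ?]]; case: (leP (v + 1) x.2) => ?; [left|right]; split=> //; apply/andP.
  by move=> [|] [? /andP[? ?]]; split=> //; lra.
rewrite E E' !ge0_integral_setU//; try exact: measurable_funTS.
- by rewrite (int_itvX (0, 1) u) /= !addr0.
- apply/disj_set2P/seteqP; split=> // x [] [] /=; rewrite !in_itv/=; lra.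
- apply/disj_set2P/seteqP; split=> // x [] [] /=; rewrite !in_itv/=; lra.
Qed.

Lemma ge0_integral_cell_shift a :
  (\int[leb2]_(x in cell) F (translate a x) = \int[leb2]_(x in cell) F x)%E.
Proof.
transitivity (J a.1 a.2).
  rewrite /J -[RHS](@ge0_integral_shift a)//.
  rewrite (_ : translate a @^-1` _ = cell)//.
  by apply/seteqP; split=> x; rewrite /Defs.cell /translate /= !in_itv/= => -[? ?]; split; lra.
pose f1 := Num.floor a.1; pose f2 := Num.floor a.2.
have := floor_itv a.1; have := floor_itv a.2; rewrite !intrD.
move=> /andP[h2 g2] /andP[h1 g1].
rewrite -(@J_right f1%:~R)//; last exact/ltW.
rewrite -(@J_up _ f2%:~R)//; last exact/ltW.
apply: etrans _ (esym (int_itvX (f1, f2) 0 1 0 1)).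
by rewrite /J !add0r !(addrC 1).
Qed.

End PeriodicIntegral.

Lemma Rintegral_cell_shift a (f : plane -> R) : periodic2 f ->
  measurable_fun setT f ->
  \int[leb2]_(x in cell) f (translate a x) = \int[leb2]_(x in cell) f x.
Proof.
move=> pf mf; rewrite /Rintegral; congr fine.
have mE : measurable_fun setT (EFin \o f) by apply/measurable_EFinP.
rewrite integralE [RHS]integralE; congr (_ - _)%E.
  have H : periodic2 ((EFin \o f)^\+)%E by move=> x y /pf fxy; rewrite !funeposE /= fxy.
  rewrite -[RHS](ge0_integral_cell_shift H (measurable_funepos mE) _ a)//.
  by apply: eq_integral => x _; rewrite !funeposE.
have H : periodic2 ((EFin \o f)^\-)%E by move=> x y /pf fxy; rewrite !funenegE /= fxy.
rewrite -[RHS](ge0_integral_cell_shift H (measurable_funeneg mE) _ a)//.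
by apply: eq_integral => x _; rewrite !funenegE.
Qed.

Local Notation itv01 := (`[0, 1[%classic : set (measurableTypeR R)).

Definition tens (f g : R -> R) : plane -> R := fun x => f x.1 * g x.2.

(** One-variable factors for which Fubini needs no integrability check. *)
Definition bdd (f : R -> R) : Prop :=
  measurable_fun itv01 f /\ exists M, forall x, itv01 x -> `|f x| <= M.

Lemma bddD (f g : R -> R) : bdd f -> bdd g -> bdd (f \+ g).
Proof.
move=> [mf [M fM]] [mg [N gN]]; split; first exact: measurable_funD.
by exists (M + N) => x Dx; rewrite (le_trans (ler_normD _ _))// lerD ?fM// gN.
Qed.

Lemma bddZ c (f : R -> R) : bdd f -> bdd (c \*o f).
Proof.
move=> [mf [M fM]]; split; first exact: measurable_funM.
by exists (`|c| * M) => x Dx; rewrite /= normrM ler_wpM2l// fM.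
Qed.

Lemma bddM (f g : R -> R) : bdd f -> bdd g -> bdd (f \* g).
Proof.
move=> [mf [M fM]] [mg [N gN]]; split; first exact: measurable_funM.
by exists (M * N) => x Dx; rewrite normrM ler_pM// ?fM// gN.
Qed.

Lemma leb_itv01 : leb itv01 = 1%E.
Proof. by rewrite lebesgue_measure_itv /= lte_fin ltr01 oppr0 adde0. Qed.

Lemma bdd_int f : bdd f -> leb.-integrable itv01 (EFin \o f).
Proof.
move=> [mf [M fM]]; apply: measurable_bounded_integrable => //.
- by rewrite -[X in (X < _)%E]/(leb itv01) leb_itv01 ltry.
- exists M; split; first exact: num_real.
  by move=> N MN x Dx; apply: le_trans (fM _ Dx) (ltW MN).
Qed.

Lemma tens_restrict f g : (tens f g) \_ cell = tens (f \_ itv01) (g \_ itv01).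
Proof.
apply/funext => x; rewrite /tens /patch /cell in_setX.
by case: (x.1 \in _); case: (x.2 \in _); rewrite /= ?mulr0 ?mul0r.
Qed.

Lemma bdd_restrict f : bdd f -> measurable_fun setT (f \_ itv01).
Proof.
by move=> [mf _]; apply/(measurable_restrictT _ _).1 => //; exact: measurable_itv.
Qed.

Lemma tens_sqint f g : bdd f -> bdd g -> sqint leb2 cell (tens f g).
Proof.
move=> bf bg; have [mf [M fM]] := bf; have [mg [N gN]] := bg.
apply: (@sqint_bounded _ _ _ leb2 cell measurable_cell leb2_cell_fin _ (M * N)).
  apply/(measurable_restrictT _ _).2; first exact: measurable_cell.
  rewrite tens_restrict; apply: measurable_funM.
    exact: (measurableT_comp (bdd_restrict bf) measurable_fst).
  exact: (measurableT_comp (bdd_restrict bg) measurable_snd).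
by move=> x [x1 x2]; rewrite normrM ler_pM//; [exact: fM|exact: gN].
Qed.

Lemma Rintegral_tens f g : bdd f -> bdd g ->
  \int[leb2]_(x in cell) tens f g x =
  (\int[leb]_(x in itv01) f x) * (\int[leb]_(x in itv01) g x).
Proof.
move=> bf bg; have sfg := tens_sqint bf bg.
rewrite Rintegral_mkcond (Rintegral_mkcond leb itv01 f) (Rintegral_mkcond leb itv01 g).
have ifg : leb2.-integrable setT (EFin \o (tens f g \_ cell)).
  rewrite -restrict_EFin; apply/integrable_restrict => //; first exact: measurable_cell.
  by rewrite setTI; apply: sqint_int sfg; [exact: measurable_cell|exact: leb2_cell_fin].
have i1 (h : R -> R) : bdd h -> leb.-integrable setT (EFin \o (h \_ itv01)).
  move=> bh; rewrite -restrict_EFin; apply/integrable_restrict => //.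
  by rewrite setTI; exact: bdd_int.
rewrite {1}/Rintegral -(integral12_prod_meas1 ifg) /fubini_F.
under eq_integral => x _.
  under eq_integral => y _ do rewrite /= tens_restrict /tens /= EFinM.
  rewrite integralZl//; last exact: i1.
  over.
have Ig : (\int[leb]_y ((g \_ itv01) y)%:E = (\int[leb]_y (g \_ itv01) y)%:E)%E.
  by rewrite fineK//; apply: integrable_fin_num => //; exact: i1.
rewrite /= Ig.
by rewrite integralZr ?fineM//=; [apply: integrable_fin_num => //; exact: i1|exact: i1].
Qed.

End Plane.

(** * Trigonometric polynomials *)

Section Trig.
Variable R : realType.
Local Notation leb := (@lebesgue_measure R).
Local Notation itv01 := (`[0, 1[%classic : set (measurableTypeR R)).

Definition twopi : R := pi *+ 2.

(** The boolean selects the sine. Differentiation negates it, up to a scalar,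
    which treats both waves at once. *)
Definition wave (b : bool) (k : nat) (x : R) : R :=
  if b then sin (k%:R * twopi * x) else cos (k%:R * twopi * x).

(** Real trigonometric polynomials of period 1. *)
Inductive trig : (R -> R) -> Prop :=
| trig_wave b k : trig (wave b k)
| trigD f g : trig f -> trig g -> trig (f \+ g)
| trigZ c f : trig f -> trig (c \*o f).

Definition wave_sign (b : bool) : R := if b then 1 else -1.

Lemma is_derive_wave b k (x : R) :
  is_derive x 1 (wave b k) (wave_sign b * (k%:R * twopi) * wave (~~ b) k x).
Proof.
have H : is_derive x 1 (fun y : R => k%:R * twopi * y) (k%:R * twopi).
  rewrite (_ : (fun y => _) = (k%:R * twopi) \*: (@idfun R)) //.
  by apply: is_derive_eq; rewrite /GRing.scale /= mulr1.
case: b; rewrite /wave /wave_sign /=.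
  have := @is_derive1_comp _ (@sin R) (fun y : R => k%:R * twopi * y) x _ _ _ H.
  by move=> /(_ _ (is_derive_sin _)) h; apply: is_derive_eq h _; ring.
have := @is_derive1_comp _ (@cos R) (fun y : R => k%:R * twopi * y) x _ _ _ H.
by move=> /(_ _ (is_derive_cos _)) h; apply: is_derive_eq h _; ring.
Qed.

Lemma trig_derive f : trig f -> exists2 g, trig g & forall x : R, is_derive x 1 f (g x).
Proof.
elim=> [b k|{}f h _ [f' tf' ff'] _ [h' th' hh']|c {}f _ [f' tf' ff']].
- exists ((wave_sign b * (k%:R * twopi)) \*o wave (~~ b) k); first exact/trigZ/trig_wave.
  by move=> x; exact: is_derive_wave.
- exists (f' \+ h'); first exact: trigD.
  by move=> x; have := ff' x; have := hh' x => *; exact: is_deriveD.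
- exists (c \*o f'); first exact: trigZ.
  by move=> x; have := ff' x => *; exact: is_deriveZ.
Qed.

Lemma trig_derivative f f' : trig f -> (forall x : R, is_derive x 1 f (f' x)) -> trig f'.
Proof.
move=> tf df; have [g tg dg] := trig_derive tf; rewrite (_ : f' = g)//.
by apply/funext => x; rewrite -(@derive_val _ _ _ _ _ _ _ (df x)) (@derive_val _ _ _ _ _ _ _ (dg x)).
Qed.

Lemma wave_cos0 : wave false 0 = cst 1.
Proof. by apply/funext => x; rewrite /wave !mul0r cos0. Qed.

Lemma trig_cst c : trig (cst c).
Proof.
rewrite (_ : cst c = c \*o wave false 0); first exact/trigZ/trig_wave.
by apply/funext => x; rewrite wave_cos0 /= mulr1.
Qed.

(** All product-to-sum formulas at once. The clause for equal waves keeps what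
    orthogonality needs: the coefficients, and the fact that the lower frequency
    is zero only for equal frequencies. *)
Lemma waveM b k b' l : exists p q (d : nat),
  (b = b' -> [/\ p = - wave_sign b / 2, q = 2^-1 & (d == 0%N) = (k == l)]) /\
  forall x, wave b k x * wave b' l x = p * wave (b (+) b') (k + l) x + q * wave (b (+) b') d x.
Proof.
wlog kl : k l b b' / (l <= k)%N.
  move=> H; have [/H//|/ltnW/(H l k b' b)[p [q [d [E1 E]]]]] := leqP l k.
  exists p, q, d; split=> [bb|x]; last by rewrite mulrC E addbC addnC.
  by have [] := E1 (esym bb); rewrite -bb (eq_sym l).
have E0 : (k - l == 0)%N = (k == l) by rewrite subn_eq0 eqn_leq kl andbT.
have E1 x : (k + l)%:R * twopi * x = k%:R * twopi * x + l%:R * twopi * x.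
  by rewrite natrD; ring.
have E2 x : (k - l)%:R * twopi * x = k%:R * twopi * x - l%:R * twopi * x.
  by rewrite natrB//; ring.
case: b; case: b' => /=.
- exists (- 2^-1), 2^-1, (k - l)%N; split=> [_|x]; first by rewrite /wave_sign E0; split=> //; rewrite mulN1r.
  by rewrite /wave E1 E2 cosD cosB; field.
- by exists 2^-1, 2^-1, (k - l)%N; split=> // x; rewrite /wave E1 E2 sinD sinB; field.
- by exists 2^-1, (- 2^-1), (k - l)%N; split=> // x; rewrite /wave E1 E2 sinD sinB; field.
- exists 2^-1, 2^-1, (k - l)%N; split=> [_|x]; first by rewrite /wave_sign E0 opprK; split=> //; rewrite mul1r.
  by rewrite /wave E1 E2 cosD cosB; field.
Qed.

Lemma trigM f g : trig f -> trig g -> trig (f \* g).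
Proof.
elim=> [b k|{}f h _ IHf _ IHh|c {}f _ IHf] tg.
- elim: tg => [b' l|{}g h _ IHg _ IHh|c {}g _ IHg].
  + have [p [q [d [_ E]]]] := waveM b k b' l.
    rewrite (_ : _ \* _ = (p \*o wave (b (+) b') (k + l)) \+ (q \*o wave (b (+) b') d)).
      by apply: trigD; apply: trigZ; exact: trig_wave.
    by apply/funext => x; rewrite /= E.
  + rewrite (_ : _ \* _ = (wave b k \* g) \+ (wave b k \* h)); first exact: trigD.
    by apply/funext => x; rewrite /= mulrDr.
  + rewrite (_ : _ \* _ = c \*o (wave b k \* g)); first exact: trigZ.
    by apply/funext => x; rewrite /= mulrCA.
- rewrite (_ : _ \* _ = (f \* g) \+ (h \* g)).
    by apply: trigD; [exact: IHf|exact: IHh].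
  by apply/funext => x; rewrite /= mulrDl.
- rewrite (_ : _ \* _ = c \*o (f \* g)); first by apply: trigZ; exact: IHf.
  by apply/funext => x; rewrite /= mulrA.
Qed.

Lemma trigX f n : trig f -> trig (fun x => f x ^+ n).
Proof.
move=> tf; elim: n => [|n IH].
  by rewrite (_ : (fun x => _) = cst 1); [exact: trig_cst|apply/funext => x; rewrite expr0].
by rewrite (_ : (fun x => _) = f \* (fun x => f x ^+ n)); [exact: trigM|apply/funext => x; rewrite exprS].
Qed.

Lemma trig_continuous f : trig f -> continuous f.
Proof.
move=> /trig_derive[g _ fg] x; apply: differentiable_continuous.
by apply/derivable1_diffP; have := fg x; move=> [].
Qed.

Lemma trig_bounded f : trig f -> exists M, forall x, `|f x| <= M.
Proof.
elim=> [b k|{}f h _ [M fM] _ [N hN]|c {}f _ [M fM]].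
- by exists 1 => x; case: b; [exact: sin_max|exact: cos_max].
- by exists (M + N) => x; rewrite (le_trans (ler_normD _ _))// lerD.
- by exists (`|c| * M) => x; rewrite /= normrM ler_wpM2l.
Qed.

Lemma trig_bdd f : trig f -> bdd f.
Proof.
move=> tf; split; last by have [M fM] := trig_bounded tf; exists M => x _; exact: fM.
by apply: measurable_funTS; apply: continuous_measurable_fun; exact: trig_continuous.
Qed.

Lemma trig_periodic f (m : int) x : trig f -> f (x + m%:~R) = f x.
Proof.
elim=> [b k|{}f h _ IHf _ IHh|c {}f _ IHf]; rewrite /= ?IHf ?IHh//.
have H n y : wave b k (y + n%:R) = wave b k y.
  rewrite /wave mulrDr (_ : k%:R * twopi * n%:R = twopi *+ (k * n)).
    by case: b; rewrite /twopi (periodicn (@sinD2pi R), periodicn (@cosD2pi R)).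
  by rewrite mulr_natr -mulr_natl mulrA -natrM mulr_natl mulnC.
case: m => n; first by rewrite -[Posz n]/(n%:Z) -pmulrn H.
by rewrite NegzE intrN -(H n.+1 (x - _)) -pmulrn subrK.
Qed.

Lemma trig_shift f a : trig f -> trig (fun x => f (x + a)).
Proof.
elim=> [b k|{}f h _ IHf _ IHh|c {}f _ IHf].
- set t := k%:R * twopi * a.
  have E x : k%:R * twopi * (x + a) = k%:R * twopi * x + t by rewrite mulrDr.
  case: b.
    rewrite (_ : (fun x => _) = (cos t \*o wave true k) \+ (sin t \*o wave false k)).
      by apply: trigD; apply: trigZ; exact: trig_wave.
    by apply/funext => x; rewrite /wave E sinD /=; ring.
  rewrite (_ : (fun x => _) = (cos t \*o wave false k) \+ ((- sin t) \*o wave true k)).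
    by apply: trigD; apply: trigZ; exact: trig_wave.
  by apply/funext => x; rewrite /wave E cosD /=; ring.
- exact: trigD.
- exact: trigZ.
Qed.

Lemma Rintegral01_derive (F f : R -> R) :
  (forall x : R, is_derive x 1 F (f x)) -> continuous f ->
  \int[leb]_(x in itv01) f x = F 1 - F 0.
Proof.
move=> dF cf.
have cF : continuous F.
  move=> x; apply: differentiable_continuous; apply/derivable1_diffP.
  by have := dF x; move=> [].
have mf : measurable_fun setT (f : measurableTypeR R -> R) by exact: continuous_measurable_fun.
rewrite /Rintegral.
have := @continuous_FTC2 R f F 0 1 ltr01 _ _ _.
move=> /(_ _ _ _)/= H.
rewrite integral_itv_bndo_bndc; last by apply/measurable_EFinP; exact: measurable_funTS.
rewrite H//.
- exact: continuous_subspaceT.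
- split.
  + by move=> x _; have := dF x; move=> [].
  + exact/cvg_at_right_filter/cF.
  + exact/cvg_at_left_filter/cF.
- by move=> x _; have := dF x; rewrite derive1E => -[_ ->].
Qed.

Lemma wave_int b k : \int[leb]_(x in itv01) wave b k x = (~~ b && (k == 0%N))%:R.
Proof.
have tb01 b' n : wave b' n 1 = wave b' n 0.
  by have := @trig_periodic (wave b' n) 1 0 (trig_wave _ _); rewrite add0r.
have [->|k0] := eqVneq k 0%N.
  case: b; rewrite ?wave_cos0.
    rewrite (_ : (fun x => _) = cst 0) ?Rintegral_cst ?mul0r//.
    by apply/funext => x; rewrite /wave !mul0r sin0.
  by rewrite Rintegral_cst//= mul1r -[X in fine X]/(leb itv01) leb_itv01.
have w0 : wave_sign (~~ b) * (k%:R * twopi) != 0.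
  rewrite mulf_neq0//; first by case: (b); rewrite /wave_sign /= ?oppr_eq0 oner_eq0.
  by rewrite mulf_neq0 ?pnatr_eq0// /twopi mulrn_eq0/= gt_eqF ?pi_gt0.
have := @Rintegral01_derive _ _ (is_derive_wave (~~ b) k) _.
rewrite negbK tb01 subrr => /(_ _) H.
have {H} : \int[leb]_(x in itv01) (wave_sign (~~ b) * (k%:R * twopi) * wave b k x) = 0.
  by apply: H; apply: trig_continuous; exact/trigZ/trig_wave.
rewrite RintegralZl//; last exact/bdd_int/trig_bdd/trig_wave.
by move=> /eqP; rewrite mulf_eq0 (negbTE w0)/= andbF => /eqP.
Qed.

(** At frequency zero the cosine has squared norm 1 instead of 1/2, and the sine
    is the zero function. *)
Lemma wave_ip b k b' l : \int[leb]_(x in itv01) (wave b k x * wave b' l x) =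
  if (b, k) == (b', l) then (if k == 0%N then (~~ b)%:R else 2^-1) else 0.
Proof.
have [p [q [d [E1 E]]]] := waveM b k b' l.
under eq_Rintegral do rewrite E.
have ib b1 n c : leb.-integrable itv01 (EFin \o (fun x => c * wave b1 n x)).
  exact/bdd_int/trig_bdd/trigZ/trig_wave.
rewrite RintegralD//; try exact: ib.
rewrite !RintegralZl//; try exact/bdd_int/trig_bdd/trig_wave.
rewrite !wave_int xpair_eqE.
have [bb|bb] := eqVneq b b'; last first.
  by move: bb; case: (b); case: (b') => //= _; rewrite !mulr0 addr0.
rewrite bb addbb /= addn_eq0.
have [-> -> ->] := E1 bb; rewrite -bb.
have [<-|kl] /= := eqVneq k l.
  rewrite andbb mulr1; case: eqP => _; last by rewrite mulr0 add0r.
  by rewrite /wave_sign; case: (b) => /=; field.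
rewrite (_ : (k == 0)%N && (l == 0)%N = false) ?mulr0 ?addr0//.
by apply/negbTE; apply: contra kl => /andP[/eqP-> /eqP->].
Qed.

Lemma wave_sin0 : wave true 0 = cst 0.
Proof. by apply/funext => x; rewrite /wave !mul0r sin0. Qed.

End Trig.

(** * Density of trigonometric polynomials *)

Section StepApprox.
Variable R : realType.
Local Notation itv01 := (`[0, 1[%classic : set (measurableTypeR R)).

(** Polynomials in p which, on the unit interval, tend to 0 for p < 1/2 and to 1
    for p > 1/2; both limits follow from Bernoulli's inequality. *)
Definition sharpen (n : nat) (p : R) : R := 1 - (1 - p ^+ n) ^+ (2 ^ n).

Lemma sharpen01 n p : 0 <= p <= 1 -> 0 <= sharpen n p <= 1.
Proof.
move=> /andP[p0 p1]; have h0 : 0 <= p ^+ n <= 1 by rewrite exprn_ge0 ?exprn_ile1.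
have : 0 <= (1 - p ^+ n) ^+ (2 ^ n) <= 1.
  by rewrite exprn_ge0 ?exprn_ile1//; lra.
by rewrite /sharpen; lra.
Qed.

Lemma bernoulli_sub (x : R) m : 0 <= x <= 1 -> 1 - m%:R * x <= (1 - x) ^+ m.
Proof.
move=> /andP[x0 x1]; elim: m => [|m IH]; first by rewrite mul0r subr0 expr0.
rewrite exprS; apply: le_trans (ler_wpM2l _ IH); last by lra.
by rewrite -natr1; have := ler0n R m; nra.
Qed.

Lemma bernoulli_add (x : R) m : 0 <= x -> 1 + m%:R * x <= (1 + x) ^+ m.
Proof.
move=> x0; elim: m => [|m IH]; first by rewrite mul0r addr0 expr0.
rewrite exprS; apply: le_trans (ler_wpM2l _ IH); last by lra.
by rewrite -natr1; have := ler0n R m; nra.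
Qed.

Lemma sharpen_lo p : 0 <= p < 2^-1 -> (fun n => sharpen n p) @ \oo --> 0.
Proof.
move=> /andP[p0 p1].
apply: (@squeeze_cvgr _ _ _ _ (cst 0) (fun n => (2 * p) ^+ n)).
- apply: nearW => n; have := @sharpen01 n p; rewrite p0 /= => /(_ _)/andP[]; first by lra.
  move=> -> _ /=; rewrite /sharpen exprMn.
  have h : 0 <= p ^+ n <= 1 by rewrite exprn_ge0 ?exprn_ile1//; lra.
  by have := bernoulli_sub (2 ^ n) h; rewrite natrX; lra.
- exact: cvg_cst.
- by apply: cvg_expr; rewrite ger0_norm; lra.
Qed.

Lemma sharpen_hi p : 2^-1 < p <= 1 -> (fun n => sharpen n p) @ \oo --> (1 : R).
Proof.
move=> /andP[p0 p1].
have cv : (fun n => 1 - ((2 * p)^-1) ^+ n) @ \oo --> (1 : R).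
  rewrite -[X in _ --> X]subr0; apply: cvgB; first exact: cvg_cst.
  apply: cvg_expr; rewrite ger0_norm ?invr_ge0; last by lra.
  by rewrite invf_lt1; lra.
apply: (@squeeze_cvgr _ _ _ _ (fun n => 1 - ((2 * p)^-1) ^+ n) (cst 1)) => //; last exact: cvg_cst.
apply: nearW => n; have := @sharpen01 n p; rewrite p1 andbT => /(_ _)/andP[]; first by lra.
move=> _ -> /=; rewrite andbT /sharpen lerD2l lerN2.
have pn : 0 < p ^+ n by rewrite exprn_gt0//; lra.
have h : 0 <= p ^+ n <= 1 by rewrite exprn_ge0 ?exprn_ile1//; lra.
have := bernoulli_add (2 ^ n) (ltW pn); rewrite natrX -exprMn => B.
rewrite exprVn -[leRHS]mul1r ler_pdivlMr ?exprn_gt0//; last by lra.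
apply: (@le_trans _ _ ((1 - p ^+ n) ^+ (2 ^ n) * (1 + p ^+ n) ^+ (2 ^ n))).
  rewrite ler_wpM2l ?exprn_ge0//; first by lra.
  by have : 0 <= (1 : R) by []; lra.
by rewrite -exprMn exprn_ile1//; have := sqr_ge0 (p ^+ n); rewrite ?expr2; nra.
Qed.

(** The factors have period 2, but their product is half of
    cos (2 pi x - pi a) - cos (pi a), of period 1. For 0 < a < 1 its only sign
    change between 0 and 1 is at a. *)
Lemma trig_sign a : trig (fun x : R => sin (pi * x) * sin (pi * (a - x))).
Proof.
rewrite (_ : (fun x => _) = (2^-1 \*o (fun x => wave false 1 (x + (- (a / 2))))) \+ cst (- cos (pi * a) / 2)).
  apply: trigD; last exact: trig_cst.
  by apply: trigZ; apply: trig_shift; exact: trig_wave.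
apply/funext => x; rewrite /wave /twopi /= mul1r.
rewrite (_ : pi *+ 2 * (x - a / 2) = pi * x - pi * (a - x)); last by field.
rewrite [in RHS](_ : pi * a = pi * x + pi * (a - x)); last by ring.
by rewrite cosB cosD; field.
Qed.

(** Sharpen 1/2 + sin (pi x) sin (pi (a - x)) / 2. Convergence fails only where
    this equals 1/2: at 0 and at the jump. *)
Lemma trig_step (A : set R) : A = setT \/ (exists r, A = `]-oo, r[%classic) ->
  exists (q : nat -> R -> R) (c : R), [/\ forall n, trig (q n),
    forall n x, `|q n x| <= 1 &
    forall x, itv01 x -> x != 0 -> x != c -> q ^~ x @ \oo --> (\1_A x : R)].
Proof.
move=> [->|[a ->]].
  exists (fun n => cst 1), 0; split=> [n|n x|x _ _ _]; first exact: trig_cst.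
    by rewrite normr1.
  by rewrite indicT; exact: cvg_cst.
have [a0|a0] := leP a 0.
  exists (fun n => cst 0), 0; split=> [n|n x|x + _ _]; first exact: trig_cst.
    by rewrite normr0.
  rewrite /= in_itv/= => /andP[x0 _]; rewrite indicE memNset; first exact: cvg_cst.
  by rewrite /= in_itv/=; lra.
have [a1|a1] := leP 1 a.
  exists (fun n => cst 1), 0; split=> [n|n x|x + _ _]; first exact: trig_cst.
    by rewrite normr1.
  rewrite /= in_itv/= => /andP[x0 x1]; rewrite indicE mem_set; first exact: cvg_cst.
  by rewrite /= in_itv/=; lra.
pose s x : R := sin (pi * x) * sin (pi * (a - x)).
pose p x : R := 2^-1 + s x / 2.
have p01 x : 0 <= p x <= 1.
  have := sin_max (pi * x); have := sin_max (pi * (a - x)).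
  rewrite !ler_norml /p /s => /andP[? ?] /andP[? ?]; nra.
have tp : trig p.
  apply: (@trigD _ (cst 2^-1) (fun x => s x / 2)); first exact: trig_cst.
  rewrite (_ : (fun x => _) = 2^-1 \*o s); last by apply/funext => x; rewrite /= mulrC.
  by apply: trigZ; exact: trig_sign.
exists (fun n x => sharpen n (p x)), a; split=> [n|n x|x].
- rewrite (_ : (fun x => _) = (cst 1 \+ (-1 \*o (fun x => (cst 1 \+ (-1 \*o (fun x => p x ^+ n))) x ^+ (2 ^ n))))).
    apply: trigD; first exact: trig_cst.
    apply: trigZ; apply: trigX; apply: trigD; first exact: trig_cst.
    by apply: trigZ; exact: trigX.
  by apply/funext => x; rewrite /sharpen /= !mulN1r.
- by have /andP[h0 h1] := sharpen01 n (p01 x); rewrite ger0_norm.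
rewrite /= in_itv/= => /andP[x0 x1] xn0 xa.
have pi0 := @pi_gt0 R.
have xp : 0 < x by rewrite lt_neqAle eq_sym xn0.
have sx : 0 < sin (pi * x) by apply: sin_gt0_pi; nra.
have /andP[p0 p1] := p01 x.
have [ax|ax] := ltP x a.
  rewrite indicE mem_set; last by rewrite /= in_itv/=.
  apply: sharpen_hi; rewrite p1 andbT /p.
  have : 0 < s x by rewrite mulr_gt0// sin_gt0_pi//; nra.
  by lra.
rewrite indicE memNset; last by rewrite /= in_itv/=; lra.
have {}ax : a < x by rewrite lt_neqAle eq_sym xa.
apply: sharpen_lo; rewrite p0 /= /p.
have : 0 < - s x.
  rewrite /s -mulrN -sinN mulr_gt0// sin_gt0_pi//; nra.
by lra.
Qed.

End StepApprox.

Section Fourier.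
Variable R : realType.
Local Notation plane := (measurableTypeR R * measurableTypeR R)%type.
Local Notation leb := (@lebesgue_measure R).
Local Notation leb2 := (leb2 R).
Local Notation cell := (@cell R).
Local Notation itv01 := (`[0, 1[%classic : set (measurableTypeR R)).
Local Notation sq := (sqint leb2 cell).
Local Notation ip := (inner_product leb2 cell).
Implicit Types f g : plane -> R.

Let mC := @measurable_cell R.
Let fC := @leb2_cell_fin R.
Let sqD := @sqintD _ _ R leb2 cell mC.
Let sqZ := @sqintZ _ _ R leb2 cell mC.

Inductive trig2 : (plane -> R) -> Prop :=
| trig2_tens u v : trig u -> trig v -> trig2 (tens u v)
| trig2D p q : trig2 p -> trig2 q -> trig2 (p \+ q)
| trig2Z c p : trig2 p -> trig2 (c \*o p).

Lemma trig2_sqint p : trig2 p -> sq p.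
Proof.
elim=> [u v tu tv|{}p q _ sp _ sq'|c {}p _ sp].
- by apply: tens_sqint; exact: trig_bdd.
- exact: sqD.
- exact: sqZ.
Qed.

Lemma negligible_lines (A : set R) : countable A -> leb2.-negligible [set x | A x.1 \/ A x.2].
Proof.
move=> cA; have mA : measurable (A : set (measurableTypeR R)).
  by apply: countable_measurable => // t; exact: measurable_set1.
have A0 : leb A = 0%E by exact: countable_lebesgue_measure0.
rewrite (_ : [set _ | _] = (A `*` setT) `|` (setT `*` A)); last first.
  by apply/seteqP; split=> [x /= [|]|x [|] []]; [left|right|left|right].
have e1 : leb2 (A `*` setT) = 0%E by rewrite leb2X// A0 mul0e.
have e2 : leb2 (setT `*` A) = 0%E by rewrite leb2X// A0 mule0.
by apply: negligibleU; [exists (A `*` setT)|exists (setT `*` A)]; split=> //; exact: measurableX.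
Qed.

Lemma L2closure_quadrant (A B : set R) :
  A = setT \/ (exists r, A = `]-oo, r[%classic) ->
  B = setT \/ (exists r, B = `]-oo, r[%classic) ->
  L2closure leb2 cell trig2 (\1_(A `*` B) : plane -> R).
Proof.
move=> rA rB.
have mr (X : set R) : X = setT \/ (exists r, X = `]-oo, r[%classic) ->
    measurable (X : set (measurableTypeR R)).
  by move=> [->|[r ->]]; [exact: measurableT|exact: measurable_itv].
have [q [c [tq q1 qc]]] := trig_step rA; have [q' [c' [tq' q1' qc']]] := trig_step rB.
have t2 n : trig2 (tens (q n) (q' n)) by exact: trig2_tens.
have s1 : sq (\1_(A `*` B) : plane -> R).
  apply: (@sqint_bounded _ _ _ leb2 cell mC fC _ 1).
    by apply: measurable_funTS; apply: measurable_indic; apply: measurableX; exact: mr.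
  by move=> x _; rewrite indicE; case: (_ \in _); rewrite ?normr1 ?normr0.
apply: (@L2closure_cvg _ _ _ leb2 cell mC trig2 trig2_sqint (fun n => tens (q n) (q' n))) => //.
  by move=> n; apply: L2closureS => //; exact: trig2_sqint.
apply: (@ip_dominated _ _ _ leb2 cell mC _ _ (cst 1)) => //.
- by move=> n; exact: trig2_sqint.
- exact: sqint_cst.
- have := @negligible_lines [set 0; c; c'] _.
  case; first exact: finite_set_countable.
  move=> N [mN N0 sN]; exists N; split => // x nx; apply: sN => /=; apply: contrapT => h; apply: nx => -[x1 x2].
  rewrite /tens (_ : \1_(A `*` B) x = \1_A x.1 * \1_B x.2); last first.
    by rewrite !indicE in_setX; case: (_ \in _); case: (_ \in _); rewrite ?mulr1 ?mulr0 ?mul0r.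
  apply: cvgM; [apply: qc|apply: qc'] => //; apply/eqP => E; apply: h; rewrite E; tauto.
- by move=> n x _; rewrite /tens normrM /= mulr_ile1.
- by move=> x _; rewrite indicE; case: (_ \in _); rewrite ?normr1 ?normr0.
Qed.

Lemma indic_sqint (E : set plane) : measurable E -> sq (\1_E : plane -> R).
Proof.
move=> mE; apply: (@sqint_bounded _ _ _ leb2 cell mC fC _ 1).
  by apply: measurable_funTS; exact: measurable_indic.
by move=> x _; rewrite indicE; case: (_ \in _); rewrite ?normr1 ?normr0.
Qed.

Lemma indic_bigcup_cvg (F : (set plane)^nat) : (forall n, measurable (F n)) ->
  trivIset setT F ->
  let s N : plane -> R := fun x => \sum_(n < N) \1_(F n) x in
  (fun N => ip (s N \- \1_(\bigcup_n F n)) (s N \- \1_(\bigcup_n F n))) @ \oo --> 0.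
Proof.
move=> mF tF s.
have sE N x : s N x = \1_(\bigcup_(n in `I_N) F n) x.
  rewrite /s; have [[n /= nN Fx]|nF] := pselect ((\bigcup_(n in `I_N) F n) x).
    rewrite indicE mem_set; last by exists n.
    rewrite (bigD1 (Ordinal nN))//= indicE mem_set// big1 ?addr0// => i ni.
    rewrite indicE memNset// => Fi.
    have h : nat_of_ord i = n by apply: tF => //; exists x.
    by move/eqP: ni; case; exact/val_inj.
  rewrite indicE memNset// big1// => i _; rewrite indicE memNset// => Fi.
  by apply: nF; exists (nat_of_ord i) => /=.
have s1 N x : `|s N x| <= 1.
  by rewrite sE indicE; case: (_ \in _); rewrite ?normr1 ?normr0.
apply: (@ip_dominated _ _ _ leb2 cell mC _ _ (cst 1)) => //.
- by move=> N; apply: sqint_sum => // i; exact: indic_sqint.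
- by apply: indic_sqint; exact: bigcupT_measurable.
- exact: sqint_cst.
- apply: aeW => x _; rewrite indicE.
  have [[n _ Fx]|nF] := pselect ((\bigcup_n F n) x).
    rewrite mem_set; last by exists n.
    apply: cvg_near_cst; exists n.+1 => // N /= nN.
    by rewrite sE indicE mem_set//; exists n.
  rewrite memNset//; apply: cvg_near_cst; apply: nearW => N.
  by rewrite sE indicE memNset// => -[n _ Fx]; apply: nF; exists n.
- by move=> x _; rewrite indicE; case: (_ \in _); rewrite ?normr1 ?normr0.
Qed.

Lemma L2closure_indic (E : set plane) : measurable E ->
  L2closure leb2 cell trig2 (\1_E : plane -> R).
Proof.
have c1 : L2closure leb2 cell trig2 (cst 1 : plane -> R).
  apply: L2closureS => //; first exact: trig2_sqint.
  rewrite (_ : cst 1 = tens (cst 1) (cst 1)); last by apply/funext => x; rewrite /tens /= mulr1.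
  by apply: trig2_tens; exact: trig_cst.
apply: (@quadrant_induction R (fun E => L2closure leb2 cell trig2 (\1_E : plane -> R))).
- by rewrite indicT.
- by move=> A B rA rB; exact: L2closure_quadrant.
- move=> X mX cX; rewrite (_ : \1_(~` X) = cst 1 \+ (-1 \*o (\1_X : plane -> R))).
    apply: L2closureD => //; [exact: trig2_sqint|exact: trig2D|].
    by apply: L2closureZ => //; [exact: trig2_sqint|exact: trig2Z].
  by apply/funext => x; rewrite /= !indicE in_setC; case: (_ \in _); rewrite /= ?mulr1 ?mulr0 ?subrr ?addr0.
- move=> F mF tF cF.
  apply: (@L2closure_cvg _ _ _ leb2 cell mC trig2 trig2_sqint (fun N x => \sum_(n < N) \1_(F n) x)).
  + elim=> [|N IH].
      rewrite (_ : (fun x => _) = 0 \*o cst 1).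
        by apply: L2closureZ => //; [exact: trig2_sqint|exact: trig2Z].
      by apply/funext => x; rewrite big_ord0 /= mul0r.
    rewrite (_ : (fun x => _) = (fun x => \sum_(n < N) \1_(F n) x) \+ \1_(F N)).
      by apply: L2closureD => //; [exact: trig2_sqint|exact: trig2D].
    by apply/funext => x; rewrite big_ord_recr.
  + by apply: indic_sqint; exact: bigcupT_measurable.
  + exact: indic_bigcup_cvg.
Qed.

Lemma L2closure_trig2 f : sq f -> L2closure leb2 cell trig2 f.
Proof.
apply: L2_density => //; [exact: trig2_sqint|exact: trig2D|exact: trig2Z|].
exact: L2closure_indic.
Qed.

(** * Parseval's identity and the null Lagrangian *)

(** Sine and cosine at every frequency below N in each variable, including the
    zero sines, which contribute nothing. *)
Definition fourier_index N := ((bool * 'I_N) * (bool * 'I_N))%type.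

Definition fourier_basis N (i : fourier_index N) : plane -> R := tens (wave i.1.1 i.1.2) (wave i.2.1 i.2.2).

(** Reciprocal of the squared norm of a non-zero wave. *)
Definition wave_weight (k : nat) : R := if k == 0%N then 1 else 2.

Definition fourier_weight N (i : fourier_index N) : R := wave_weight i.1.2 * wave_weight i.2.2.

Lemma ip_tens (u v u' v' : R -> R) : bdd u -> bdd v -> bdd u' -> bdd v' ->
  ip (tens u v) (tens u' v') =
  (\int[leb]_(x in itv01) (u x * u' x)) * (\int[leb]_(x in itv01) (v x * v' x)).
Proof.
move=> bu bv bu' bv'.
rewrite -(@Rintegral_tens _ (u \* u') (v \* v')); try exact: bddM.
by apply: eq_Rintegral => x _; rewrite /tens /= mulrACA.
Qed.

Lemma fourier_basis_sqint N (i : fourier_index N) : sq (fourier_basis i).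
Proof. by apply: trig2_sqint; apply: trig2_tens; exact: trig_wave. Qed.

Lemma fourier_basis_orth N (i j : fourier_index N) : i != j -> ip (fourier_basis i) (fourier_basis j) = 0.
Proof.
move: i j => [[b k] [c l]] [[b' k'] [c' l']] ij.
rewrite ip_tens; try exact/trig_bdd/trig_wave.
rewrite !wave_ip /=.
have [[Eb Ek]|_] := eqVneq (b, nat_of_ord k) (b', nat_of_ord k'); last by rewrite mul0r.
have [[Ec El]|_] := eqVneq (c, nat_of_ord l) (c', nat_of_ord l'); last by rewrite mulr0.
by move/eqP: ij; case; rewrite Eb Ec (val_inj Ek) (val_inj El).
Qed.

Lemma fourier_basis_norm N (i : fourier_index N) : fourier_basis i = cst 0 \/ fourier_weight i * ip (fourier_basis i) (fourier_basis i) = 1.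
Proof.
move: i => [[b k] [c l]]; rewrite /fourier_weight /fourier_basis /=.
have [/andP[/eqP k0 bt]|nk] := boolP ((nat_of_ord k == 0%N) && b).
  by left; apply/funext => x; rewrite /tens k0 bt wave_sin0 /= mul0r.
have [/andP[/eqP l0 ct]|nl] := boolP ((nat_of_ord l == 0%N) && c).
  by left; apply/funext => x; rewrite /tens l0 ct wave_sin0 /= mulr0.
right; rewrite ip_tens; try exact/trig_bdd/trig_wave.
rewrite !wave_ip !eqxx mulrACA.
have H (m : nat) (d : bool) : ~~ ((m == 0%N) && d) ->
    wave_weight m * (if m == 0%N then (~~ d)%:R else 2^-1) = 1.
  rewrite /wave_weight; case: eqP => _ /=; last by move=> _; rewrite mulfV.
  by move=> ->; rewrite mulr1.
by rewrite !H// mulr1.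
Qed.

Local Notation proj N := (orthproj leb2 cell (@fourier_basis N) (@fourier_weight N)).

(** Induction for properties that hold once the truncation order exceeds the
    degree of the polynomial. *)
Lemma trig_eventually (P : nat -> (R -> R) -> Prop) :
  (forall b k, \forall N \near \oo, P N (wave b k)) ->
  (forall N (f g : R -> R), P N f -> P N g -> trig f -> trig g -> P N (f \+ g)) ->
  (forall N c (f : R -> R), P N f -> trig f -> P N (c \*o f)) ->
  forall f : R -> R, trig f -> \forall N \near \oo, P N f.
Proof.
move=> P0 PD PZ f; elim=> [b k|{}f g tf IHf tg IHg|c {}f tf IHf]; first exact: P0.
- by near=> N; apply: PD => //; near: N.
- by near=> N; apply: PZ => //; near: N.
Unshelve. all: by end_near. Qed.

Lemma proj_trig2 p : trig2 p -> \forall N \near \oo, proj N p = p.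
Proof.
elim=> [u v tu tv|{}p q tp IHp tq IHq|c {}p tp IHp]; last 2 first.
- apply: filterS2 IHp IHq => N Ep Eq.
  by rewrite orthprojD// ?Ep ?Eq//; try exact: trig2_sqint; exact: fourier_basis_sqint.
- apply: filterS IHp => N Ep.
  by rewrite orthprojZ// ?Ep//; try exact: trig2_sqint; exact: fourier_basis_sqint.
move: v tv u tu.
have key v : trig v -> forall b k, \forall N \near \oo, proj N (tens (wave b k) v) = tens (wave b k) v.
  move=> tv b k; move: v tv; apply: trig_eventually.
  - move=> c l; exists (maxn k l).+1 => // N /=; rewrite gtn_max => /andP[kN lN].
    pose i : fourier_index N := ((b, Ordinal kN), (c, Ordinal lN)).
    have E := orthproj_id (@fourier_basis_orth N) (@fourier_basis_norm N) i.
    exact: E.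
  - move=> N f g Ef Eg tf tg.
    rewrite (_ : tens _ _ = tens (wave b k) f \+ tens (wave b k) g); last first.
      by apply/funext => x; rewrite /tens /= mulrDr.
    rewrite orthprojD// ?Ef ?Eg//; try exact: fourier_basis_sqint;
      by apply: trig2_sqint; apply: trig2_tens => //; exact: trig_wave.
  - move=> N c f Ef tf.
    rewrite (_ : tens _ _ = c \*o tens (wave b k) f); last first.
      by apply/funext => x; rewrite /tens /= mulrCA.
    rewrite orthprojZ// ?Ef//; try exact: fourier_basis_sqint.
    by apply: trig2_sqint; apply: trig2_tens => //; exact: trig_wave.
move=> v tv; apply: trig_eventually.
- by move=> b k; exact: key.
- move=> N f g Ef Eg tf tg.
  rewrite (_ : tens _ _ = tens f v \+ tens g v); last first.
    by apply/funext => x; rewrite /tens /= mulrDl.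
  rewrite orthprojD// ?Ef ?Eg//; try exact: fourier_basis_sqint;
    by apply: trig2_sqint; exact: trig2_tens.
- move=> N c f Ef tf.
  rewrite (_ : tens _ _ = c \*o tens f v); last first.
    by apply/funext => x; rewrite /tens /= mulrA.
  rewrite orthprojZ// ?Ef//; try exact: fourier_basis_sqint.
  by apply: trig2_sqint; exact: trig2_tens.
Qed.

(** The partial sums are the inner products of g with the projections of f.
    These converge to f: they are at least as close to f as any trigonometric
    polynomial that they fix, and every such polynomial is eventually fixed. *)
Lemma parseval f g : sq f -> sq g ->
  (fun N => \sum_(i : fourier_index N) fourier_weight i * ip f (fourier_basis i) * ip g (fourier_basis i)) @ \oo --> ip f g.
Proof.
move=> sf sg.
have sP N : sq (proj N f) by apply: orthproj_sqint => // i; exact: fourier_basis_sqint.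
rewrite (_ : (fun N => _) = (fun N => ip (proj N f) g)); last first.
  by apply/funext => N; rewrite ip_orthproj//; exact: fourier_basis_sqint.
apply: ip_cvg => //; apply/cvgrPdist_le => e e0.
have [_ /(_ _ e0)[p tp fp]] := L2closure_trig2 sf.
near=> N; rewrite sub0r normrN ger0_norm ?ip_ge0//.
rewrite (_ : ip _ _ = ip (f \- proj N f) (f \- proj N f)); last first.
  by apply: eq_Rintegral => x _ /=; ring.
apply: le_trans fp; apply: orthproj_best => //.
- exact: fourier_basis_sqint.
- exact: fourier_basis_orth.
- exact: fourier_basis_norm.
- exact: trig2_sqint.
- by near: N; exact: proj_trig2.
Unshelve. all: by end_near. Qed.

(** Products of trigonometric polynomials are test functions enough to compute
    all Fourier coefficients. Restricting to them makes it easy to show that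
    products of piecewise affine functions, which are not smooth, have weak
    gradients. *)
Definition weak_grad v E1 E2 : Prop :=
  [/\ sq v, sq E1, sq E2 &
   forall u u' w w' : R -> R, trig u -> trig w ->
     (forall x : R, is_derive x 1 u (u' x)) -> (forall x : R, is_derive x 1 w (w' x)) ->
     ip v (tens u' w) = - ip E1 (tens u w) /\ ip v (tens u w') = - ip E2 (tens u w)].

(** On Fourier coefficients a derivative multiplies by the frequency and
    exchanges sine and cosine in one variable. Exchanging them in both variables
    therefore matches the two Parseval sums term by term. For the two rows of
    the gradient of a vector field this says that its determinant has mean
    zero. *)
Theorem null_lagrangian v E1 E2 w H1 H2 : weak_grad v E1 E2 -> weak_grad w H1 H2 ->
  ip E1 H2 = ip E2 H1.
Proof.
move=> hv hw; have [_ sE1 sE2 _] := hv; have [_ sH1 sH2 _] := hw.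
have cv1 := parseval sE1 sH2; have cv2 := parseval sE2 sH1.
suff E N : \sum_(i : fourier_index N) fourier_weight i * ip E1 (fourier_basis i) * ip H2 (fourier_basis i) =
           \sum_(i : fourier_index N) fourier_weight i * ip E2 (fourier_basis i) * ip H1 (fourier_basis i).
  apply: (cvg_unique _ cv1); first exact: Rhausdorff.
  by rewrite (_ : (fun N => _) = (fun N => \sum_(i : fourier_index N) fourier_weight i * ip E2 (fourier_basis i) * ip H1 (fourier_basis i)))//; apply/funext.
pose flip (i : fourier_index N) : fourier_index N := ((~~ i.1.1, i.1.2), (~~ i.2.1, i.2.2)).
have flipK : involutive flip by move=> [[b k] [c l]]; rewrite /flip /= !negbK.
rewrite [RHS](reindex_inj (inv_inj flipK)); apply: eq_bigr => -[[b k] [c l]] _.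
have coef f E F b1 k1 c1 l1 (h : weak_grad f E F) :
    ip E (tens (wave b1 k1) (wave c1 l1)) =
      - (wave_sign R b1 * (k1%:R * twopi R)) * ip f (tens (wave (~~ b1) k1) (wave c1 l1)) /\
    ip F (tens (wave b1 k1) (wave c1 l1)) =
      - (wave_sign R c1 * (l1%:R * twopi R)) * ip f (tens (wave b1 k1) (wave (~~ c1) l1)).
  case: h => sf _ _ h.
  have [h1 h2] := h _ _ _ _ (trig_wave R b1 k1) (trig_wave R c1 l1) (is_derive_wave b1 k1) (is_derive_wave c1 l1).
  split.
    rewrite -[LHS]opprK -h1 mulNr; congr (- _).
    rewrite -ipZr//; last by apply: trig2_sqint; apply: trig2_tens; exact: trig_wave.
    by apply: eq_Rintegral => x _; rewrite /tens /=; ring.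
  rewrite -[LHS]opprK -h2 mulNr; congr (- _).
  rewrite -ipZr//; last by apply: trig2_sqint; apply: trig2_tens; exact: trig_wave.
  by apply: eq_Rintegral => x _; rewrite /tens /=; ring.
rewrite /fourier_weight /fourier_basis /flip /=.
rewrite (coef _ _ _ _ _ _ _ hv).1 (coef _ _ _ _ _ _ _ hw).2.
rewrite (coef _ _ _ _ _ _ _ hv).2 (coef _ _ _ _ _ _ _ hw).1 !negbK.
have tN d : wave_sign R (~~ d) = - wave_sign R d by case: d; rewrite /wave_sign /= ?opprK.
by rewrite !tN; ring.
Qed.

End Fourier.

(** * Piecewise affine test functions *)

Section Ramps.
Variable R : realType.
Local Notation leb := (@lebesgue_measure R).
Local Notation itv01 := (`[0, 1[%classic : set (measurableTypeR R)).

(** Integration by parts on the unit interval; k u(1) is the boundary term. For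
    k = 0 the pair behaves like a periodic function and its derivative. *)
Definition ibp (T tau : R -> R) (k : R) : Prop :=
  [/\ bdd T, bdd tau & forall u u' : R -> R, trig u -> (forall x : R, is_derive x 1 u (u' x)) ->
    \int[leb]_(x in itv01) (T x * u' x) = k * u 1 - \int[leb]_(x in itv01) (tau x * u x)].

Lemma trig_derive_bdd (u u' : R -> R) : trig u -> (forall x : R, is_derive x 1 u (u' x)) -> bdd u'.
Proof. by move=> tu du; exact: trig_bdd (trig_derivative tu du). Qed.

Lemma ibpD T t k S s l : ibp T t k -> ibp S s l -> ibp (T \+ S) (t \+ s) (k + l).
Proof.
move=> [bT bt HT] [bS bs HS]; split; try exact: bddD.
move=> u u' tu du; have bu := trig_bdd tu; have bu' := trig_derive_bdd tu du.
under eq_Rintegral do rewrite /= mulrDl.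
under [X in _ = _ - X]eq_Rintegral do rewrite /= mulrDl.
rewrite !RintegralD//; try by apply: bdd_int; exact: bddM.
by rewrite (HT _ _ tu du) (HS _ _ tu du); ring.
Qed.

Lemma ibpZ c T t k : ibp T t k -> ibp (c \*o T) (c \*o t) (c * k).
Proof.
move=> [bT bt HT]; split; try exact: bddZ.
move=> u u' tu du; have bu := trig_bdd tu; have bu' := trig_derive_bdd tu du.
under eq_Rintegral do rewrite /= -mulrA.
under [X in _ = _ - X]eq_Rintegral do rewrite /= -mulrA.
rewrite !RintegralZl//; try by apply: bdd_int; exact: bddM.
by rewrite (HT _ _ tu du); ring.
Qed.

Definition ramp (c x : R) : R := Num.max (x - c) 0.
Definition step (c x : R) : R := (c <= x)%R%:R.

Lemma step_bdd c : bdd (step c).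
Proof.
split; last by exists 1 => x _; rewrite /step; case: (c <= x); rewrite ?normr1 ?normr0.
rewrite (_ : step c = \1_`[c, +oo[); first exact: measurable_indic.
by apply/funext => x; rewrite indicE mem_setE in_itv/= andbT.
Qed.

Lemma ramp_bound c (x : R) : 0 <= x < 1 -> `|ramp c x| <= `|c| + 1.
Proof.
move=> /andP[x0 x1]; have h0 := normr_ge0 c; have h1 := ler_norm (- c).
by rewrite normrN in h1; rewrite ler_norml /ramp; case: (lerP (x - c) 0) => h; lra.
Qed.

Lemma ramp_bdd c : bdd (ramp c).
Proof.
split.
  by apply: measurable_maxr; [exact: measurable_funB|exact: measurable_cst].
by exists (`|c| + 1) => x; rewrite /= in_itv/=; exact: ramp_bound.
Qed.

Lemma ibp_ramp c : 0 <= c < 1 -> ibp (ramp c) (step c) (1 - c).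
Proof.
move=> /andP[c0 c1]; split; [exact: ramp_bdd|exact: step_bdd|move=> u u' tu du].
have bu := trig_bdd tu; have bu' := trig_derive_bdd tu du.
apply/eqP; rewrite eq_sym subr_eq eq_sym; apply/eqP.
rewrite -RintegralD//; last 2 first.
- by apply: bdd_int; apply: bddM => //; exact: ramp_bdd.
- by apply: bdd_int; apply: bddM => //; exact: step_bdd.
pose f x : R := (x - c) * u' x + u x.
have dF (x : R) : is_derive x 1 (fun y => (y - c) * u y) (f x).
  have d1 : is_derive x 1 (fun y : R => y - c) 1.
    have h := @is_deriveB _ _ _ (@idfun R) (cst c) x 1 1 0 (is_derive_id _ _) (is_derive_cst _ _ _).
    by apply: is_derive_eq h _; rewrite subr0.
  have := du x => d2; have := is_deriveM d1 d2 => d3.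
  by apply: is_derive_eq d3 _; rewrite /f /GRing.scale /=; ring.
have cu : continuous u by exact: trig_continuous.
have cu' : continuous u' by exact: trig_continuous (trig_derivative tu du).
have cf : continuous f.
  move=> x; apply: cvgD; last exact: cu.
  by apply: cvgM; [apply: cvgB; [exact: cvg_id|exact: cvg_cst]|exact: cu'].
have cF : continuous (fun y : R => (y - c) * u y).
  by move=> x; apply: cvgM; [apply: cvgB; [exact: cvg_id|exact: cvg_cst]|exact: cu].
transitivity (\int[leb]_(x in `[c, 1[) f x).
  rewrite (_ : `[c, 1[%classic = itv01 `&` `[c, 1[).
    rewrite Rintegral_mkcondr; apply: eq_Rintegral => x.
    rewrite inE/= in_itv/= => /andP[x0 x1]; rewrite /patch mem_setE in_itv/= x1 andbT /ramp /step /f.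
    case: ifPn => [cx|]; first by rewrite max_l ?mul1r// subr_ge0.
    by rewrite -ltNge => xc; rewrite max_r ?mul0r ?addr0//; lra.
  by apply/seteqP; split=> x /=; rewrite !in_itv/=; [move=> ?; split; lra|case].
have mf : measurable_fun setT (f : measurableTypeR R -> R) by exact: continuous_measurable_fun.
rewrite /Rintegral.
rewrite integral_itv_bndo_bndc; last by apply/measurable_EFinP; exact: measurable_funTS.
rewrite (@continuous_FTC2 R f (fun y => (y - c) * u y) c 1 c1).
- by rewrite subrr mul0r /= oppr0 addr0.
- exact: continuous_subspaceT.
- split.
  + by move=> x _; have := dF x; move=> [].
  + exact/cvg_at_right_filter/cF.
  + exact/cvg_at_left_filter/cF.
- by move=> x _; have := dF x; rewrite derive1E => -[_ ->].
Qed.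

(** The slope is the normalised indicator of one interval minus that of a larger
    one, so that testing with it compares two averages. *)
Definition hat a b u v : R -> R :=
  ((v - u)^-1 \*o (ramp u \+ (-1 \*o ramp v))) \+
  ((- (b - a)^-1) \*o (ramp a \+ (-1 \*o ramp b))).

Definition itv_indic (a b x : R) : R := (a <= x < b)%R%:R.

Lemma step_itv_indic a b x : a <= b -> step a x - step b x = itv_indic a b x.
Proof.
move=> ab; rewrite /step /itv_indic; case: (leP a x) => ax; case: (leP b x) => bx /=;
  rewrite ?subrr ?subr0//; lra.
Qed.

Lemma itv_indic_bdd a b : a <= b -> bdd (itv_indic a b).
Proof.
move=> ab; rewrite (_ : itv_indic a b = step a \+ (-1 \*o step b)).
  by apply: bddD; [|apply: bddZ]; exact: step_bdd.
by apply/funext => x; rewrite /= mulN1r step_itv_indic.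
Qed.

Lemma itv_indic_int a b : 0 <= a <= b -> b <= 1 -> \int[leb]_(x in itv01) itv_indic a b x = b - a.
Proof.
move=> /andP[a0 ab] b1.
rewrite (_ : \int[leb]_(x in itv01) _ = \int[leb]_(x in itv01) ((cst (1 : R)) \_ `[a, b[) x).
  rewrite -Rintegral_mkcondr (_ : itv01 `&` `[a, b[ = `[a, b[%classic).
    rewrite Rintegral_cst// mul1r; have := lebesgue_measure_itv `[a, b[; rewrite /= => ->.
    rewrite lte_fin; case: ltP => //= ba; have -> : a = b by apply/eqP; rewrite eq_le ab.
    by rewrite subrr.
  by apply/seteqP; split=> x /=; rewrite !in_itv/=; [case|move=> ?; split; lra].
by apply: eq_Rintegral => x _; rewrite /patch mem_setE in_itv/= /itv_indic; case: ifP.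
Qed.

Lemma ibp_hat a b u v : 0 <= a <= u -> u < v -> v <= b < 1 ->
  ibp (hat a b u v) (fun x => (v - u)^-1 * itv_indic u v x - (b - a)^-1 * itv_indic a b x) 0.
Proof.
move=> /andP[a0 au] uv /andP[vb b1].
have I c : 0 <= c < 1 -> ibp (ramp c) (step c) (1 - c) by exact: ibp_ramp.
have J c d : 0 <= c < 1 -> 0 <= d < 1 -> ibp (ramp c \+ (-1 \*o ramp d)) (step c \+ (-1 \*o step d)) (1 - c + -1 * (1 - d)).
  by move=> hc hd; apply: ibpD; [exact: I|apply: ibpZ; exact: I].
have Juv : ibp _ _ _ := J u v _ _; have Jab := J a b _ _.
have := ibpD (ibpZ (v - u)^-1 (J u v _ _)) (ibpZ (- (b - a)^-1) (J a b _ _)).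
move=> /(_ _ _ _ _) H.
rewrite (_ : (fun x => _) = ((v - u)^-1 \*o (step u \+ (-1 \*o step v))) \+
    ((- (b - a)^-1) \*o (step a \+ (-1 \*o step b)))); last first.
  by apply/funext => x; rewrite /= !mulN1r !step_itv_indic; [ring|lra|lra].
rewrite (_ : 0 = (v - u)^-1 * (1 - u + -1 * (1 - v)) + - (b - a)^-1 * (1 - a + -1 * (1 - b))).
  by apply: H; lra.
by field; lra.
Qed.

Lemma hat0 a b u v x : a <= u < v -> v <= b -> x < a \/ b <= x -> hat a b u v x = 0.
Proof.
move=> /andP[au uv] vb [xa|bx]; rewrite /hat /ramp /= !mulN1r.
  by rewrite !max_r; [ring|lra|lra|lra|lra].
by rewrite !max_l; [field; lra|lra|lra|lra|lra].
Qed.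

(** The denominator n + 2 keeps the two edges of a trapezoid from
    overlapping. *)
Definition trapezoid_edge u v (n : nat) : R := (v - u) / n.+2%:R.

Definition trapezoid u v n : R -> R :=
  (trapezoid_edge u v n)^-1 \*o ((ramp u \+ (-1 \*o ramp (u + trapezoid_edge u v n))) \+
     (-1 \*o (ramp (v - trapezoid_edge u v n) \+ (-1 \*o ramp v)))).

Definition trapezoid_slope u v n : R -> R :=
  (trapezoid_edge u v n)^-1 \*o ((step u \+ (-1 \*o step (u + trapezoid_edge u v n))) \+
     (-1 \*o (step (v - trapezoid_edge u v n) \+ (-1 \*o step v)))).

Lemma trapezoid_edge_gt0 u v n : u < v -> 0 < trapezoid_edge u v n.
Proof. by move=> uv; rewrite divr_gt0// subr_gt0. Qed.

Lemma trapezoid_edge_le u v n : u < v -> trapezoid_edge u v n + trapezoid_edge u v n <= v - u.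
Proof.
move=> uv; rewrite /trapezoid_edge -mulrDl ler_pdivrMr//.
by have : (2 : R) <= n.+2%:R by [rewrite ler_nat]; nra.
Qed.

Lemma ibp_trapezoid u v n : 0 <= u < v -> v < 1 -> ibp (trapezoid u v n) (trapezoid_slope u v n) 0.
Proof.
move=> /andP[u0 uv] v1; have d0 := trapezoid_edge_gt0 n uv; have d1 := trapezoid_edge_le n uv.
rewrite /trapezoid /trapezoid_slope; set d := trapezoid_edge u v n in d0 d1 *.
rewrite (_ : 0 = d^-1 * ((1 - u + -1 * (1 - (u + d))) + -1 * ((1 - (v - d)) + -1 * (1 - v)))); last by field; lra.
by apply: ibpZ; apply: ibpD; [|apply: ibpZ]; (apply: ibpD; [|apply: ibpZ]); apply: ibp_ramp; lra.
Qed.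

Lemma trapezoid0 u v n x : u < v -> x <= u \/ v <= x -> trapezoid u v n x = 0.
Proof.
move=> uv; have d0 := trapezoid_edge_gt0 n uv; have d1 := trapezoid_edge_le n uv.
rewrite /trapezoid /ramp /= !mulN1r; set d := trapezoid_edge u v n in d0 d1 *; move=> [xu|vx].
  by rewrite !max_r; [ring|lra|lra|lra|lra].
by rewrite !max_l; [ring|lra|lra|lra|lra].
Qed.

Lemma trapezoid_slope0 u v n x : u < v -> x < u \/ v <= x -> trapezoid_slope u v n x = 0.
Proof.
move=> uv; have d0 := trapezoid_edge_gt0 n uv; have d1 := trapezoid_edge_le n uv.
rewrite /trapezoid_slope /step /= !mulN1r; set d := trapezoid_edge u v n in d0 d1 *.
move=> [xu|vx].
  have -> : (u <= x) = false by lra.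
  have -> : (u + d <= x) = false by lra.
  have -> : (v - d <= x) = false by lra.
  have -> : (v <= x) = false by lra.
  by rewrite /=; ring.
have -> : (u <= x) = true by lra.
have -> : (u + d <= x) = true by lra.
have -> : (v - d <= x) = true by lra.
have -> : (v <= x) = true by lra.
by rewrite /=; ring.
Qed.

Lemma trapezoid_le1 u v n x : u < v -> `|trapezoid u v n x| <= 1.
Proof.
move=> uv; have d0 := trapezoid_edge_gt0 n uv; have d1 := trapezoid_edge_le n uv.
rewrite /trapezoid /= !mulN1r; set d := trapezoid_edge u v n in d0 d1 *.
rewrite normrM gtr0_norm ?invr_gt0// mulrC ler_pdivrMr// mul1r /ramp ler_norml.
case: (lerP (x - u) 0); case: (lerP (x - (u + d)) 0); case: (lerP (x - (v - d)) 0); case: (lerP (x - v) 0); lra.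
Qed.

Lemma trapezoid_cvg u v x : u < v -> x != u -> trapezoid u v ^~ x @ \oo --> itv_indic u v x.
Proof.
move=> uv xu.
have [h|h] : (x <= u \/ v <= x) \/ (u < x < v) by lra.
  rewrite (_ : itv_indic u v x = 0); last first.
    rewrite /itv_indic; case: h => h; last by rewrite (leNgt v) in h; rewrite (negbTE h) andbF.
    by rewrite leNgt lt_neqAle xu h.
  by apply: cvg_near_cst; apply: nearW => n; exact: trapezoid0.
rewrite (_ : itv_indic u v x = 1); last first.
  by rewrite /itv_indic; case/andP: h => h1 h2; rewrite (ltW h1) h2.
have dcvg : (fun n => trapezoid_edge u v n) @ \oo --> 0.
  rewrite /trapezoid_edge -(mulr0 (v - u)); apply: cvgM; first exact: cvg_cst.
  have := @cvg_harmonic R; rewrite -(cvg_shiftS (@harmonic R)); exact.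
have m0 : 0 < Num.min (x - u) (v - x) by rewrite lt_min; lra.
move/cvgrPdist_lt : dcvg => /(_ _ m0) near_d.
apply: cvg_near_cst; apply: filterS near_d => n.
have d0 := trapezoid_edge_gt0 n uv.
rewrite sub0r normrN gtr0_norm// lt_min => /andP[d1 d2].
rewrite /trapezoid /ramp /= !mulN1r; set d := trapezoid_edge u v n in d0 d1 d2 *.
rewrite (max_l (_ : 0 <= x - u)); last by lra.
rewrite (max_l (_ : 0 <= x - (u + d))); last by lra.
rewrite (max_r (_ : x - (v - d) <= 0)); last by lra.
rewrite (max_r (_ : x - v <= 0)); last by lra.
by field; lra.
Qed.

End Ramps.

(** * Curl-free fields proportional to the identity *)

Section LocalConstancy.
Variable R : realType.
Local Notation plane := (measurableTypeR R * measurableTypeR R)%type.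
Local Notation leb := (@lebesgue_measure R).
Local Notation leb2 := (leb2 R).
Local Notation cell := (@cell R).
Local Notation sq := (sqint leb2 cell).
Local Notation ip := (inner_product leb2 cell).

Let mC := @measurable_cell R.
Let fC := @leb2_cell_fin R.

Lemma weak_grad_tens (T t S s : R -> R) : ibp T t 0 -> ibp S s 0 ->
  weak_grad (tens T S) (tens t S) (tens T s).
Proof.
move=> [bT bt HT] [bS bs HS]; split; try exact: tens_sqint.
move=> u u' w w' tu tw du dw.
have bu := trig_bdd tu; have bu' := trig_derive_bdd tu du.
have bw := trig_bdd tw; have bw' := trig_derive_bdd tw dw.
split; rewrite !ip_tens//.
  by rewrite (HT _ _ tu du) mul0r sub0r mulNr.
by rewrite (HS _ _ tw dw) mul0r sub0r mulrN.
Qed.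

(** Orthogonality to rotated gradients, the dual form of being curl-free. Unlike
    being the gradient of a periodic function it is stable under adding
    constants. *)
Definition curlfree (E1 E2 : plane -> R) : Prop :=
  [/\ sq E1, sq E2 & forall w H1 H2, weak_grad w H1 H2 -> ip E1 H2 = ip E2 H1].

Lemma weak_grad_curlfree v E1 E2 : weak_grad v E1 E2 -> curlfree E1 E2.
Proof.
move=> h; have [_ s1 s2 _] := h; split=> // w H1 H2 hw.
exact: null_lagrangian h hw.
Qed.

Lemma weak_grad_mean0 v E1 E2 : weak_grad v E1 E2 -> ip (cst 1) E1 = 0 /\ ip (cst 1) E2 = 0.
Proof.
move=> [sv s1 s2 H].
have d1 (x : R) : is_derive x 1 (cst 1 : R -> R) ((cst 0 : R -> R) x) by exact: is_derive_cst.
have [h1 h2] := H _ _ _ _ (trig_cst 1) (trig_cst 1) d1 d1.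
have E : tens (cst 1) (cst 1) = cst 1 :> (plane -> R).
  by apply/funext => x; rewrite /tens /= mulr1.
have Z1 : ip v (tens (cst 0) (cst 1)) = 0.
  by rewrite /inner_product (_ : (fun x => _) = cst 0) ?Rintegral_cst ?mul0r//; apply/funext => x; rewrite /tens /= mul0r mulr0.
have Z2 : ip v (tens (cst 1) (cst 0)) = 0.
  by rewrite /inner_product (_ : (fun x => _) = cst 0) ?Rintegral_cst ?mul0r//; apply/funext => x; rewrite /tens /= mulr0 mulr0.
move: h1 h2; rewrite Z1 Z2 E => /esym/eqP; rewrite oppr_eq0 => /eqP h1 /esym/eqP.
by rewrite oppr_eq0 => /eqP h2; rewrite !(ipC _ _ (cst 1)).
Qed.

Lemma curlfree_cst E1 E2 c1 c2 : curlfree E1 E2 ->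
  curlfree (E1 \+ cst c1) (E2 \+ cst c2).
Proof.
move=> [s1 s2 H]; have sc c : sq (cst c) by exact: sqint_cst.
split; try exact: sqintD.
move=> w H1 H2 hw; have [_ sH1 sH2 _] := hw.
rewrite !ipDl// (H _ _ _ hw).
have h c (G : plane -> R) : sq G -> ip (cst 1) G = 0 -> ip (cst c) G = 0.
  move=> sG G0; rewrite (_ : cst c = c \*o cst 1); last by apply/funext => x; rewrite /= mulr1.
  by rewrite ipZl// G0 mulr0.
have [m1 m2] := weak_grad_mean0 hw.
by rewrite (h _ _ sH2 m2) (h _ _ sH1 m1).
Qed.

Definition rect (a b c d : R) : set plane := `[a, b[ `*` `[c, d[.

Lemma hat_slope_bdd (a b u v : R) : a <= b -> u <= v ->
  bdd (fun x => (v - u)^-1 * itv_indic u v x - (b - a)^-1 * itv_indic a b x).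
Proof.
move=> ab uv; rewrite (_ : (fun x => _) = ((v - u)^-1 \*o itv_indic u v) \+ ((- (b - a)^-1) \*o itv_indic a b)).
  by apply: bddD; apply: bddZ; exact: itv_indic_bdd.
by apply/funext => x; rewrite /= mulNr.
Qed.

Lemma tens_trapezoid_cvg (E : plane -> R) (T : R -> R) u v : sq E -> bdd T -> 0 <= u < v -> v < 1 ->
  ((fun n => ip (tens T (trapezoid u v n)) E) @ \oo --> ip (tens T (itv_indic u v)) E) /\
  ((fun n => ip (tens (trapezoid u v n) T) E) @ \oo --> ip (tens (itv_indic u v) T) E).
Proof.
move=> sE bT u0v v1; have /andP[u0 uv] := u0v.
have bt n : bdd (trapezoid u v n) by have [] := ibp_trapezoid n u0v v1.
have bi : bdd (itv_indic u v) by apply: itv_indic_bdd; exact: ltW.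
have [mT [M TM]] := bT.
have i1 x : `|itv_indic u v x| <= 1 by rewrite /itv_indic; case: (_ && _); rewrite ?normr1 ?normr0.
have [N [mN N0 sN]] := @negligible_lines R [set u] (finite_set_countable (finite_set1 u)).
split; apply: ip_cvg => //; try (by move=> n; exact: tens_sqint); try exact: tens_sqint.
- apply: (@ip_dominated _ _ _ leb2 cell mC _ _ (cst M)).
  + by move=> n; exact: tens_sqint.
  + exact: tens_sqint.
  + exact: sqint_cst.
  + exists N; split => // x nx; apply: sN => /=; apply: contrapT => hx; apply: nx => _.
    apply: cvgM; first exact: cvg_cst.
    by apply: trapezoid_cvg => //; apply/eqP => h; apply: hx; right.
  + move=> n x [x1 x2]; rewrite normrM -[leRHS]mulr1 ler_pM//; [exact: TM|exact: trapezoid_le1].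
  + by move=> x [x1 x2]; rewrite normrM -[leRHS]mulr1 ler_pM//; exact: TM.
- apply: (@ip_dominated _ _ _ leb2 cell mC _ _ (cst M)).
  + by move=> n; exact: tens_sqint.
  + exact: tens_sqint.
  + exact: sqint_cst.
  + exists N; split => // x nx; apply: sN => /=; apply: contrapT => hx; apply: nx => _.
    apply: cvgM; last exact: cvg_cst.
    by apply: trapezoid_cvg => //; apply/eqP => h; apply: hx; left.
  + move=> n x [x1 x2]; rewrite normrM -[leRHS]mul1r ler_pM//; [exact: trapezoid_le1|exact: TM].
  + by move=> x [x1 x2]; rewrite normrM -[leRHS]mul1r ler_pM//; exact: TM.
Qed.

Lemma ip_ae0 (E g : plane -> R) (A : set plane) : sq E -> sq g ->
  {ae leb2, forall x, A x -> E x = 0} -> (forall x, cell x -> ~ A x -> g x = 0) ->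
  ip E g = 0.
Proof.
move=> sE sg E0 g0; have s0 : sq (cst 0) by exact: sqint_cst.
rewrite (@ip_ae_eq _ _ _ leb2 cell mC E (cst 0) g (cst 0))//.
  by rewrite /inner_product (_ : (fun x => _) = cst 0) ?Rintegral_cst ?mul0r//; apply/funext => x /=; rewrite mulr0.
apply: filterS E0 => x h Dx /=; rewrite mulr0.
by have [Ax|nA] := pselect (A x); [rewrite h// mul0r|rewrite g0// mulr0].
Qed.

Section OnRect.
Variables (a b c d : R).
Hypotheses (a0 : 0 <= a) (ab : a < b) (b1 : b < 1) (c0 : 0 <= c) (cd : c < d) (d1 : d < 1).

(** Test with hat (x) trapezoid: its first derivative compares the averages of
    E2 over two intervals, while its second derivative lives where E1 vanishes.
    Then let the trapezoids tend to an indicator. *)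
Lemma curlfree_indep1 E1 E2 u v p q : curlfree E1 E2 ->
  {ae leb2, forall x, rect a b c d x -> E1 x = 0} ->
  a <= u -> u < v -> v <= b -> c <= p -> p < q -> q <= d ->
  (v - u)^-1 * ip (tens (itv_indic u v) (itv_indic p q)) E2 =
  (b - a)^-1 * ip (tens (itv_indic a b) (itv_indic p q)) E2.
Proof.
move=> [s1 s2 H] E10 au uv vb cp pq qd.
have hu : 0 <= a <= u by rewrite a0.
have hv : v <= b < 1 by rewrite vb.
have hp : 0 <= p < q by rewrite (le_trans c0).
have q1 : q < 1 by exact: le_lt_trans d1.
have ih := ibp_hat hu uv hv.
have bh := hat_slope_bdd (ltW ab) (ltW uv).
have buv : bdd (itv_indic u v) by apply: itv_indic_bdd; lra.
have bab : bdd (itv_indic a b) by apply: itv_indic_bdd; lra.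
have bpq : bdd (itv_indic p q) by apply: itv_indic_bdd; lra.
have Z n : ip (tens (fun x => (v - u)^-1 * itv_indic u v x - (b - a)^-1 * itv_indic a b x) (trapezoid p q n)) E2 = 0.
  have it := ibp_trapezoid n hp q1; have [bt bt' _] := it; have [bhat _ _] := ih.
  rewrite ipC -(H _ _ _ (weak_grad_tens ih it)).
  apply: (@ip_ae0 _ _ (rect a b c d)) => //; first exact: tens_sqint.
  move=> x _ nx; rewrite /tens.
  have [ha|ha] := boolP (a <= x.1 < b); last first.
    by rewrite hat0 ?mul0r//; lra.
  have [hc|hc] := boolP (c <= x.2 < d); last first.
    by rewrite trapezoid_slope0 ?mulr0//; lra.
  by case: nx; rewrite /rect; split; rewrite /= in_itv.
have [cv _] := tens_trapezoid_cvg s2 bh hp q1.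
have L : ip (tens (fun x => (v - u)^-1 * itv_indic u v x - (b - a)^-1 * itv_indic a b x) (itv_indic p q)) E2 = 0.
  apply: (cvg_unique _ cv); first exact: Rhausdorff.
  by apply: cvg_near_cst; apply: nearW => n; exact: Z.
apply/eqP; rewrite -subr_eq0 -L; apply/eqP.
have su := tens_sqint buv bpq; have sa := tens_sqint bab bpq.
rewrite -!ipZl// -ipBl//; try exact: sqintZ.
by apply: eq_Rintegral => x _; rewrite /tens /=; ring.
Qed.

Lemma curlfree_indep2 E1 E2 u v p q : curlfree E1 E2 ->
  {ae leb2, forall x, rect a b c d x -> E2 x = 0} ->
  a <= u -> u < v -> v <= b -> c <= p -> p < q -> q <= d ->
  (q - p)^-1 * ip (tens (itv_indic u v) (itv_indic p q)) E1 =
  (d - c)^-1 * ip (tens (itv_indic u v) (itv_indic c d)) E1.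
Proof.
move=> [s1 s2 H] E20 au uv vb cp pq qd.
have hp : 0 <= c <= p by rewrite c0.
have hq : q <= d < 1 by rewrite qd.
have hu : 0 <= u < v by rewrite (le_trans a0).
have v1 : v < 1 by exact: le_lt_trans b1.
have ih := ibp_hat hp pq hq.
have bh := hat_slope_bdd (ltW cd) (ltW pq).
have buv : bdd (itv_indic u v) by apply: itv_indic_bdd; lra.
have bcd : bdd (itv_indic c d) by apply: itv_indic_bdd; lra.
have bpq : bdd (itv_indic p q) by apply: itv_indic_bdd; lra.
have Z n : ip (tens (trapezoid u v n) (fun x => (q - p)^-1 * itv_indic p q x - (d - c)^-1 * itv_indic c d x)) E1 = 0.
  have it := ibp_trapezoid n hu v1; have [bt bt' _] := it; have [bhat _ _] := ih.
  rewrite ipC (H _ _ _ (weak_grad_tens it ih)).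
  apply: (@ip_ae0 _ _ (rect a b c d)) => //; first exact: tens_sqint.
  move=> x _ nx; rewrite /tens.
  have [ha|ha] := boolP (a <= x.1 < b); last first.
    by rewrite trapezoid_slope0 ?mul0r//; lra.
  have [hc|hc] := boolP (c <= x.2 < d); last first.
    by rewrite hat0 ?mulr0//; lra.
  by case: nx; rewrite /rect; split; rewrite /= in_itv.
have [_ cv] := tens_trapezoid_cvg s1 bh hu v1.
have L : ip (tens (itv_indic u v) (fun x => (q - p)^-1 * itv_indic p q x - (d - c)^-1 * itv_indic c d x)) E1 = 0.
  apply: (cvg_unique _ cv); first exact: Rhausdorff.
  by apply: cvg_near_cst; apply: nearW => n; exact: Z.
apply/eqP; rewrite -subr_eq0 -L; apply/eqP.
have su := tens_sqint buv bpq; have sa := tens_sqint buv bcd.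
rewrite -!ipZl// -ipBl//; try exact: sqintZ.
by apply: eq_Rintegral => x _; rewrite /tens /=; ring.
Qed.

(** The sets whose indicator is orthogonal to h form a lambda-system, hence are
    all the Borel sets; as indicators span a dense subspace, h is orthogonal to
    itself. *)
Lemma orth_quadrants h : sq h ->
  (forall A B : set R, A = setT \/ (exists r, A = `]-oo, r[%classic) ->
     B = setT \/ (exists r, B = `]-oo, r[%classic) -> ip (\1_(A `*` B) : plane -> R) h = 0) ->
  {ae leb2, forall x, cell x -> h x = 0}.
Proof.
move=> sh hq.
have s1 : sq (cst 1) by exact: sqint_cst.
have hT : ip (cst 1) h = 0.
  have := hq setT setT; rewrite setXTT indicT; apply; by left.
have orthE E : measurable E -> ip (\1_E : plane -> R) h = 0.
  move: E; apply: (@quadrant_induction R (fun E => ip (\1_E : plane -> R) h = 0)).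
  - by rewrite indicT.
  - by move=> A B; exact: hq.
  - move=> E mE hE; rewrite (_ : \1_(~` E) = cst 1 \- (\1_E : plane -> R)).
      by rewrite ipBl//; [rewrite hT hE subrr|exact: indic_sqint].
    by apply/funext => x; rewrite /= !indicE in_setC; case: (_ \in _); rewrite /= ?subrr ?subr0.
  - move=> F mF tF hF; have cv := indic_bigcup_cvg mF tF.
    have sF N : sq (fun x : plane => \sum_(n < N) \1_(F n) x).
      by apply: sqint_sum => // i; exact: indic_sqint.
    have sU : sq (\1_(\bigcup_n F n) : plane -> R) by apply: indic_sqint; exact: bigcupT_measurable.
    have := ip_cvg mC sF sU sh cv => cv'.
    apply: (cvg_unique _ cv'); first exact: Rhausdorff.
    apply: cvg_near_cst; apply: nearW => N; rewrite ip_suml//; last by move=> i; exact: indic_sqint.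
    by rewrite big1.
pose S : set (plane -> R) := [set g | sq g /\ ip g h = 0].
have [_ hS] : L2closure leb2 cell S h.
  apply: L2_density => //.
  - by move=> p [].
  - move=> p q [sp hp] [sq' hq']; split; first exact: sqintD.
    by rewrite ipDl// hp hq' addr0.
  - move=> k p [sp hp]; split; first exact: sqintZ.
    by rewrite ipZl// hp mulr0.
  - move=> E mE; apply: L2closureS => //.
    + by move=> p [].
    + by split; [exact: indic_sqint|exact: orthE].
apply: ip_eq0_ae => //.
apply/eqP; rewrite eq_le ip_ge0 andbT; apply/ler_addgt0Pr => e e0; rewrite add0r.
have [p [sp hp] le_e] := hS _ e0.
have := ip_ge0 leb2 cell p.
move: le_e; rewrite ipBl// ?ipBr// ?(ipC _ _ h p) ?hp; try exact: sqintB.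
lra.
Qed.

(** The second row makes the common diagonal entry independent of the first
    variable, and the first row makes it independent of the second one. It then
    has the same average k over all subrectangles, so F11 - k is orthogonal to
    all quadrants. *)
Theorem curlfree_scalar_cst F11 F12 F21 F22 : curlfree F11 F12 -> curlfree F21 F22 ->
  {ae leb2, forall x, rect a b c d x -> F12 x = 0} ->
  {ae leb2, forall x, rect a b c d x -> F21 x = 0} ->
  {ae leb2, forall x, rect a b c d x -> F11 x = F22 x} ->
  exists k, {ae leb2, forall x, rect a b c d x -> F11 x = k}.
Proof.
move=> cf1 cf2 E12 E21 E1122.
have [s11 _ _] := cf1; have [_ s22 _] := cf2.
have bi u v : u <= v -> bdd (itv_indic u v) by exact: itv_indic_bdd.
have si u v p q : u <= v -> p <= q -> sq (tens (itv_indic u v) (itv_indic p q)).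
  by move=> *; apply: tens_sqint; exact: bi.
have itv0 u v p q x : a <= u -> v <= b -> c <= p -> q <= d ->
    ~ rect a b c d x -> tens (itv_indic u v) (itv_indic p q) x = 0.
  move=> au vb cp qd nx; rewrite /tens /itv_indic.
  case: (boolP (u <= x.1 < v)) => h1; last by rewrite mul0r.
  case: (boolP (p <= x.2 < q)) => h2; last by rewrite mulr0.
  by case: nx; split; rewrite /= in_itv/=; lra.
pose k := ip (tens (itv_indic a b) (itv_indic c d)) F11 / ((b - a) * (d - c)).
have key u v p q : a <= u -> u <= v -> v <= b -> c <= p -> p <= q -> q <= d ->
    ip (tens (itv_indic u v) (itv_indic p q)) F11 = k * ((v - u) * (q - p)).
  move=> au uv vb cp pq qd.
  have [uv'|uv'] := ltP u v; last first.
    have -> : v = u by lra.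
    rewrite subrr mul0r mulr0 /inner_product (_ : (fun x => _) = cst 0) ?Rintegral_cst ?mul0r//.
    by apply/funext => x; rewrite /tens /itv_indic; case: ltP; rewrite ?andbF ?andbT; case: leP; rewrite /= ?mul0r//; lra.
  have [pq'|pq'] := ltP p q; last first.
    have -> : q = p by lra.
    rewrite subrr !mulr0 /inner_product (_ : (fun x => _) = cst 0) ?Rintegral_cst ?mul0r//.
    by apply/funext => x; rewrite /tens /itv_indic; case: (ltP x.2); rewrite ?andbF ?andbT; case: (leP p); rewrite /= ?mulr0 ?mul0r//; lra.
  have e1122 u' v' p' q' : a <= u' -> u' <= v' -> v' <= b -> c <= p' -> p' <= q' -> q' <= d ->
      ip (tens (itv_indic u' v') (itv_indic p' q')) F22 = ip (tens (itv_indic u' v') (itv_indic p' q')) F11.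
    move=> *; apply: ip_ae_eq => //; try exact: si.
    apply: filterS E1122 => x hx _.
    have [Ax|nA] := pselect (rect a b c d x); first by rewrite hx.
    by rewrite itv0// !mul0r.
  have h1 := curlfree_indep1 cf2 E21 au uv' vb (lexx c) cd (lexx d).
  have h2 := curlfree_indep2 cf1 E12 au uv' vb cp pq' qd.
  rewrite !e1122 in h1; [|lra..].
  have {}h1 : ip (tens (itv_indic u v) (itv_indic c d)) F11 =
      (v - u) * ((b - a)^-1 * ip (tens (itv_indic a b) (itv_indic c d)) F11) by rewrite -h1; field; lra.
  have {}h2 : ip (tens (itv_indic u v) (itv_indic p q)) F11 =
      (q - p) * ((d - c)^-1 * ip (tens (itv_indic u v) (itv_indic c d)) F11) by rewrite -h2; field; lra.
  by rewrite h2 h1 /k; field; lra.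
pose Q := tens (itv_indic a b) (itv_indic c d).
have sQ : sq Q by apply: si; exact: ltW.
have sk : sq (cst k) by exact: sqint_cst.
have sF : sq (F11 \- cst k) by exact: sqintB.
have Q1 x : `|Q x| <= 1.
  by rewrite /Q /tens /itv_indic; case: (_ && _); case: (_ && _); rewrite ?mulr1 ?mulr0 ?normr1 ?normr0.
have sh : sq (Q \* (F11 \- cst k)).
  by apply: (sqintMb mC _ (M := 1)) => //; exact: sQ.1.
have [] := @orth_quadrants (Q \* (F11 \- cst k)) sh.
  move=> A B rA rB.
  have cut (l m : R) (X : set R) : l < m -> X = setT \/ (exists r, X = `]-oo, r[%classic) ->
      exists m', [/\ l <= m', m' <= m & forall x, itv_indic l m x * \1_X x = itv_indic l m' x].
    move=> lm [->|[r ->]].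
      by exists m; split=> //; [exact: ltW|move=> x; rewrite indicT mulr1].
    exists (Num.max l (Num.min r m)); split.
    - by rewrite le_max lexx.
    - by rewrite ge_max ge_min lexx orbT andbT ltW.
    - move=> x; rewrite indicE mem_setE in_itv/= /itv_indic -natrM mulnb; congr (_ %:R).
      congr nat_of_bool; rewrite lt_max lt_min.
      case: (leP l x) => lx /=; last by [].
      by rewrite andbC.
  have [b' [ab' bb' Hb]] := cut _ _ _ ab rA; have [d' [cd' dd' Hd]] := cut _ _ _ cd rB.
  transitivity (ip (tens (itv_indic a b') (itv_indic c d')) (F11 \- cst k)).
    apply: eq_Rintegral => x _.
    rewrite (_ : \1_(A `*` B) x = \1_A x.1 * \1_B x.2); last first.
      by rewrite !indicE in_setX; case: (_ \in _); case: (_ \in _); rewrite ?mulr1 ?mulr0 ?mul0r.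
    by rewrite /Q /tens -Hb -Hd /=; ring.
  rewrite ipBr//; last exact: si.
  rewrite key//.
  rewrite (_ : ip _ (cst k) = k * ((b' - a) * (d' - c))) ?subrr//.
  have -> : cst k = k \*o tens (cst 1) (cst 1) :> (plane -> R).
    by apply/funext => x; rewrite /tens /= !mulr1.
  have b1' : bdd (cst 1 : R -> R) by exact/trig_bdd/trig_cst.
  rewrite ipZr; [|exact: mC|exact: si|exact: tens_sqint].
  rewrite ip_tens//; try exact: bi.
  have m1 (h : R -> R) : \int[leb]_(x in `[0, 1[) (h x * cst 1 x) = \int[leb]_(x in `[0, 1[) h x.
    by apply: eq_Rintegral => x _; rewrite mulr1.
  by rewrite !m1 !itv_indic_int ?a0 ?c0 ?(ltW (le_lt_trans dd' d1)) ?(ltW (le_lt_trans bb' b1)).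
move=> N [mN N0 sN]; exists k; exists N; split=> // x nx; apply: sN => /= h; apply: nx => rx.
have [r1 r2] := rx; move: r1 r2; rewrite /= !in_itv/= => r1 r2.
have cx : cell x.
  case/andP: (r1) => r3 r4; case/andP: (r2) => r5 r6.
  split; rewrite /= in_itv/=; first by rewrite (le_trans a0)// (lt_trans r4).
  by rewrite (le_trans c0)// (lt_trans r6).
have := h cx; rewrite /Q /tens /itv_indic r1 r2 /= !mul1r => /eqP.
by rewrite subr_eq0 => /eqP.
Qed.

End OnRect.

End LocalConstancy.

(** * Local values up to a Lipschitz boundary *)

(** A relation V stands for the function, because the value of a function known
    up to null sets is only visible on a neighbourhood. *)
Lemma connected_locally_constant (T : topologicalType) (K : Type) (S : set T)
    (V : T -> K -> Prop) : connected S ->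
  (forall x, S x -> exists k U, [/\ open U, U x & forall y, U y -> S y -> V y k]) ->
  (forall x k k', S x -> V x k -> V x k' -> k = k') ->
  forall x0 k0, S x0 -> V x0 k0 -> forall y, S y -> V y k0.
Proof.
move=> cS locV uniqV x0 k0 Sx0 Vx0.
pose C1 : set T := [set y | exists U, [/\ open U, U y & forall z, U z -> S z -> V z k0]].
pose C2 : set T := [set y | exists k U, [/\ k <> k0, open U, U y & forall z, U z -> S z -> V z k]].
have o1 : open C1.
  rewrite openE => y [U [oU Uy UV]]; apply: (filterS _ (open_nbhs_nbhs (conj oU Uy))) => z Uz.
  by exists U.
have o2 : open C2.
  rewrite openE => y [k [U [kk oU Uy UV]]]; apply: (filterS _ (open_nbhs_nbhs (conj oU Uy))) => z Uz.
  by exists k, U.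
have E1 : [set y | S y /\ V y k0] = S `&` C1.
  apply/seteqP; split=> [y [Sy Vy]|y [Sy [U [oU Uy UV]]]]; last by split=> //; exact: UV.
  split=> //; have [k [U [oU Uy UV]]] := locV _ Sy; exists U; split=> //.
  by rewrite (uniqV _ _ _ Sy Vy (UV _ Uy Sy)).
have E2 : [set y | S y /\ V y k0] = S `&` ~` C2.
  apply/seteqP; split=> [y [Sy Vy]|y [Sy nC]].
    by split=> // -[k [U [kk oU Uy UV]]]; apply: kk; apply: (uniqV y) => //; exact: UV.
  split=> //; have [k [U [oU Uy UV]]] := locV _ Sy; apply: contrapT => nV; apply: nC.
  by exists k, U; split=> // kk; apply: nV; rewrite -kk; exact: UV.
have ne : [set y | S y /\ V y k0] !=set0 by exists x0.
have ES := cS _ ne (ex_intro2 _ _ _ o1 E1) (ex_intro2 _ _ _ (open_closedC o2) E2).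
by move=> y; rewrite -ES => -[].
Qed.

Section Geometry.
Variable R : realType.
Local Notation plane := (measurableTypeR R * measurableTypeR R)%type.
Local Notation leb := (@lebesgue_measure R).
Local Notation leb2 := (leb2 R).

Lemma leb2_sqbox (x : R * R) r : 0 < r -> leb2 (sqbox x r) = ((r *+ 2) ^+ 2)%:E.
Proof.
move=> r0.
rewrite (_ : sqbox x r = `]x.1 - r, x.1 + r[%classic `*` `]x.2 - r, x.2 + r[%classic); last first.
  by apply/seteqP; split=> y [] /=; rewrite ?in_itv/= ?ltr_norml => *; split; rewrite ?in_itv/= ?ltr_norml; lra.
have h (z : R) : leb `]z - r, z + r[ = (r *+ 2)%:E.
  rewrite lebesgue_measure_itv /= lte_fin ifT; last by lra.
  by rewrite -EFinB; congr EFin; ring.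
by rewrite leb2X; [rewrite !h -EFinM expr2|exact: measurable_itv|exact: measurable_itv].
Qed.

Lemma sqbox_not_negligible (x : R * R) r : 0 < r -> ~ leb2.-negligible (sqbox x r).
Proof.
move=> r0 /(negligibleP leb2 (measurable_sqbox x r)) H.
have H' : leb2 (sqbox x r) = 0%E := H.
have : (0 < leb2 (sqbox x r))%E by rewrite leb2_sqbox// lte_fin exprn_gt0// pmulrn_lgt0.
by rewrite H' ltxx.
Qed.

Lemma sqbox_sub (x y : R * R) r : sqbox x r y -> exists2 s, 0 < s & sqbox y s `<=` sqbox x r.
Proof.
move=> [y1 y2]; exists (Num.min (r - `|y.1 - x.1|) (r - `|y.2 - x.2|)).
  by rewrite lt_min !subr_gt0 y1.
move=> z [z1 z2]; move: z1 z2; rewrite !lt_min => /andP[z1 _] /andP[_ z2]; split.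
  by have := ler_distD y.1 z.1 x.1; lra.
by have := ler_distD y.2 z.2 x.2; lra.
Qed.

Section Chart.
Variables (x : R * R) (theta : R).

Definition chart (p : R * R) : R * R :=
  (x.1 + p.1 * cos theta - p.2 * sin theta, x.2 + p.1 * sin theta + p.2 * cos theta).

Definition unchart (y : R * R) : R * R :=
  ((y.1 - x.1) * cos theta + (y.2 - x.2) * sin theta,
   (y.2 - x.2) * cos theta - (y.1 - x.1) * sin theta).

Lemma unchartK y : chart (unchart y) = y.
Proof.
rewrite /chart /unchart; have := cos2Dsin2 theta.
set c := cos theta; set s := sin theta => cs; case: y => y1 y2 /=; congr pair.
  transitivity (x.1 + (y1 - x.1) * (c ^+ 2 + s ^+ 2)); first by ring.
  by rewrite cs; ring.
transitivity (x.2 + (y2 - x.2) * (c ^+ 2 + s ^+ 2)); first by ring.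
by rewrite cs; ring.
Qed.

Lemma rot_bound (a b : R) : `|a * cos theta| + `|b * sin theta| <= `|a| + `|b| /\
  `|a * sin theta| + `|b * cos theta| <= `|a| + `|b|.
Proof.
have hc := cos_max theta; have hs := sin_max theta.
by rewrite !normrM; split; apply: lerD; rewrite -[leRHS]mulr1 ler_wpM2l.
Qed.

Lemma chart_dist p q : `|(chart p).1 - (chart q).1| <= `|p.1 - q.1| + `|p.2 - q.2| /\
  `|(chart p).2 - (chart q).2| <= `|p.1 - q.1| + `|p.2 - q.2|.
Proof.
have [h1 h2] := rot_bound (p.1 - q.1) (p.2 - q.2); rewrite /chart /=; split.
  apply: le_trans h1.
  rewrite (_ : _ - _ = (p.1 - q.1) * cos theta - (p.2 - q.2) * sin theta); last by ring.
  exact: ler_normB.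
apply: le_trans h2.
rewrite (_ : _ - _ = (p.1 - q.1) * sin theta + (p.2 - q.2) * cos theta); last by ring.
exact: ler_normD.
Qed.

Lemma unchart_dist y z : `|(unchart y).1 - (unchart z).1| <= `|y.1 - z.1| + `|y.2 - z.2| /\
  `|(unchart y).2 - (unchart z).2| <= `|y.1 - z.1| + `|y.2 - z.2|.
Proof.
have [h1 _] := rot_bound (y.1 - z.1) (y.2 - z.2).
have [_ h2] := rot_bound (y.1 - z.1) (y.2 - z.2); rewrite /unchart /=; split.
  apply: le_trans h1.
  rewrite (_ : _ - _ = (y.1 - z.1) * cos theta + (y.2 - z.2) * sin theta); last by ring.
  exact: ler_normD.
apply: le_trans h2.
rewrite (_ : _ - _ = (y.2 - z.2) * cos theta - (y.1 - z.1) * sin theta); last by ring.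
by apply: le_trans (ler_normB _ _) _; rewrite addrC.
Qed.

Lemma unchart0 : unchart x = (0, 0).
Proof. by rewrite /unchart !subrr !mul0r addr0 subr0. Qed.

(** About 2N squares of side of order 1/N cover the graph, with total area of
    order 1/N. *)
Lemma lipschitz_graph_negligible (g : R -> R) (L d : R) : 0 < L -> 0 < d ->
  (forall s s', `|g s - g s'| <= L * `|s - s'|) ->
  leb2.-negligible [set chart (s, g s) | s in `[- d, d]].
Proof.
move=> L0 d0 gL.
pose sN (N i : nat) : R := - d + i%:R * (d / N.+1%:R).
pose eta (N : nat) : R := 2 * (1 + L) * d / N.+1%:R.
have eta0 N : 0 < eta N by rewrite divr_gt0// !mulr_gt0// addr_gt0.
pose A N i : set plane := sqbox (chart (sN N i, g (sN N i))) (eta N).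
pose U N : set plane := \big[setU/set0]_(i < (N.+1).*2.+1) A N i.
have mU N : measurable (U N) by apply: bigsetU_measurable => i _; exact: measurable_sqbox.
have cover N : [set chart (s, g s) | s in `[- d, d]] `<=` U N.
  move=> _ [s + <-]; rewrite /= in_itv/= => /andP[s1 s2].
  have n0 : (0 : R) < N.+1%:R by rewrite ltr0n.
  pose j := Num.truncn ((s + d) * N.+1%:R / d).
  have x0 : 0 <= (s + d) * N.+1%:R / d by apply: divr_ge0 (ltW d0); apply: mulr_ge0 (ltW n0); lra.
  have /andP[j1 j2] := truncn_itv x0.
  rewrite -/j in j1 j2.
  have jN : (j < (N.+1).*2.+1)%N.
    rewrite ltnS -(ler_nat R); apply: le_trans j1 _.
    by rewrite ler_pdivrMr// -muln2 natrM; nra.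
  rewrite /U -(bigcup_mkord _ (A N)); exists j => //.
  have sj : `|s - sN N j| <= d / N.+1%:R.
    move: j1 j2; rewrite ler_pdivlMr// ltr_pdivrMr// -(natr1 j) => j1 j2.
    rewrite /sN; set h := d / N.+1%:R.
    have h0 : 0 < h by rewrite divr_gt0.
    have hN : d = h * N.+1%:R by rewrite /h divfK// gt_eqF.
    have l1 : j%:R * h <= s + d by rewrite -(ler_pM2r n0) -mulrA -hN.
    have l2 : s + d < (j%:R + 1) * h by rewrite -(ltr_pM2r n0) -mulrA -hN.
    by rewrite ler_norml; apply/andP; split; lra.
  have [h1 h2] := chart_dist (s, g s) (sN N j, g (sN N j)).
  have hb : `|s - sN N j| + `|g s - g (sN N j)| < eta N.
    have gl := gL s (sN N j); have e0 := eta0 N.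
    have -> : eta N = 2 * ((1 + L) * (d / N.+1%:R)) by rewrite /eta; field; rewrite gt_eqF.
    have L1 : 0 < 1 + L by lra.
    apply: (@le_lt_trans _ _ ((1 + L) * (d / N.+1%:R))).
      apply: le_trans (ler_wpM2l (ltW L1) sj); rewrite mulrDl mul1r.
      exact: lerD.
    by rewrite ltr_pMl ?ltr1n// mulr_gt0// divr_gt0.
  by split; [exact: le_lt_trans h1 hb|exact: le_lt_trans h2 hb].
have muU N : (leb2 (U N) <= ((48 * ((1 + L) * d) ^+ 2) / N.+1%:R)%:E)%E.
  have mA i : (i < (N.+1).*2.+1)%N -> measurable (A N i) by move=> _; exact: measurable_sqbox.
  apply: (le_trans (Boole_inequality leb2 mA)).
  rewrite (eq_bigr (fun=> ((eta N *+ 2) ^+ 2)%:E)); last by move=> i _; exact: leb2_sqbox.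
  rewrite sumEFin lee_fin sumr_const card_ord.
  have n1 : (1 : R) <= N.+1%:R by rewrite ler1n.
  have n0 : (0 : R) < N.+1%:R by rewrite ltr0n.
  have E : ((N.+1).*2.+1)%:R = 2 * N.+1%:R + 1 :> R by rewrite -addn1 natrD -muln2 natrM mulrC.
  rewrite -[leLHS]mulr_natl E.
  set K := ((1 + L) * d) ^+ 2; have K0 : 0 <= K by exact: sqr_ge0.
  have -> : (2 * N.+1%:R + 1) * (eta N *+ 2) ^+ 2 = (2 * N.+1%:R + 1) * 16 * K / N.+1%:R / N.+1%:R.
    by rewrite /eta /K; field; rewrite gt_eqF.
  rewrite ler_pM2r ?invr_gt0// ler_pdivrMr//.
  by have : K <= N.+1%:R * K by [rewrite ler_peMl]; nra.
exists (\bigcap_N U N); split.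
- exact: bigcapT_measurable.
- apply/eqP; rewrite eq_le measure_ge0 andbT; apply/lee_addgt0Pr => e e0; rewrite add0e.
  pose C := 48 * ((1 + L) * d) ^+ 2.
  have C0 : 0 <= C by rewrite mulr_ge0// sqr_ge0.
  pose N := Num.truncn (C / e).
  have CN : C / e < N.+1%:R by apply: truncnS_gt; exact: num_real.
  apply: (@le_trans _ _ (leb2 (U N))).
    by apply: le_measure; rewrite ?inE//; [exact: bigcapT_measurable|exact: bigcap_inf].
  apply: le_trans (muU N) _; rewrite lee_fin ler_pdivrMr ?ltr0n// (mulrC e) -ler_pdivrMr//.
  exact: ltW.
- by move=> y hy N _; exact: cover.
Qed.

End Chart.

Section GoodValues.
Variables (B : set plane) (f : plane -> R).

(** The value of f on B near x; it makes sense at every x even though f is only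
    known up to null sets. *)
Definition near_value (x : R * R) (k : R) : Prop :=
  exists2 r, 0 < r & leb2.-negligible ([set y | B y /\ f y <> k] `&` sqbox x r).

Definition inner (x : R * R) : Prop := exists2 r, 0 < r & sqbox x r `<=` B.

Lemma near_value_open x k : near_value x k ->
  exists2 r, 0 < r & forall y, sqbox x r y -> near_value y k.
Proof.
move=> [r r0 nr]; exists r => // y /sqbox_sub[s s0 sr]; exists s => //.
by apply: negligibleS nr => z [Bz /sr].
Qed.

(** If B were null near x every k would qualify; inner points close to x exclude
    this. *)
Lemma near_value_uniq x k k' :
  (forall r, 0 < r -> exists2 y, sqbox x r y & inner y) ->
  near_value x k -> near_value x k' -> k = k'.
Proof.
move=> acc [r r0 nr] [r' r0' nr']; apply: contrapT => kk.
have m0 : 0 < Num.min r r' by rewrite lt_min r0.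
have [y xy [s s0 sB]] := acc _ m0.
have [s' s0' ss'] := sqbox_sub xy.
have q0 : 0 < Num.min s s' by rewrite lt_min s0.
apply: (@sqbox_not_negligible y _ q0).
apply: negligibleS (negligibleU nr nr') => z [z1 z2].
move: z1 z2; rewrite !lt_min => /andP[z1 z1'] /andP[z2 z2'].
have Bz : B z by apply: sB.
have [h1 h2] : sqbox x (Num.min r r') z by apply: ss'.
move: h1 h2; rewrite !lt_min => /andP[h1 h1'] /andP[h2 h2'].
have [fk|fk] := pselect (f z = k); [right|left]; split=> //.
by split=> // fk'; apply: kk; rewrite -fk.
Qed.

Lemma inner_acc x : inner x -> forall r, 0 < r -> exists2 y, sqbox x r y & inner y.
Proof. by move=> ix r r0; exists x => //; split; rewrite subrr normr0. Qed.

Hypothesis inner_value : forall x, inner x -> exists k, near_value x k.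

(** On the segment local values exist, are unique and are locally constant, and
    the segment is connected. *)
Lemma near_value_segment (x y : R * R) k :
  (forall t : R, 0 <= t <= 1 -> inner (x.1 + t * (y.1 - x.1), x.2 + t * (y.2 - x.2))) ->
  near_value x k -> near_value y k.
Proof.
move=> seg xk.
pose gam (t : R) : R * R := (x.1 + t * (y.1 - x.1), x.2 + t * (y.2 - x.2)).
have V0 : near_value (gam 0) k by rewrite /gam !mul0r !addr0 -surjective_pairing.
have -> : y = gam 1 by rewrite /gam !mul1r !subrKC -surjective_pairing.
apply: (@connected_locally_constant R R `[0, 1]%classic (fun t => near_value (gam t)) _ _ _ 0 k) => //.
- exact: segment_connected.
- move=> t; rewrite /= in_itv/= => t01.
  have [h tk] := inner_value (seg t t01); exists h.
  have [r r0 rk] := near_value_open tk.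
  pose M := `|y.1 - x.1| + `|y.2 - x.2| + 1.
  have M0 : 0 < M by rewrite ltr_wpDl// addr_ge0.
  exists (ball t (r / M)); split.
  + exact: ball_open.
  + by apply: ballxx; exact: divr_gt0.
  + move=> s ts _; apply: rk.
    have {}ts : `|s - t| < r / M by rewrite distrC; exact: ts.
    have st : `|s - t| * M < r by rewrite -ltr_pdivlMr.
    split; rewrite /gam /=.
      rewrite (_ : _ - _ = (s - t) * (y.1 - x.1)); last by ring.
      rewrite normrM; apply: le_lt_trans st; rewrite ler_wpM2l// /M.
      by have := normr_ge0 (y.2 - x.2); lra.
    rewrite (_ : _ - _ = (s - t) * (y.2 - x.2)); last by ring.
    rewrite normrM; apply: le_lt_trans st; rewrite ler_wpM2l// /M.
    by have := normr_ge0 (y.1 - x.1); lra.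
- move=> t h h'; rewrite /= in_itv/= => t01; apply: near_value_uniq.
  exact: inner_acc (seg t t01).
- by rewrite /= in_itv/= lexx ler01.
- by rewrite /= in_itv/= lexx ler01.
Qed.

Section BoundaryPoint.
Variables (x : R * R) (theta r L : R) (g : R -> R).
Hypotheses (r0 : 0 < r) (L0 : 0 < L).
Hypothesis gL : forall s s', `|g s - g s'| <= L * `|s - s'|.
Hypothesis chartB : forall s t, s ^+ 2 + t ^+ 2 < r ^+ 2 ->
  (B (chart x theta (s, t)) <-> t <= g s).
Hypothesis Bx : B x.

Let g0 : 0 <= g 0.
Proof.
have := @chartB 0 0; rewrite /chart /= !mul0r !subr0 !addr0 -surjective_pairing.
by rewrite expr0n /= addr0 exprn_gt0// => /(_ isT)[/(_ Bx)].
Qed.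

(** The Lipschitz bound keeps a whole square around a point strictly below the
    graph below the graph. *)
Lemma hypograph_inner s t : `|s| < r / 2 -> `|t| < r / 2 -> t < g s ->
  inner (chart x theta (s, t)).
Proof.
move=> sr tr tg; set z := chart x theta (s, t).
have L1 : 0 < L + 1 by rewrite addr_gt0.
pose e := Num.min ((g s - t) / (L + 1)) (Num.min (r / 2 - `|s|) (r / 2 - `|t|)) / 2.
have e0 : 0 < e by rewrite divr_gt0// !lt_min divr_gt0 ?subr_gt0// sr.
have e2 : e + e = Num.min ((g s - t) / (L + 1)) (Num.min (r / 2 - `|s|) (r / 2 - `|t|)).
  by rewrite /e -splitr.
have : e + e <= Num.min ((g s - t) / (L + 1)) (Num.min (r / 2 - `|s|) (r / 2 - `|t|)) by rewrite e2.
rewrite !le_min => /and3P[e3 es et].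
have unK : unchart x theta z = (s, t).
  rewrite /z /unchart /chart /=; have := cos2Dsin2 theta.
  set c := cos theta; set sn := sin theta => cs; congr pair.
    transitivity (s * (c ^+ 2 + sn ^+ 2)); first by ring.
    by rewrite cs mulr1.
  transitivity (t * (c ^+ 2 + sn ^+ 2)); first by ring.
  by rewrite cs mulr1.
exists e => // y [y1 y2].
have [] := unchart_dist x theta y z; rewrite unK /=.
set p := unchart x theta y => h1 h2.
have Ep : y = chart x theta (p.1, p.2) by rewrite -surjective_pairing unchartK.
have d1 : `|p.1 - s| < e + e by apply: le_lt_trans h1 _; exact: ltrD.
have d2 : `|p.2 - t| < e + e by apply: le_lt_trans h2 _; exact: ltrD.
have n1 : `|p.1| < r / 2 by have := ler_distD 0 p.1 s; have := ler_normD (p.1 - s) s; rewrite subrK; lra.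
have n2 : `|p.2| < r / 2 by have := ler_normD (p.2 - t) t; rewrite subrK; lra.
rewrite Ep; apply/chartB.
  rewrite -(real_normK (num_real p.1)) -(real_normK (num_real p.2)).
  have := normr_ge0 p.1; have := normr_ge0 p.2; nra.
have := gL p.1 s; rewrite ler_norml => /andP[gl _].
move: e3; rewrite ler_pdivlMr// => e3.
have d3 : L * `|p.1 - s| <= L * (e + e) by rewrite ler_pM2l// ltW.
by move: d2; rewrite ltr_norml => /andP[_ d2]; lra.
Qed.

(** Two points strictly below the graph and close to x are joined by three
    segments of inner points: down to a fixed depth, across, and up. They have
    the same local value, and the graph itself is null. *)
Lemma boundary_value : (exists k, near_value x k) /\
  (forall r', 0 < r' -> exists2 y, sqbox x r' y & inner y).
Proof.
split; last first.
  move=> e e0; pose t := Num.min e (r / 2) / 2.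
  have t0 : 0 < t by rewrite divr_gt0// lt_min e0 divr_gt0.
  have tt : t + t = Num.min e (r / 2) by rewrite /t -splitr.
  have : t + t <= Num.min e (r / 2) by rewrite tt.
  rewrite le_min => /andP[te tr].
  exists (chart x theta (0, - t)).
    have [] := chart_dist x theta (0, - t) (0, 0).
    have -> : chart x theta (0, 0) = x by rewrite /chart /= !mul0r !addr0 subr0 -surjective_pairing.
    rewrite /= subrr normr0 add0r subr0 normrN (gtr0_norm t0) => h1 h2.
    by split; [apply: le_lt_trans h1 _|apply: le_lt_trans h2 _]; lra.
  apply: hypograph_inner.
  - by rewrite normr0 divr_gt0.
  - by rewrite normrN gtr0_norm//; lra.
  - by rewrite (lt_le_trans _ g0)// oppr_lt0.
pose rho := r / 4; have rho0 : 0 < rho by rewrite divr_gt0.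
pose d := rho / (L + 1) / 2.
have L1 : 0 < L + 1 by rewrite addr_gt0.
have d0 : 0 < d by rewrite !divr_gt0.
have dL : d * (L + 1) = rho / 2 by rewrite /d; field; lra.
have dL0 : 0 < L * d by rewrite mulr_gt0.
rewrite mulrDr mulr1 (mulrC d) in dL.
have dr : d < rho by lra.
have gd s : `|s| <= d -> - rho < g s.
  move=> sd; have := gL s 0; rewrite subr0 ler_norml => /andP[h _].
  have : L * `|s| <= L * d by rewrite ler_pM2l.
  by have := g0; lra.
have r4 : rho + rho = r / 2 by rewrite /rho; field.
have [k zk] : exists k, near_value (chart x theta (0, - rho)) k.
  apply: inner_value; apply: hypograph_inner; rewrite ?normr0 ?normrN ?(gtr0_norm rho0); try lra.
  by apply: gd; rewrite normr0 ltW.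
exists k.
have hypo s t : `|s| <= d -> `|t| <= d -> t < g s -> near_value (chart x theta (s, t)) k.
  move=> sd td tg.
  have s1 : near_value (chart x theta (s, - rho)) k.
    apply: near_value_segment zk => tau /andP[t0 t1].
    rewrite (_ : (_, _) = chart x theta (tau * s, - rho)); last first.
      by rewrite /chart /=; congr pair; ring.
    have ts : `|tau * s| <= d.
      by rewrite normrM (ger0_norm t0) (le_trans _ sd)// ler_piMl.
    apply: hypograph_inner; rewrite ?normrN ?(gtr0_norm rho0); [lra|lra|exact: gd].
  apply: near_value_segment s1 => tau /andP[t0 t1].
  rewrite (_ : (_, _) = chart x theta (s, - rho + tau * (t + rho))); last first.
    by rewrite /chart /=; congr pair; ring.
  have : - d <= t <= d by rewrite -ler_norml.
  move=> /andP[td1 td2].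
  have le1 : - rho + tau * (t + rho) <= t by nra.
  have le2 : - rho <= - rho + tau * (t + rho) by rewrite lerDl mulr_ge0//; lra.
  apply: hypograph_inner; [lra| |exact: le_lt_trans tg].
  by rewrite ltr_norml; apply/andP; split; lra.
have d20 : 0 < d / 2 by lra.
exists (d / 2) => //.
pose N1 : set plane := [set y | [/\ B y, f y <> k & near_value y k]].
have nN1 : leb2.-negligible N1.
  apply: locally_negligible => y [_ _ [e e0 ne]]; exists e => //.
  by apply: negligibleS ne => z [[Bz fz _] ?].
apply: negligibleS (negligibleU nN1 (lipschitz_graph_negligible x theta L0 d0 gL)).
move=> y [[By fy] [y1 y2]].
have [] := unchart_dist x theta y x; rewrite unchart0 /= !subr0.
set p := unchart x theta y => h1 h2.
have p1 : `|p.1| <= d by apply: le_trans h1 _; lra.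
have p2 : `|p.2| <= d by apply: le_trans h2 _; lra.
have Ep : y = chart x theta (p.1, p.2) by rewrite -surjective_pairing unchartK.
have pg : p.2 <= g p.1.
  apply/chartB; last by rewrite -Ep.
  rewrite -(real_normK (num_real p.1)) -(real_normK (num_real p.2)).
  have := normr_ge0 p.1; have := normr_ge0 p.2; nra.
have [lt_pg|ge_pg] := ltP p.2 (g p.1).
  by left; split=> //; rewrite Ep; exact: hypo.
right; exists p.1; first by rewrite /= in_itv/= -ler_norml.
have E : g p.1 = p.2 by apply/eqP; rewrite eq_le ge_pg.
by rewrite E.
Qed.

End BoundaryPoint.

End GoodValues.
End Geometry.

(** * From the torus to periodic functions on the plane *)

Section TorusTransport.
Variable R : realType.
Local Notation plane := (measurableTypeR R * measurableTypeR R)%type.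
Local Notation leb := (@lebesgue_measure R).
Local Notation leb2 := (leb2 R).
Local Notation cell := (@cell R).
Local Notation sq := (sqint leb2 cell).
Local Notation ip := (inner_product leb2 cell).

Let mC := @measurable_cell R.
Let fC := @leb2_cell_fin R.

Lemma torus_piP (x y : R * R) : reflect (torus_pi x = torus_pi y) (Z2_congr x y).
Proof.
have H : reflect (x = y %[mod torus R])%qT (Z2_congr x y) by exact: (@eqmodP _ (Z2_congr_equiv R)).
exact: H.
Qed.

Lemma torus_reprK (z : torus R) : torus_pi (repr z) = z.
Proof. by rewrite /torus_pi reprK. Qed.

Lemma torus_lift_periodic (U : Type) (h : torus R -> U) : periodic2 (torus_lift h).
Proof. by move=> x y /torus_piP; rewrite /torus_lift /= => ->. Qed.

Lemma torus_lift_repr (U : Type) (p : plane -> U) : periodic2 p ->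
  torus_lift (fun z => p (repr z)) = p.
Proof.
move=> pp; apply/funext => x; apply: pp; apply/torus_piP; exact: torus_reprK.
Qed.

Lemma torus_openE (U : set (torus R)) : open U = open (@torus_pi R @^-1` U).
Proof. by []. Qed.

Lemma tens_trig_periodic (f g : R -> R) : trig f -> trig g -> periodic2 (tens f g).
Proof.
move=> tf tg x y /andP[/intrP[m mE] /intrP[n nE]]; rewrite /tens.
have -> : x.1 = y.1 + m%:~R by rewrite -mE; ring.
have -> : x.2 = y.2 + n%:~R by rewrite -nE; ring.
by rewrite !trig_periodic.
Qed.

Lemma basis_vec0 : basis_vec R 0 = (1, 0).
Proof. by []. Qed.

Lemma basis_vec1 : basis_vec R 1 = (0, 1).
Proof. by []. Qed.

Lemma is_derive_tens (f f' g g' : R -> R) (x : R * R) :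
  is_derive (x.1 : R) 1 f (f' x.1) -> is_derive (x.2 : R) 1 g (g' x.2) ->
  is_derive x (basis_vec R 0) (tens f g : R * R -> R) (tens f' g x) /\
  is_derive x (basis_vec R 1) (tens f g : R * R -> R) (tens f g' x).
Proof.
move=> [df ef] [dg eg]; rewrite basis_vec0 basis_vec1; split.
  have H : (fun h : R => h^-1 *: (((tens f g : R * R -> R) \o shift x) (h *: ((1 : R), (0 : R))) - tens f g x)) @ 0^' --> tens f' g x.
    rewrite (_ : (fun h => _) = (fun h => (h^-1 *: ((f \o shift x.1) (h *: 1) - f x.1)) * g x.2)); last first.
      apply/funext => h; rewrite /tens /= /shift /GRing.scale /=.
      by rewrite mulr0 add0r -mulrBl mulrA.
    by apply: cvgM; [rewrite -ef; exact: df|exact: cvg_cst].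
  by apply: DeriveDef; [exact: (cvgP _ H)|exact: cvg_lim].
have H : (fun h : R => h^-1 *: (((tens f g : R * R -> R) \o shift x) (h *: ((0 : R), (1 : R))) - tens f g x)) @ 0^' --> tens f g' x.
  rewrite (_ : (fun h => _) = (fun h => f x.1 * (h^-1 *: ((g \o shift x.2) (h *: 1) - g x.2)))); last first.
    apply/funext => h; rewrite /tens /= /shift /GRing.scale /=.
    by rewrite mulr0 add0r -mulrBr mulrCA.
  by apply: cvgM; [exact: cvg_cst|rewrite -eg; exact: dg].
by apply: DeriveDef; [exact: (cvgP _ H)|exact: cvg_lim].
Qed.

Lemma ord2P (q : 'I_2) : q = 0 \/ q = 1.
Proof.
by case: q => -[|[|//]] i; [left|right]; exact: val_inj.
Qed.

Lemma partial_tens (f f' g g' : R -> R) :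
  (forall x : R, is_derive x 1 f (f' x)) -> (forall x : R, is_derive x 1 g (g' x)) ->
  partial 0 (tens f g : R * R -> R) = tens f' g /\ partial 1 (tens f g : R * R -> R) = tens f g'.
Proof.
move=> df dg; split; apply/funext => x;
  have [[_ h1] [_ h2]] := @is_derive_tens f f' g g' x (df _) (dg _); [exact: h1|exact: h2].
Qed.

Lemma Cn_tens n (f g : R -> R) : trig f -> trig g -> Cn n (tens f g : R * R -> R).
Proof.
elim: n f g => [|n IH] f g tf tg.
  split=> // x; apply: cvgM.
    apply: (@continuous_comp (R * R)%type R R fst f); first exact: cvg_fst.
    exact: trig_continuous.
  apply: (@continuous_comp (R * R)%type R R snd g); first exact: cvg_snd.
  exact: trig_continuous.
split; first by case: n IH => [|m] IH; have [] := IH f g tf tg.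
have [f' tf' df] := trig_derive tf; have [g' tg' dg] := trig_derive tg.
have [p0 p1] := partial_tens df dg.
move=> q; have [->|->] := ord2P q.
  split; last by rewrite p0; exact: IH.
  by move=> x; have [[h _] _] := @is_derive_tens f f' g g' x (df _) (dg _).
split; last by rewrite p1; exact: IH.
by move=> x; have [_ [h _]] := @is_derive_tens f f' g g' x (df _) (dg _).
Qed.

(** Products of trigonometric polynomials descend to smooth functions on the
    torus. *)
Lemma H1_gradient_weak_grad (v : torus R -> 'cV[R]_2) (G : torus R -> 'M[R]_2) p :
  H1_gradient v G ->
  weak_grad (torus_lift (fun z => v z p 0)) (torus_lift (fun z => G z p 0)) (torus_lift (fun z => G z p 1)).
Proof.
move=> [sv sG H]; split; [exact: sv|exact: sG|exact: sG|].
move=> u u' w w' tu tw du dw.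
have tu' := trig_derivative tu du; have tw' := trig_derivative tw dw.
have pt := tens_trig_periodic tu tw.
pose phi (z : torus R) : R := tens u w (repr z).
have lphi : torus_lift phi = tens u w by exact: torus_lift_repr.
have sphi : torus_smooth phi by move=> n; rewrite lphi; exact: Cn_tens.
have [p0 p1] := partial_tens du dw.
split.
  have := H _ sphi p 0; rewrite /torus_int => E.
  rewrite (_ : ip _ _ = \int[leb2]_(x in cell) torus_lift (fun x0 => v x0 p 0 * torus_partial 0 phi x0) x).
    rewrite E; congr (- _); apply: eq_Rintegral => x _.
    by rewrite -lphi.
  apply: eq_Rintegral => x _; rewrite /torus_lift /= /torus_partial lphi p0; congr (_ * _).
  by apply: (tens_trig_periodic tu' tw); apply/torus_piP; rewrite torus_reprK.
have := H _ sphi p 1; rewrite /torus_int => E.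
rewrite (_ : ip _ _ = \int[leb2]_(x in cell) torus_lift (fun x0 => v x0 p 0 * torus_partial 1 phi x0) x).
  rewrite E; congr (- _); apply: eq_Rintegral => x _.
  by rewrite -lphi.
apply: eq_Rintegral => x _; rewrite /torus_lift /= /torus_partial lphi p1; congr (_ * _).
by apply: (tens_trig_periodic tu tw'); apply/torus_piP; rewrite torus_reprK.
Qed.

Lemma sq_shift a (f : plane -> R) : periodic2 f -> sq f -> sq (f \o translate a).
Proof.
move=> pf [mf /integrableP[_ f2]].
have mfT := measurable_periodic pf mf.
have mfs : measurable_fun setT (f \o translate a) by apply: measurableT_comp => //; exact: measurable_shift.
split; first exact: measurable_funTS.
apply/integrableP; split.
  by apply/measurable_EFinP; apply: measurable_funTS; exact: measurable_funX.
apply: le_lt_trans f2.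
rewrite (@ge0_integral_cell_shift R (fun x => `|(f x ^+ 2)%:E|)%E)//.
- by move=> x y /pf fxy; rewrite fxy.
- apply: measurableT_comp => //; apply/measurable_EFinP; exact: measurable_funX.
Qed.

Lemma periodicM (f g : plane -> R) : periodic2 f -> periodic2 g -> periodic2 (f \* g).
Proof. by move=> pf pg x y xy; rewrite /= (pf _ _ xy) (pg _ _ xy). Qed.

Lemma ip_shift a (f g : plane -> R) : periodic2 f -> periodic2 g ->
  measurable_fun cell f -> measurable_fun cell g ->
  ip (f \o translate a) (g \o translate a) = ip f g.
Proof.
move=> pf pg mf mg; apply: (@Rintegral_cell_shift R a (f \* g)).
  exact: periodicM.
by apply: measurable_funM; exact: measurable_periodic.
Qed.

(** Translations bring a square that meets the boundary of the unit cell inside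
    it, where piecewise affine test functions with support in the square
    exist. *)
Lemma weak_grad_shift a v E1 E2 : periodic2 v -> periodic2 E1 -> periodic2 E2 ->
  weak_grad v E1 E2 -> @weak_grad R (v \o translate a) (E1 \o translate a) (E2 \o translate a).
Proof.
move=> pv p1 p2 [sv s1 s2 H]; split; try exact: sq_shift.
move=> u u' w w' tu tw du dw.
have tu' := trig_derivative tu du; have tw' := trig_derivative tw dw.
pose S b (f : R -> R) x := f (x + (- b)).
have tS b f : trig f -> trig (S b f) by move=> tf; exact: trig_shift.
have dS b (f f1 : R -> R) : (forall x : R, is_derive x 1 f (f1 x)) ->
    forall x : R, is_derive x 1 (S b f) (S b f1 x).
  move=> df x; have d1 : is_derive x 1 (fun y : R => y + - b) 1.
    have h := @is_deriveD _ _ _ (@idfun R) (cst (- b)) x 1 1 0 (is_derive_id _ _) (is_derive_cst _ _ _).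
    by apply: is_derive_eq h _; rewrite addr0.
  have h := @is_derive1_comp _ f (fun y : R => y + - b) x _ _ (df _) d1.
  by apply: is_derive_eq h _; rewrite mulr1.
have [h1 h2] := H _ _ _ _ (tS a.1 _ tu) (tS a.2 _ tw) (dS a.1 _ _ du) (dS a.2 _ _ dw).
have ts (f g : R -> R) : tens f g = tens (S a.1 f) (S a.2 g) \o translate a.
  by apply/funext => x; rewrite /tens /S /translate /= !addrK.
have pS f g : trig f -> trig g -> periodic2 (tens (S a.1 f) (S a.2 g)).
  by move=> tf tg; apply: tens_trig_periodic; exact: tS.
have mS f g : trig f -> trig g -> measurable_fun cell (tens (S a.1 f) (S a.2 g)).
  by move=> tf tg; have [] := tens_sqint (trig_bdd (tS a.1 _ tf)) (trig_bdd (tS a.2 _ tg)).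
have E (h : plane -> R) f g : periodic2 h -> sq h -> trig f -> trig g ->
    ip (h \o translate a) (tens f g) = ip h (tens (S a.1 f) (S a.2 g)).
  move=> ph sh tf tg; rewrite [tens f g]ts ip_shift//; [exact: pS|exact: sh.1|exact: mS].
by rewrite !E.
Qed.

(** Translate x to the centre of the unit cell, so that a small square around it
    lies inside the cell. *)
Lemma inner_near_value (B : set plane) (F11 F12 F21 F22 : plane -> R) :
  (forall a, curlfree (F11 \o translate a) (F12 \o translate a)) ->
  (forall a, curlfree (F21 \o translate a) (F22 \o translate a)) ->
  {ae leb2, forall x, B x -> [/\ F12 x = 0, F21 x = 0 & F11 x = F22 x]} ->
  forall x, inner B x -> exists k, near_value B F11 x k.
Proof.
move=> cf1 cf2 H0 x [r r0 rB].
pose a : plane := (x.1 - 2^-1, x.2 - 2^-1).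
pose d := Num.min r (2^-1) / 2.
have m0 : 0 < Num.min r (2^-1 : R) by rewrite lt_min r0 invr_gt0 ltr0n.
have d0 : 0 < d by rewrite divr_gt0.
have dd : d + d = Num.min r (2^-1) by rewrite /d -splitr.
have : d + d <= Num.min r (2^-1) by rewrite dd.
rewrite le_min => /andP[dr d2].
have l0 : 0 <= 2^-1 - d by lra.
have l1 : 2^-1 - d < 2^-1 + d by lra.
have l2 : 2^-1 + d < 1 by lra.
have inB y : rect (2^-1 - d) (2^-1 + d) (2^-1 - d) (2^-1 + d) y -> B (translate a y).
  move=> [y1 y2]; apply: rB; move: y1 y2; rewrite /= !in_itv/= => /andP[? ?] /andP[? ?].
  by split; rewrite /translate /a /= ltr_norml; lra.
have [N [mN N0 sN]] := H0.
have nN : leb2.-negligible N by exists N; split.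
have [M [mM M0 sM]] := negligible_shift a nN.
have ae (P : plane -> Prop) : (forall y, ~ N (translate a y) -> P y) -> {ae leb2, forall y, P y}.
  by move=> NP; exists M; split=> // y nP; apply: sM => /=; apply: contrapT => nNy; apply: nP; exact: NP.
have notN y : ~ N y -> B y -> [/\ F12 y = 0, F21 y = 0 & F11 y = F22 y].
  by move=> nNy By; apply: contrapT => h; apply: nNy; apply: sN => /(_ By).
have [k [M' [mM' M'0 sM']]] := @curlfree_scalar_cst R _ _ _ _ l0 l1 l2 l0 l1 l2 _ _ _ _ (cf1 a) (cf2 a)
  (ae _ (fun y nNy ry => let: And3 h _ _ := notN _ nNy (inB _ ry) in h))
  (ae _ (fun y nNy ry => let: And3 _ h _ := notN _ nNy (inB _ ry) in h))
  (ae _ (fun y nNy ry => let: And3 _ _ h := notN _ nNy (inB _ ry) in h)).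
exists k; exists d => //.
have nM' : leb2.-negligible M' by exists M'; split.
apply: negligibleS (negligible_shift (- a.1, - a.2) nM') => z [[Bz fz] [z1 z2]].
apply: sM' => /= h; apply: fz.
have zK : translate a (translate (- a.1, - a.2) z) = z.
  by rewrite /translate /= !subrK -surjective_pairing.
rewrite -[in LHS]zK; apply: h; move: z1 z2; rewrite !ltr_norml => /andP[? ?] /andP[? ?].
by split; rewrite /= in_itv/= /a /=; apply/andP; split; lra.
Qed.

Section Complement.
Variable Omega : set (torus R).
Hypothesis hlip : Lipschitz_boundary Omega.
Hypothesis hconn : connected (~` Omega).
Variables (F11 F12 F21 F22 : plane -> R).
Hypothesis p11 : periodic2 F11.
Hypothesis cf1 : forall a, curlfree (F11 \o translate a) (F12 \o translate a).
Hypothesis cf2 : forall a, curlfree (F21 \o translate a) (F22 \o translate a).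

Let B : set plane := @torus_pi R @^-1` (~` Omega).

Hypothesis H0 : {ae leb2, forall x, B x -> [/\ F12 x = 0, F21 x = 0 & F11 x = F22 x]}.

Let B_per x y : Z2_congr x y -> B x -> B y.
Proof. by move=> /torus_piP xy; rewrite /B /= xy. Qed.

(** A point outside Omega that is not an inner point of the complement is a
    boundary point of Omega. *)
Lemma lipschitz_chart x : B x -> ~ inner B x -> exists theta r L (g : R -> R),
  [/\ 0 < r, 0 < L, forall s s', `|g s - g s'| <= L * `|s - s'| &
    forall s t, s ^+ 2 + t ^+ 2 < r ^+ 2 -> (B (chart x theta (s, t)) <-> t <= g s)].
Proof.
move=> Bx nx.
have bx : (closure Omega `\` Omega^°) (torus_pi x).
  split; last first.
    by move=> /interior_subset; exact: Bx.
  move=> U nU.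
  have : nbhs x (@torus_pi R @^-1` U).
    have /nbhs_interior := nU; rewrite nbhsE => -[V [oV Vx] VU].
    apply: (filterS (P := @torus_pi R @^-1` V)).
      by move=> y /VU /interior_subset.
    by apply: open_nbhs_nbhs; split.
  move=> /nbhs_sqbox[r r0 rU].
  apply: contrapT => nm; apply: nx; exists r => // y /rU Uy Oy; apply: nm.
  by exists (torus_pi y).
have [theta [r [g [r0 lg H]]]] := hlip bx.
have [L [L0 gL]] := pinfty_ex_gt0 lg.
exists theta, r, L, g; split=> //.
  by move=> s s'; exact: (gL (s, s')).
move=> s t st; have h := H s t st; rewrite /B /chart /=; split.
  by move=> nO; rewrite leNgt; apply/negP => /h.
by rewrite leNgt => /negP gt /h.
Qed.

Lemma value_exists x : B x -> (exists k, near_value B F11 x k) /\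
  (forall r, 0 < r -> exists2 y, sqbox x r y & inner B y).
Proof.
have iv := inner_near_value cf1 cf2 H0.
move=> Bx; have [ix|nx] := pselect (inner B x).
  by split; [exact: iv|exact: inner_acc].
have [theta [r [L [g [r0 L0 gL cB]]]]] := lipschitz_chart Bx nx.
exact: (boundary_value iv r0 L0 gL cB Bx).
Qed.

Lemma near_value_congr x y k : Z2_congr x y -> near_value B F11 x k -> near_value B F11 y k.
Proof.
move=> xy [r r0 nr]; exists r => //.
pose a : plane := (x.1 - y.1, x.2 - y.2).
apply: negligibleS (negligible_shift a nr) => z [[Bz fz] [z1 z2]].
have zz : Z2_congr z (translate a z).
  move: xy => /andP[h1 h2]; rewrite /Z2_congr /translate /a /=.
  by apply/andP; split; rewrite opprD addrA subrr add0r rpredN.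
split; first by split; [exact: B_per zz Bz|rewrite -(p11 zz)].
split; rewrite /translate /a /=.
  by rewrite (_ : _ - _ = z.1 - y.1)//; ring.
by rewrite (_ : _ - _ = z.2 - y.2)//; ring.
Qed.

(** Every point outside Omega, on the boundary or not, has exactly one local
    value, and this value is locally constant; hence it is constant by
    connectedness. Local null sets then patch together by Lindelof. *)
Theorem scalar_field_cst : exists k, {ae leb2, forall x, B x -> F11 x = k}.
Proof.
pose V (z : torus R) (k : R) := exists2 x, torus_pi x = z & near_value B F11 x k.
have Vlift x k : V (torus_pi x) k -> near_value B F11 x k.
  by move=> [y /torus_piP yx]; exact: near_value_congr.
have [[z0 Bz0]|nB] := pselect (exists z, ~ Omega z); last first.
  by exists 0; apply: aeW => x Bx; exfalso; apply: nB; exists (torus_pi x).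
have B0 : B (repr z0) by rewrite /B /= torus_reprK.
have [[k0 x0k] _] := value_exists B0.
have allV : forall z, ~ Omega z -> V z k0.
  apply: (@connected_locally_constant _ _ (~` Omega) V hconn _ _ z0 k0) => //.
  - move=> z nz; have Bz : B (repr z) by rewrite /B /= torus_reprK.
    have [[k zk] _] := value_exists Bz; exists k.
    have [r r0 rk] := near_value_open zk.
    exists (@torus_pi R @` sqbox (repr z) r); split.
    + rewrite torus_openE openE => y [y' hy' yy'].
      pose a : R * R := (y'.1 - y.1, y'.2 - y.2).
      have [s s0 ss] := sqbox_sub hy'; apply/nbhs_sqbox; exists s => // w [w1 w2].
      exists (translate a w).
        apply: ss; split; rewrite /translate /a /=.
          by rewrite (_ : _ - _ = w.1 - y.1)//; ring.
        by rewrite (_ : _ - _ = w.2 - y.2)//; ring.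
      apply/torus_piP; move/torus_piP : yy' => /andP[h1 h2].
      by apply/andP; split; rewrite /translate /a /= addrAC subrr add0r.
    + by exists (repr z); [split; rewrite subrr normr0|exact: torus_reprK].
    + by move=> _ [y hy <-] _; exists y => //; exact: rk.
  - move=> z k k' nz; rewrite -(torus_reprK z) => /Vlift h /Vlift h'.
    have Bz : B (repr z) by rewrite /B /= torus_reprK.
    by have [_ acc] := value_exists Bz; apply: near_value_uniq h h'.
  - by exists (repr z0); [exact: torus_reprK|].
exists k0.
suff [N [mN N0 sN]] : leb2.-negligible [set y | B y /\ F11 y <> k0].
  by exists N; split=> // y ny; apply: sN; apply: contrapT => h; apply: ny => By; apply: contrapT => ?; apply: h.
apply: locally_negligible => y [By _].
have [r r0 nr] : near_value B F11 y k0 by apply: Vlift; exact: allV.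
by exists r.
Qed.

End Complement.

End TorusTransport.

(** * Isotropic quadratic forms *)

Section QuadraticForms.
Variable R : realType.
Implicit Types (X : 'M[R]_2) (l m : R).

Lemma sum2 (F : 'I_2 -> R) : \sum_i F i = F 0 + F 1.
Proof.
rewrite !big_ord_recl big_ord0 addr0; congr (F _ + F _); exact: val_inj.
Qed.

Lemma mxdot2 X : mxdot X X = X 0 0 ^+ 2 + X 0 1 ^+ 2 + X 1 0 ^+ 2 + X 1 1 ^+ 2.
Proof. by rewrite /mxdot !sum2; ring. Qed.

Lemma mxdot_iso l m X : mxdot X (tensor_act (iso_tensor l m) X) =
  l * (X 0 0 + X 1 1) ^+ 2 + m * (2 * X 0 0 ^+ 2 + 2 * X 1 1 ^+ 2 + (X 0 1 + X 1 0) ^+ 2).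
Proof. by rewrite /mxdot !sum2 !mxE !sum2 /iso_tensor /=; ring. Qed.

Lemma mxdot_two_phase (chi : torus R -> R) l1 m1 l2 m2 z X :
  mxdot X (tensor_act (two_phase chi (iso_tensor l1 m1) (iso_tensor l2 m2) z) X) =
  chi z * mxdot X (tensor_act (iso_tensor l1 m1) X) +
  (1 - chi z) * mxdot X (tensor_act (iso_tensor l2 m2) X).
Proof. by rewrite /mxdot !sum2 !mxE !sum2 /two_phase; ring. Qed.

Lemma iso_rank_one l m (a b : 'cV[R]_2) : let M := a *m b^T in
  mxdot M (tensor_act (iso_tensor l m) M) =
    (l + m) * (a 0 0 * b 0 0 + a 1 0 * b 1 0) ^+ 2 + m * mxdot M M /\
  (a 0 0 * b 0 0 + a 1 0 * b 1 0) ^+ 2 <= mxdot M M.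
Proof.
have E i j : (a *m b^T) i j = a i 0 * b j 0 by rewrite !mxE big_ord1 !mxE.
rewrite /= mxdot_iso mxdot2 !E; split; first by ring.
rewrite -subr_ge0 (_ : _ - _ = (a 0 0 * b 1 0 - a 1 0 * b 0 0) ^+ 2); last by ring.
exact: sqr_ge0.
Qed.

(** On a (x) b the form is affine in (a . b)^2, which ranges between 0 and
    |a|^2 |b|^2; the two ends give the coefficients m and l + 2 m. *)
Lemma iso_strongly_elliptic l m : 0 < l + m + m -> 0 < m ->
  strictly_strongly_elliptic (iso_tensor l m : tensor4 R).
Proof.
move=> h m0; exists (Num.min (l + m + m) m); first by rewrite lt_min h.
move=> a b /=; have [-> le] := iso_rank_one l m a b.
set M := mxdot _ _ in le *; set t := (_ + _) ^+ 2 in le *.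
have t0 : 0 <= t by exact: sqr_ge0.
have M0 : 0 <= M by exact: le_trans le.
have [lm|lm] := leP 0 (l + m).
  have : Num.min (l + m + m) m * M <= m * M by rewrite ler_wpM2r// ge_min lexx orbT.
  by have : 0 <= (l + m) * t by [rewrite mulr_ge0]; lra.
have : Num.min (l + m + m) m * M <= (l + m + m) * M by rewrite ler_wpM2r// ge_min lexx.
by have : (l + m) * M <= (l + m) * t by [rewrite ler_wnM2l// ltW]; lra.
Qed.

End QuadraticForms.

(** * Energies and rigidity of minimizers *)

Section Energy.
Variable R : realType.
Local Notation plane := (measurableTypeR R * measurableTypeR R)%type.
Local Notation leb2 := (leb2 R).
Local Notation cell := (@cell R).
Local Notation sq := (sqint leb2 cell).
Local Notation ip := (inner_product leb2 cell).

Let mC := @measurable_cell R.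
Let fC := @leb2_cell_fin R.

Lemma ip11 : ip (cst 1) (cst 1) = 1.
Proof.
rewrite /inner_product (_ : (fun x => _) = cst 1); last by apply/funext => x /=; rewrite mulr1.
by rewrite Rintegral_cst// mul1r -[X in fine X]/(leb2 cell) leb2_cell.
Qed.

Lemma weak_gradB v v' E1 E1' E2 E2' : @weak_grad R v E1 E2 -> @weak_grad R v' E1' E2' ->
  @weak_grad R (v \- v') (E1 \- E1') (E2 \- E2').
Proof.
move=> [sv s1 s2 H] [sv' s1' s2' H']; split; try exact: sqintB.
move=> u u' w w' tu tw du dw.
have [h1 h2] := H _ _ _ _ tu tw du dw; have [h1' h2'] := H' _ _ _ _ tu tw du dw.
have bu := trig_bdd tu; have bw := trig_bdd tw.
have bu' := trig_derive_bdd tu du; have bw' := trig_derive_bdd tw dw.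
rewrite !ipBl//; try exact: tens_sqint.
by rewrite h1 h2 h1' h2'; split; ring.
Qed.

Definition total_field (M : 'M[R]_2) (G : torus R -> 'M[R]_2) (p q : 'I_2) : plane -> R :=
  torus_lift (fun z => (M + G z) p q).

Let scst (c : R) : sq (cst c). Proof. exact: sqint_cst. Qed.

Lemma ip_cstl (c : R) f : sq f -> ip (cst c) f = c * ip (cst 1) f.
Proof.
move=> sf; rewrite -ipZl//; congr inner_product.
by apply/funext => x; rewrite /= mulr1.
Qed.

Lemma ip_cstr (c : R) f : sq f -> ip f (cst c) = c * ip (cst 1) f.
Proof. by move=> sf; rewrite ipC ip_cstl. Qed.

Section Field.
Variables (M : 'M[R]_2) (v : torus R -> 'cV[R]_2) (G : torus R -> 'M[R]_2).
Hypothesis vG : H1_gradient v G.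

Local Notation g p q := (torus_lift (fun z : torus R => G z p q)).

Let total_fieldE p q : total_field M G p q = g p q \+ cst (M p q).
Proof. by apply/funext => x; rewrite /total_field /torus_lift /= mxE addrC. Qed.

Let sg p q : sq (g p q).
Proof. by have [_ sG _] := vG; exact: sG. Qed.

Lemma total_field_sqint p q : sq (total_field M G p q).
Proof. by rewrite total_fieldE; apply: sqintD => //; exact: sqint_cst. Qed.

Lemma total_field_periodic p q : periodic2 (total_field M G p q).
Proof. exact: torus_lift_periodic. Qed.

Lemma grad_mean p q : ip (cst 1) (g p q) = 0.
Proof.
have [h0 h1] := weak_grad_mean0 (H1_gradient_weak_grad p vG).
by have [->|->] := ord2P q.
Qed.

Lemma total_field_mean p q : ip (cst 1) (total_field M G p q) = M p q.
Proof.
by rewrite total_fieldE ipDr// grad_mean add0r ip_cstr// ip11 mulr1.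
Qed.

(** The constant part gives det M, the mixed terms vanish because gradients have
    mean zero, and the determinant of the gradient is a null Lagrangian. *)
Lemma total_field_det : ip (total_field M G 0 0) (total_field M G 1 1) - ip (total_field M G 0 1) (total_field M G 1 0) =
  M 0 0 * M 1 1 - M 0 1 * M 1 0.
Proof.
have E (p q p' q' : 'I_2) : ip (total_field M G p q) (total_field M G p' q') = ip (g p q) (g p' q') + M p q * M p' q'.
  rewrite !total_fieldE ipDl ?ipDr//; try exact: sqintD.
  rewrite (ip_cstr _ (sg p q)) (ip_cstl (M p q) (sg p' q')) (ip_cstl (M p q) (scst (M p' q'))).
  by rewrite (ip_cstr (M p' q') (scst 1)) ip11 !grad_mean; ring.
rewrite !E (null_lagrangian (H1_gradient_weak_grad 0 vG) (H1_gradient_weak_grad 1 vG)).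
ring.
Qed.

Lemma total_field_curlfree p a :
  curlfree (total_field M G p 0 \o translate a) (total_field M G p 1 \o translate a).
Proof.
rewrite !total_fieldE; apply: (@curlfree_cst R (g p 0 \o translate a) (g p 1 \o translate a)).
apply: weak_grad_curlfree.
by apply: (weak_grad_shift _ _ _ _ (H1_gradient_weak_grad p vG)); exact: torus_lift_periodic.
Qed.

End Field.

Section TwoPhase.
Variables (l1 m1 l2 m2 : R) (Omega : set (torus R)).
Hypothesis hopen : open Omega.

Definition chi : plane -> R := torus_lift (\1_Omega : torus R -> R).

Lemma chi01 x : chi x = 0 \/ chi x = 1.
Proof. by rewrite /chi /torus_lift /= indicE; case: (_ \in _); [right|left]. Qed.

Lemma chi_measurable : measurable_fun setT chi.
Proof.
rewrite (_ : chi = \1_(@torus_pi R @^-1` Omega)).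
  by apply: measurable_indic; exact: open_plane_measurable.
by apply/funext => x; rewrite /chi /torus_lift /= !indicE.
Qed.

(** The energy density plus 4 m1 det, written as a sum of squares. The term
    4 m1 det cancels the traceless symmetric part in phase 1, and cancels the
    trace in phase 2 since l2 + m2 = - m1. *)
Definition sos_density (M : 'M[R]_2) G : plane -> R := fun x =>
  chi x * ((l1 + 2 * m1) * (total_field M G 0 0 x + total_field M G 1 1 x) ^+ 2) +
  (1 - chi x) * ((m2 - m1) * ((total_field M G 0 0 x - total_field M G 1 1 x) ^+ 2 + (total_field M G 0 1 x + total_field M G 1 0 x) ^+ 2)) +
  m1 * (total_field M G 0 1 x - total_field M G 1 0 x) ^+ 2.

Variables (M : 'M[R]_2) (v : torus R -> 'cV[R]_2) (G : torus R -> 'M[R]_2).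
Hypothesis vG : H1_gradient v G.
Hypothesis hm : l2 + m2 = - m1.

Let a := total_field M G 0 0.
Let b := total_field M G 0 1.
Let c := total_field M G 1 0.
Let d := total_field M G 1 1.

Lemma sos_density_integrable : leb2.-integrable cell (EFin \o sos_density M G).
Proof.
have sa : sq a by exact: total_field_sqint vG _ _.
have sb : sq b by exact: total_field_sqint vG _ _.
have sc : sq c by exact: total_field_sqint vG _ _.
have sd : sq d by exact: total_field_sqint vG _ _.
have mchi : measurable_fun cell chi by apply: measurable_funTS; exact: chi_measurable.
have bchi x : cell x -> `|chi x| <= 1 by move=> _; have [->|->] := chi01 x; rewrite ?normr0 ?normr1.
have mchi' : measurable_fun cell (fun x => 1 - chi x) by apply: measurable_funB => //; exact: measurable_cst.
have bchi' x : cell x -> `|1 - chi x| <= 1.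
  by move=> _; have [->|->] := chi01 x; rewrite ?subr0 ?subrr ?normr0 ?normr1.
have term (w : plane -> R) (k : R) (f : plane -> R) : measurable_fun cell w -> (forall x, cell x -> `|w x| <= 1) ->
    sq f -> leb2.-integrable cell (fun x => (w x * (k * f x ^+ 2))%:E).
  move=> mw bw sf.
  have := sqintM mC (sqintMb mC mw bw sf) (sqintZ mC k sf).
  by apply: eq_integrable => // x _; congr EFin; rewrite /=; ring.
rewrite (_ : EFin \o _ = (fun x => (chi x * ((l1 + 2 * m1) * (a \+ d) x ^+ 2))%:E +
   (((1 - chi x) * ((m2 - m1) * (a \- d) x ^+ 2))%:E + (((1 - chi x) * ((m2 - m1) * (b \+ c) x ^+ 2))%:E +
   ((cst 1 : plane -> R) x * (m1 * (b \- c) x ^+ 2))%:E)))%E).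
  apply: integrableD => //; first by apply: term => //; exact: sqintD.
  apply: integrableD => //; first by apply: term => //; exact: sqintB.
  apply: integrableD => //; first by apply: term => //; exact: sqintD.
  by apply: term; [exact: measurable_cst|move=> x _; rewrite normr1|exact: sqintB].
by apply/funext => x; rewrite -!EFinD; congr EFin; rewrite /sos_density /a /b /c /d /=; ring.
Qed.

Lemma energy_sos :
  energy (two_phase (\1_Omega : torus R -> R) (iso_tensor l1 m1) (iso_tensor l2 m2)) M G
  + 4 * m1 * (M 0 0 * M 1 1 - M 0 1 * M 1 0) = \int[leb2]_(x in cell) sos_density M G x.
Proof.
have sa : sq a by exact: total_field_sqint vG _ _.
have sb : sq b by exact: total_field_sqint vG _ _.
have sc : sq c by exact: total_field_sqint vG _ _.
have sd : sq d by exact: total_field_sqint vG _ _.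
have iad := sqintM mC sa sd; have ibc := sqintM mC sb sc.
have idet : leb2.-integrable cell (EFin \o (fun x => a x * d x - b x * c x)).
  rewrite (_ : _ \o _ = (fun x => (a x * d x)%:E - (b x * c x)%:E)%E); first exact: integrableB.
  by apply/funext => x; rewrite /= EFinB.
have i4 : leb2.-integrable cell (EFin \o (fun x => 4 * m1 * (a x * d x - b x * c x))).
  rewrite (_ : _ \o _ = (fun x => (4 * m1)%:E * (a x * d x - b x * c x)%:E)%E); last first.
    by apply/funext => x; rewrite /= EFinM.
  exact: integrableZl.
apply/eqP; rewrite eq_sym -subr_eq; apply/eqP.
rewrite -(total_field_det M vG) -[ip _ _ - _]/(ip a d - ip b c) /inner_product -RintegralB// -RintegralZl// -RintegralB//; last exact: sos_density_integrable.
apply: eq_Rintegral => x _.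
rewrite /torus_lift /= mxdot_two_phase !mxdot_iso /sos_density /a /b /c /d /total_field /torus_lift /chi /torus_lift /=.
have -> : l2 = - m1 - m2 by move: hm; lra.
ring.
Qed.

Hypotheses (h1 : 0 < m1) (h2 : m1 < m2) (h3 : 0 < l1 + m1).

Lemma sos_density_ge0 x : 0 <= sos_density M G x.
Proof.
have k1 : 0 <= l1 + 2 * m1 by have := h1; have := h3; lra.
have k2 : 0 <= m2 - m1 by have := h2; lra.
rewrite /sos_density; apply: addr_ge0; last by rewrite mulr_ge0 ?sqr_ge0// ltW.
by have [->|->] := chi01 x; rewrite ?subr0 ?subrr ?mul0r ?mul1r ?add0r ?addr0 mulr_ge0// ?addr_ge0 ?sqr_ge0.
Qed.

Lemma sos_density_eq0 x : sos_density M G x = 0 -> b x = c x /\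
  if chi x == 1 then a x + d x = 0 else a x = d x /\ b x = 0.
Proof.
have k1 : 0 < l1 + 2 * m1 by have := h1; have := h3; lra.
have k2 : 0 < m2 - m1 by have := h2; lra.
have k3 := h1.
rewrite /sos_density -/a -/b -/c -/d; set t := (a x + d x); set u := (a x - d x); set s := (b x + c x); set w := (b x - c x).
have t0 := sqr_ge0 t; have u0 := sqr_ge0 u; have s0 := sqr_ge0 s; have w0 := sqr_ge0 w.
have sq0 (y : R) : y ^+ 2 = 0 -> y = 0 by move=> /eqP; rewrite sqrf_eq0 => /eqP.
have [->|->] := chi01 x; rewrite ?subr0 ?subrr ?mul0r ?mul1r ?add0r ?addr0 ?eqxx => E.
  rewrite eq_sym oner_eq0.
  have p1 : 0 <= (m2 - m1) * (u ^+ 2 + s ^+ 2) by apply: mulr_ge0; [exact: ltW|exact: addr_ge0].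
  have p2 : 0 <= m1 * w ^+ 2 by apply: mulr_ge0 => //; exact: ltW.
  have /eqP : m1 * w ^+ 2 = 0 by lra.
  rewrite mulf_eq0 gt_eqF//= => /eqP/sq0 w00.
  have /eqP : (m2 - m1) * (u ^+ 2 + s ^+ 2) = 0 by lra.
  rewrite mulf_eq0 gt_eqF//= => /eqP us.
  have u00 : u = 0 by apply: sq0; lra.
  have s00 : s = 0 by apply: sq0; lra.
  by move: w00 u00 s00; rewrite /w /u /s; split; [|split]; lra.
have p1 : 0 <= (l1 + 2 * m1) * t ^+ 2 by apply: mulr_ge0 => //; exact: ltW.
have p2 : 0 <= m1 * w ^+ 2 by apply: mulr_ge0 => //; exact: ltW.
have /eqP : m1 * w ^+ 2 = 0 by lra.
rewrite mulf_eq0 gt_eqF//= => /eqP/sq0 w00.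
have /eqP : (l1 + 2 * m1) * t ^+ 2 = 0 by lra.
rewrite mulf_eq0 gt_eqF//= => /eqP/sq0 t00.
by move: w00; rewrite /w; split; [lra|exact: t00].
Qed.

Lemma sos_density_rigid : \int[leb2]_(x in cell) sos_density M G x = 0 ->
  {ae leb2, forall x, cell x -> b x = c x /\
    if chi x == 1 then a x + d x = 0 else a x = d x /\ b x = 0}.
Proof.
move=> /(Rintegral_eq0_ae mC sos_density_integrable (fun x _ => sos_density_ge0 x)).
by apply: ae_mono => x h Dx; exact: sos_density_eq0 (h Dx).
Qed.

End TwoPhase.

Section Rigidity.
Variables (l1 m1 l2 m2 : R) (Omega : set (torus R)).
Hypotheses (hopen : open Omega) (h1 : 0 < m1) (h2 : m1 < m2) (h3 : 0 < l1 + m1).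

(** A field that is symmetric almost everywhere cannot have mean e1 (x) e2. *)
Lemma shear_rigid v G : H1_gradient v G ->
  \int[leb2]_(x in cell) sos_density l1 m1 m2 Omega (delta_mx 0 1) G x != 0.
Proof.
move=> vG; apply/eqP => /(sos_density_rigid hopen vG h1 h2 h3) bc.
have s p q := total_field_sqint (delta_mx 0 1) vG p q.
have : ip (cst 1) (total_field (delta_mx 0 1) G 0 1) = ip (cst 1) (total_field (delta_mx 0 1) G 1 0).
  by apply: ip_ae_eq => //; apply: ae_mono bc => x h Dx; have [-> _] := h Dx.
by rewrite !(total_field_mean _ vG) !mxE !eqxx/= => /eqP; rewrite oner_eq0.
Qed.

Hypotheses (hlip : Lipschitz_boundary Omega) (hconn : connected (~` Omega)).

(** Where the density vanishes, the field is symmetric, traceless in phase 1 and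
    scalar in phase 2; being curl-free by rows it is a constant multiple of the
    identity in phase 2. *)
Lemma dilation_cst M v G : H1_gradient v G ->
  \int[leb2]_(x in cell) sos_density l1 m1 m2 Omega M G x = 0 ->
  exists k, {ae leb2, forall x, cell x ->
    total_field M G 0 0 x + total_field M G 1 1 x = 2 * k * (1 - chi Omega x)}.
Proof.
move=> vG I0; have Hc := sos_density_rigid hopen vG h1 h2 h3 I0.
pose B : set plane := @torus_pi R @^-1` (~` Omega).
have chiB x : B x -> chi Omega x = 0.
  by move=> Bx; rewrite /chi /torus_lift /= indicE memNset.
have H0 : {ae leb2, forall x, B x ->
    [/\ total_field M G 0 1 x = 0, total_field M G 1 0 x = 0 & total_field M G 0 0 x = total_field M G 1 1 x]}.
  apply: negligible_periodic.
    move=> x y xy /=.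
    rewrite !(total_field_periodic M G _ _ xy).
    by rewrite (_ : B x = B y)//; exact: (torus_lift_periodic (~` Omega) xy).
  have [N [mN N0 sN]] := Hc.
  exists N; split=> // x [nx Dx]; apply: sN => /= h; apply: nx => Bx.
  have [<-] := h Dx; rewrite (chiB _ Bx) eq_sym oner_eq0 => -[-> ->].
  by [].
have [k Hk] := scalar_field_cst hlip hconn (@total_field_periodic M G 0 0)
  (total_field_curlfree M vG 0) (total_field_curlfree M vG 1) H0.
exists k; apply: ae_mono (ae_and Hc (ae_and H0 Hk)) => x [hc [h0 hk]] Dx.
have [_ +] := hc Dx; have [e|e] := chi01 Omega x; rewrite e ?eqxx.
  move=> _; have Bx : B x.
    by move=> Ox; move/eqP: e; rewrite /chi /torus_lift /= indicE mem_set// oner_eq0.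
  by have [_ _ <-] := h0 Bx; rewrite (hk Bx); ring.
by move=> ->; ring.
Qed.

(** Both mean traces are 1, which makes phase 2 non-null and the two constants
    equal. The difference of the two gradients is then symmetric and traceless,
    so that its determinant, of mean zero, is minus a sum of squares; hence it
    vanishes, although its first entry is -1 in phase 2. *)
Lemma dilation_rigid v1 G1 v2 G2 : H1_gradient v1 G1 -> H1_gradient v2 G2 ->
  \int[leb2]_(x in cell) sos_density l1 m1 m2 Omega (delta_mx 0 0) G1 x = 0 ->
  \int[leb2]_(x in cell) sos_density l1 m1 m2 Omega (delta_mx 1 1) G2 x = 0 -> False.
Proof.
move=> vG1 vG2 I1 I2.
have [k1 H1] := dilation_cst vG1 I1.
have [k2 H2] := dilation_cst vG2 I2.
have S1 := sos_density_rigid hopen vG1 h1 h2 h3 I1.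
have S2 := sos_density_rigid hopen vG2 h1 h2 h3 I2.
pose F1 := total_field (delta_mx 0 0) G1; pose F2 := total_field (delta_mx 1 1) G2.
have s1 p q : sq (F1 p q) by exact: total_field_sqint vG1 p q.
have s2 p q : sq (F2 p q) by exact: total_field_sqint vG2 p q.
pose w : plane -> R := cst 1 \- chi Omega.
have sw : sq w.
  apply: sqintB => //; apply: (@sqint_bounded _ _ _ leb2 cell mC fC _ 1) => //.
    by apply: measurable_funTS; exact: chi_measurable.
  by move=> x _; have [->|->] := chi01 Omega x; rewrite ?normr0 ?normr1.
have T (F : 'I_2 -> 'I_2 -> plane -> R) k : (forall p q, sq (F p q)) ->
    {ae leb2, forall x, cell x -> F 0 0 x + F 1 1 x = 2 * k * (1 - chi Omega x)} ->
    ip (cst 1) (F 0 0) + ip (cst 1) (F 1 1) = 2 * k * ip (cst 1) w.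
  move=> sF HF; rewrite -ipDr// -ipZr//; apply: ip_ae_eq => //.
  - exact: sqintD.
  - exact: sqintZ.
  by apply: ae_mono HF => x h Dx /=; rewrite (h Dx).
have := T F1 k1 s1 H1; have := T F2 k2 s2 H2.
rewrite /F1 /F2 !(total_field_mean _ vG1) !(total_field_mean _ vG2) !mxE !eqxx/= add0r addr0 => E2 E1.
(* The mean of w is the area fraction of phase 2. *)
have w0 : ip (cst 1) w != 0 by apply/eqP => w0; move: E1; rewrite w0 mulr0 => /eqP; rewrite oner_eq0.
have k12 : k1 = k2.
  have : (k1 - k2) * (2 * ip (cst 1) w) = 0 by rewrite mulrBl; move: E1 E2; lra.
  by move/eqP; rewrite mulf_eq0 mulf_eq0 (negbTE w0) pnatr_eq0 !orbF subr_eq0 => /eqP.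
pose g1 p q := torus_lift (fun z : torus R => G1 z p q).
pose g2 p q := torus_lift (fun z : torus R => G2 z p q).
pose D p q : plane -> R := g1 p q \- g2 p q.
have wD p := weak_gradB (H1_gradient_weak_grad p vG1) (H1_gradient_weak_grad p vG2).
have sD p q : sq (D p q).
  by have [_ sG1 _] := vG1; have [_ sG2 _] := vG2; apply: sqintB => //; [exact: sG1|exact: sG2].
have DE p q x : D p q x = F1 p q x - F2 p q x - (delta_mx 0 0 p q - delta_mx 1 1 p q).
  by rewrite /D /F1 /F2 /total_field /g1 /g2 /torus_lift /= ![(_ + _ : 'M[R]_2) _ _]mxE; ring.
(* The mean of det D is zero. *)
have N : ip (D 0 0) (D 1 1) = ip (D 0 1) (D 1 0) by exact: null_lagrangian (wD 0) (wD 1).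
have HD : {ae leb2, forall x, cell x -> D 1 0 x = D 0 1 x /\ D 1 1 x = - D 0 0 x}.
  apply: ae_mono (ae_and (ae_and H1 H2) (ae_and S1 S2)) => x [[t1 t2] [b1 b2]] Dx.
  have {}t1 := t1 Dx; have {}t2 := t2 Dx; have [{}b1 _] := b1 Dx; have [{}b2 _] := b2 Dx.
  rewrite !DE /F1 /F2 !mxE !eqxx/= b1 b2; split=> //.
  by move: t1 t2; rewrite k12; lra.
have D00 : {ae leb2, forall x, cell x -> D 0 0 x = 0}.
  apply: ip_eq0_ae => //.
  have e1 : ip (D 0 0) (D 1 1) = - ip (D 0 0) (D 0 0).
    rewrite -mulN1r -ipZr//; apply: ip_ae_eq => //; first exact: sqintZ.
    by apply: ae_mono HD => x h Dx; have [_ ->] := h Dx; rewrite /= mulN1r.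
  have e2 : ip (D 0 1) (D 1 0) = ip (D 0 1) (D 0 1).
    by apply: ip_ae_eq => //; apply: ae_mono HD => x h Dx; have [-> _] := h Dx.
  have p1 := ip_ge0 leb2 cell (D 0 0); have p2 := ip_ge0 leb2 cell (D 0 1).
  by move: N; rewrite e1 e2; lra.
move/eqP: w0; apply; rewrite (_ : ip _ _ = ip (cst 1) (cst 0)).
  by rewrite ip_cstr// mul0r.
apply: ip_ae_eq => //.
apply: ae_mono (ae_and D00 (ae_and (ae_and H1 H2) (ae_and S1 S2))) => x [d0 [[t1 t2] [b1 b2]]] Dx.
have {}d0 := d0 Dx; have {}t1 := t1 Dx; have {}t2 := t2 Dx.
have [_ +] := b1 Dx; have [_ +] := b2 Dx; rewrite /w /= mul1r mul1r.
move: t1 t2; have [->|->] := chi01 Omega x; last by rewrite subrr.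
rewrite eq_sym oner_eq0 => t1 t2 [c1 _] [c2 _].
move: d0; rewrite DE /F1 /F2 !mxE !eqxx/=.
by move: t1 t2; rewrite c1 c2 k12; lra.
Qed.

End Rigidity.
End Energy.

Theorem theorem2p2 (R : realType) (lambda1 mu1 lambda2 mu2 : R)
  (hmu1 : 0 < mu1)
  (hmu1K2 : mu1 = - bulk_modulus lambda2 mu2)
  (hK2mu2 : - bulk_modulus lambda2 mu2 < mu2)
  (hK1 : 0 < bulk_modulus lambda1 mu1)
  (Omega : set (torus R))
  (hopen : open Omega)
  (hlip : Lipschitz_boundary Omega)
  (hconn : connected [set x : torus R | \1_Omega x = 0 :> R])
  (Lstar : tensor4 R)
  (hhom : is_homogenized
            (two_phase (\1_Omega : torus R -> R)
               (iso_tensor lambda1 mu1) (iso_tensor lambda2 mu2)) Lstar)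
  (lambdas mus : R)
  (hiso : Lstar = iso_tensor lambdas mus) :
  0 < bulk_modulus lambdas mus + mus /\ strictly_strongly_elliptic Lstar.
Proof.
subst Lstar.
have hm : lambda2 + mu2 = - mu1 by rewrite hmu1K2 opprK.
have h2 : mu1 < mu2 by rewrite hmu1K2.
have hcompl : [set x | \1_Omega x = 0 :> R] = ~` Omega.
  apply/seteqP; split=> x /=; rewrite indicE.
    by case: (boolP (x \in Omega)) => [_ /eqP|/negP nx _ Ox]; [rewrite oner_eq0|apply: nx; rewrite inE].
  by move=> nx; rewrite memNset.
rewrite hcompl in hconn.
pose E M G := Rintegral (leb2 R) (@cell R) (sos_density lambda1 mu1 mu2 Omega M G).
have min M : exists v G, H1_gradient v G /\
    mxdot M (tensor_act (iso_tensor lambdas mus) M) + 4 * mu1 * (M 0 0 * M 1 1 - M 0 1 * M 1 0) = E M G.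
  have [[v [G [vG ->]]] _] := hhom.2 M; exists v, G; split=> //.
  by apply: energy_sos => //; exact: vG.
have E0 M G : 0 <= E M G by apply: Rintegral_ge0 => x _; exact: sos_density_ge0.
(* These matrices have determinant zero. The first two probe Kstar + mustar, the
   third one probes mustar. *)
have [v1 [G1 [vG1 e1]]] := min (delta_mx 0 0).
have [v2 [G2 [vG2 e2]]] := min (delta_mx 1 1).
have [v3 [G3 [vG3 e3]]] := min (delta_mx 0 1).
move: e1 e2 e3; rewrite !mxdot_iso !mxE !eqxx/= => e1 e2 e3.
have mus0 : 0 < mus.
  rewrite lt_neqAle; apply/andP; split.
    apply/eqP => m0; have /eqP := shear_rigid hopen hmu1 h2 hK1 vG3; apply.
    by rewrite -[LHS]/(E _ _) -e3 -m0; ring.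
  by have := E0 (delta_mx 0 1) G3; rewrite -e3; lra.
have K0 : 0 < lambdas + mus + mus.
  rewrite lt_neqAle; apply/andP; split.
    apply/eqP => k0; apply: (dilation_rigid hopen hmu1 h2 hK1 hlip hconn vG1 vG2).
      by rewrite -[LHS]/(E _ _) -e1; lra.
    by rewrite -[LHS]/(E _ _) -e2; lra.
  by have := E0 (delta_mx 0 0) G1; rewrite -e1; lra.
by split; [exact: K0|exact: iso_strongly_elliptic].
Qed.
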